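(* Let $A$ be an algebra over an algebraically closed field $K$ and let $\{e_1,e_2,\ldots,e_n\}$ be a complete set of pairwise orthogonal primitive idempotents of $A$. If $A$ is non-sincere, then $A$ is $\tau$-tilting finite if and only if $A/Ae_iA$ is $\tau$-tilting finite for every $1\leqslant i\leqslant n$.
   Context: $K$ is an algebraically closed field; an algebra is an associative finite-dimensional basic $K$-algebra with identity, and modules are finitely generated right modules. An algebra $A$ is sincere if there is an indecomposable $A$-module $M$ such that all simple $A$-modules appear in $M$ as composition factors; otherwise $A$ is non-sincere. $\tau$ denotes the Auslander–Reiten translation and $|M|$ the number of isomorphism classes of indecomposable direct summands of $M$. For an $A$-module $M$, let $e$ be an idempotent of $A$ such that the direct summands of $eA/(e\,\mathrm{rad}\,A)$ are exactly the composition factors of $M$, and let $A_M:=A/A(1-e)A$. $M$ is support $\tau$-tilting if $\mathrm{Hom}_{A_M}(M,\tau M)=0$ ($\tau$ taken over $A_M$) and $|M|=|A_M|$; it is $\tau$-tilting if moreover $A_M=A$. $A$ is $\tau$-tilting finite if it has only finitely many pairwise non-isomorphic basic $\tau$-tilting modules. *)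

(* Defs.v *)
From HB Require Import structures.
From mathcomp Require Import all_boot all_algebra.

Set Implicit Arguments.
Unset Strict Implicit.
Unset Printing Implicit Defensive.

Import GRing.Theory.
Local Open Scope ring_scope.

(* The library's falgType (like algType) requires 1 != 0, but the zero algebra
   occurs as A/AeA, so finite-dimensional algebras are introduced directly on
   top of vectType. *)
HB.mixin Record Vector_isFdAlgebra (K : fieldType) A of Vector K A := {
  fdone : A;
  fdmul : A -> A -> A;
  fdmulA : associative fdmul;
  fdmul1l : left_id fdone fdmul;
  fdmul1r : right_id fdone fdmul;
  fdmulDl : left_distributive fdmul +%R;
  fdmulDr : right_distributive fdmul +%R;
  fdscaleAl : forall (k : K) (a b : A), k *: fdmul a b = fdmul (k *: a) b;
  fdscaleAr : forall (k : K) (a b : A), k *: fdmul a b = fdmul a (k *: b)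
}.

#[short(type="fdalgType")]
HB.structure Definition FdAlgebra (K : fieldType) :=
  { A of Vector K A & Vector_isFdAlgebra K A }.

HB.instance Definition _ (K : fieldType) (A : fdalgType K) :=
  GRing.Zmodule_isPzRing.Build (FdAlgebra.sort A)
    fdmulA fdmul1l fdmul1r fdmulDl fdmulDr.

(* The opposite algebra lives on the library's converse ring A^c. *)
HB.instance Definition _ (K : fieldType) (A : fdalgType K) := Vector.on A^c.
HB.instance Definition _ (K : fieldType) (A : fdalgType K) :=
  Vector_isFdAlgebra.Build K A^c
    (fun a b c : A => esym (fdmulA c b a)) (fun a : A => fdmul1r a) (fun a : A => fdmul1l a)
    (fun a b c : A => fdmulDr c a b) (fun a b c : A => fdmulDl b c a)
    (fun k (a b : A) => fdscaleAr k b a) (fun k (a b : A) => fdscaleAl k b a).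

Section AlgebraTheory.
Variables (K : fieldType) (A : fdalgType K).

Lemma fdscalerAl (k : K) (a b : A) : k *: (a * b) = (k *: a) * b.
Proof. exact: fdscaleAl. Qed.

Lemma fdscalerAr (k : K) (a b : A) : k *: (a * b) = a * (k *: b).
Proof. exact: fdscaleAr. Qed.

Definition lmul_fun (a x : A) := a * x.

Fact lmul_is_linear (a : A) : linear (lmul_fun a).
Proof. by move=> k x y; rewrite /lmul_fun mulrDr -fdscalerAr. Qed.
HB.instance Definition _ (a : A) := GRing.isSemilinear.Build K A A _
  (lmul_fun a) (GRing.semilinear_linear (lmul_is_linear a)).

Definition lmul (a : A) : 'End(A) := linfun (lmul_fun a).

Lemma lmulE a x : lmul a x = a * x.
Proof. by rewrite lfunE. Qed.

Definition rmul_fun (a x : A) := x * a.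

Fact rmul_is_linear (a : A) : linear (rmul_fun a).
Proof. by move=> k x y; rewrite /rmul_fun mulrDl -fdscalerAl. Qed.
HB.instance Definition _ (a : A) := GRing.isSemilinear.Build K A A _
  (rmul_fun a) (GRing.semilinear_linear (rmul_is_linear a)).

Definition rmul (a : A) : 'End(A) := linfun (rmul_fun a).

Lemma rmulE a x : rmul a x = x * a.
Proof. by rewrite lfunE. Qed.

Definition idempotent (e : A) := e * e = e.

Definition primitive_idempotent (e : A) :=
  [/\ idempotent e, e <> 0 &
      forall f g, idempotent f -> idempotent g -> f * g = 0 -> g * f = 0 ->
        e = f + g -> f = 0 \/ g = 0].

Definition complete_primitive_orthogonal n (e : 'I_n -> A) :=
  [/\ forall i, primitive_idempotent (e i),
      forall i j, i != j -> e i * e j = 0 &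
      \sum_i e i = 1].

End AlgebraTheory.

Section QuotientSpace.
Variables (K : fieldType) (V : vectType K) (U : {vspace V}).

(* V/U is realised on the chosen complement U^C. *)
Definition quov := subvs_of (U^C)%VS.
HB.instance Definition _ := Vector.on quov.

Definition quopi (x : V) : quov := vsproj (U^C)%VS (daddv_pi (U^C)%VS U x).

Fact quopi_is_linear : linear quopi.
Proof. by move=> k x y; rewrite /quopi !linearP. Qed.
HB.instance Definition _ := GRing.isSemilinear.Build K V quov _ quopi
  (GRing.semilinear_linear quopi_is_linear).

Definition quorep (y : quov) : V := vsval y.

Fact quorep_is_linear : linear quorep.
Proof. by move=> k x y; rewrite /quorep linearP. Qed.
HB.instance Definition _ := GRing.isSemilinear.Build K quov V _ quorep
  (GRing.semilinear_linear quorep_is_linear).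

Fact quo_cap0 : (U^C :&: U)%VS = 0%VS.
Proof. by rewrite capvC capv_compl. Qed.

Lemma quorepK : cancel quorep quopi.
Proof.
move=> y; apply/val_inj; rewrite /= vsprojK ?memv_pi //.
by rewrite daddv_pi_id ?quo_cap0 //; apply: valP.
Qed.

Lemma quopi_eq0 x : (quopi x == 0) = (x \in U).
Proof.
have defx : daddv_pi (U^C) U x + daddv_pi U (U^C) x = x.
  by apply: daddv_pi_add; rewrite ?quo_cap0 // addvC addv_complf memvf.
have -> : (quopi x == 0) = (daddv_pi (U^C) U x == 0).
  by rewrite -(inj_eq val_inj) /= vsprojK ?memv_pi.
apply/eqP/idP=> [x0|xU]; first by rewrite -defx x0 add0r memv_pi.
have E : daddv_pi U (U^C) x = x by apply: daddv_pi_id; rewrite ?capv_compl.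
by apply: (addIr x); rewrite add0r -{2}E defx.
Qed.

Lemma quopiP x y : x - y \in U -> quopi x = quopi y.
Proof. by rewrite -quopi_eq0 linearB subr_eq0 => /eqP. Qed.

Lemma quorepP x : quorep (quopi x) - x \in U.
Proof. by rewrite -quopi_eq0 linearB /= quorepK subrr. Qed.

End QuotientSpace.

Record ideal (K : fieldType) (A : fdalgType K) := Ideal {
  ideal_vs :> {vspace A};
  idealMl : forall a x, x \in ideal_vs -> a * x \in ideal_vs;
  idealMr : forall x a, x \in ideal_vs -> x * a \in ideal_vs
}.

Section QuotientAlgebra.
Variables (K : fieldType) (A : fdalgType K) (I : ideal A).

Definition quoalg := quov I.
HB.instance Definition _ := Vector.on quoalg.

Implicit Types x y z : quoalg.

Definition qone : quoalg := quopi I 1.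
Definition qmul x y : quoalg := quopi I (quorep x * quorep y).

Lemma qmul_pi (a b : A) : qmul (quopi I a) (quopi I b) = quopi I (a * b).
Proof.
apply: quopiP.
set a' := quorep _; set b' := quorep _.
have -> : a' * b' - a * b = (a' - a) * b' + a * (b' - b).
  by rewrite mulrBl mulrBr addrA subrK.
by apply: memvD; [apply: idealMr|apply: idealMl]; apply: quorepP.
Qed.

Fact qmulA : associative qmul.
Proof.
move=> x y z; rewrite -(quorepK x) -(quorepK y) -(quorepK z).
by rewrite !qmul_pi mulrA.
Qed.

Fact qmul1l : left_id qone qmul.
Proof. by move=> x; rewrite -(quorepK x) qmul_pi mul1r. Qed.

Fact qmul1r : right_id qone qmul.
Proof. by move=> x; rewrite -(quorepK x) qmul_pi mulr1. Qed.

Fact qmulDl : left_distributive qmul +%R.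
Proof. by move=> x y z; rewrite /qmul linearD mulrDl linearD. Qed.

Fact qmulDr : right_distributive qmul +%R.
Proof. by move=> x y z; rewrite /qmul linearD mulrDr linearD. Qed.

Fact qscaleAl (k : K) x y : k *: qmul x y = qmul (k *: x) y.
Proof. by rewrite /qmul linearZ /= -fdscalerAl linearZ. Qed.

Fact qscaleAr (k : K) x y : k *: qmul x y = qmul x (k *: y).
Proof. by rewrite /qmul linearZ /= -fdscalerAr linearZ. Qed.

HB.instance Definition _ := Vector_isFdAlgebra.Build K quoalg
  qmulA qmul1l qmul1r qmulDl qmulDr qscaleAl qscaleAr.

End QuotientAlgebra.

Section IdempotentIdeal.
Variables (K : fieldType) (A : fdalgType K) (e : A).

Definition AeA_vs : {vspace A} :=
  <<[seq a * e * b | a <- vbasis {:A}, b <- vbasis {:A}]>>%VS.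

Lemma mem_AeA a b : a * e * b \in AeA_vs.
Proof.
rewrite (coord_vbasis (memvf a)) (coord_vbasis (memvf b)).
rewrite !mulr_suml; apply: memv_suml => i _; rewrite mulr_sumr.
apply: memv_suml => j _; rewrite -fdscalerAr -!fdscalerAl.
do 2![apply: memvZ]; apply/memv_span/allpairsP.
by exists ((vbasis {:A})`_i, (vbasis {:A})`_j); rewrite /= !mem_nth ?size_tuple.
Qed.

Lemma AeA_least (U : {vspace A}) :
  (forall a b, a * e * b \in U) -> (AeA_vs <= U)%VS.
Proof. by move=> eU; apply/span_subvP => _ /allpairsP[[a b] [_ _ ->]]. Qed.

Fact AeA_Ml a x : x \in AeA_vs -> a * x \in AeA_vs.
Proof.
suff /subvP sub : (AeA_vs <= lmul a @^-1: AeA_vs)%VS.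
  by move=> /sub; rewrite -memv_preim lmulE.
by apply: AeA_least => b c; rewrite -memv_preim lmulE !mulrA mem_AeA.
Qed.

Fact AeA_Mr x a : x \in AeA_vs -> x * a \in AeA_vs.
Proof.
suff /subvP sub : (AeA_vs <= rmul a @^-1: AeA_vs)%VS.
  by move=> /sub; rewrite -memv_preim rmulE.
by apply: AeA_least => b c; rewrite -memv_preim rmulE -mulrA mem_AeA.
Qed.

Definition AeA : ideal A := Ideal AeA_Ml AeA_Mr.

End IdempotentIdeal.

(* Over a finite-dimensional algebra, finitely generated right modules are the
   finite-dimensional ones. *)
Record rmod (K : fieldType) (A : fdalgType K) := RMod {
  rmod_vect :> vectType K;
  ract : rmod_vect -> A -> rmod_vect;
  ract_linl : forall a, linear (ract^~ a);
  ract_linr : forall x, linear (ract x);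
  ract1 : forall x, ract x 1 = x;
  ractM : forall x a b, ract x (a * b) = ract (ract x a) b
}.

Record hom (K : fieldType) (A : fdalgType K) (M N : rmod A) := Hom {
  hom_lfun :> 'Hom(M, N);
  homP : forall x a, hom_lfun (ract x a) = ract (hom_lfun x) a
}.

Record smod (K : fieldType) (A : fdalgType K) (M : rmod A) := SMod {
  smod_vs :> {vspace M};
  smodP : forall x a, x \in smod_vs -> ract x a \in smod_vs
}.

Section Modules.
Variables (K : fieldType) (A : fdalgType K).
Implicit Types M N P S X Y : rmod A.

Definition injective_hom M N (f : hom M N) := lker f = 0%VS.
Definition surjective_hom M N (f : hom M N) := limg f = fullv.
Definition iso M N := exists f : hom M N, injective_hom f /\ surjective_hom f.

Definition zero_rmod M := ({:M} = 0)%VS.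

Definition ract_by M (a : A) (x : M) : M := ract x a.

Fact ract_by_is_linear M a : linear (@ract_by M a).
Proof. exact: ract_linl. Qed.
HB.instance Definition _ M a := GRing.isSemilinear.Build K M M _
  (@ract_by M a) (GRing.semilinear_linear (@ract_by_is_linear M a)).

Fact ract_is_linear M (x : M) : linear (ract x).
Proof. exact: ract_linr. Qed.
HB.instance Definition _ M (x : M) := GRing.isSemilinear.Build K A M _
  (ract x) (GRing.semilinear_linear (@ract_is_linear M x)).

Lemma ractPl M k (x y : M) a : ract (k *: x + y) a = k *: ract x a + ract y a.
Proof. exact: (@ract_linl K A M a k x y). Qed.

Lemma ractPr M (x : M) k a b : ract x (k *: a + b) = k *: ract x a + ract x b.
Proof. exact: (@ract_linr K A M x k a b). Qed.

Definition ractf M (a : A) : 'End(M) := linfun (@ract_by M a).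

Lemma ractfE M a x : ractf M a x = ract x a.
Proof. by rewrite lfunE. Qed.

Definition regmod : rmod A :=
  @RMod K A A (fun x a => x * a) (@rmul_is_linear K A)
    (@lmul_is_linear K A) (@mulr1 A) (@mulrA A).

Section Sub.
Variables (M : rmod A) (U : smod M).

Definition sub_act (x : subvs_of U) (a : A) : subvs_of U :=
  vsproj U (ract (vsval x) a).

Lemma sub_actE x a : vsval (sub_act x a) = ract (vsval x) a.
Proof. by rewrite vsprojK // smodP ?subvsP. Qed.

Fact sub_linl a : linear (sub_act^~ a).
Proof. by move=> k x y; rewrite /sub_act linearP ractPl linearP. Qed.
Fact sub_linr x : linear (sub_act x).
Proof. by move=> k a b; rewrite /sub_act ractPr linearP. Qed.
Fact sub_act1 x : sub_act x 1 = x.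
Proof. by apply: subvs_inj; rewrite sub_actE ract1. Qed.
Fact sub_actM x a b : sub_act x (a * b) = sub_act (sub_act x a) b.
Proof. by apply: subvs_inj; rewrite !sub_actE ractM. Qed.

Definition submod : rmod A := RMod sub_linl sub_linr sub_act1 sub_actM.

Definition quo_act (x : quov U) (a : A) : quov U :=
  quopi U (ract (quorep x) a).

Lemma quo_act_pi (x : M) a : quo_act (quopi U x) a = quopi U (ract x a).
Proof.
apply: quopiP; have := smodP a (quorepP U x).
by rewrite -!ractfE linearB.
Qed.

Fact quo_linl a : linear (quo_act^~ a).
Proof. by move=> k x y; rewrite /quo_act linearP ractPl linearP. Qed.
Fact quo_linr x : linear (quo_act x).
Proof. by move=> k a b; rewrite /quo_act ractPr linearP. Qed.
Fact quo_act1 x : quo_act x 1 = x.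
Proof. by rewrite -(quorepK x) quo_act_pi ract1. Qed.
Fact quo_actM x a b : quo_act x (a * b) = quo_act (quo_act x a) b.
Proof. by rewrite -(quorepK x) !quo_act_pi ractM. Qed.

Definition quomod : rmod A := RMod quo_linl quo_linr quo_act1 quo_actM.

End Sub.

Fact zero_smodP M (x : M) a : x \in 0%VS -> ract x a \in 0%VS.
Proof. by rewrite !memv0 => /eqP->; rewrite -ractfE linear0. Qed.
Definition zero_smod M : smod M := SMod (@zero_smodP M).

Fact full_smodP M (x : M) a : x \in fullv -> ract x a \in fullv.
Proof. by move=> _; apply: memvf. Qed.
Definition full_smod M : smod M := SMod (@full_smodP M).

Fact himg_smodP M N (f : hom M N) (U : smod M) y a :
  y \in (f @: U)%VS -> ract y a \in (f @: U)%VS.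
Proof.
by move=> /memv_imgP[x xU ->]; rewrite -homP memv_img // smodP.
Qed.
Definition himg M N (f : hom M N) (U : smod M) : smod N :=
  SMod (@himg_smodP M N f U).

Fact hker_smodP M N (f : hom M N) x a : x \in lker f -> ract x a \in lker f.
Proof. by rewrite !memv_ker homP => /eqP->; rewrite -ractfE linear0. Qed.
Definition hker M N (f : hom M N) : smod M := SMod (@hker_smodP M N f).

Fact preim_smodP M (U V : smod M) (x : submod U) a :
  x \in (linfun vsval @^-1: V)%VS -> ract x a \in (linfun vsval @^-1: V)%VS.
Proof. by rewrite -!memv_preim !lfunE /= sub_actE; apply: smodP. Qed.

(* U/V for submodules V <= U of M. *)
Definition subquo M (U V : smod M) : rmod A :=
  quomod (SMod (@preim_smodP M U V)).

Section DirectSum.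
Variables (M N : rmod A).

Definition dsum_act (x : M * N) (a : A) : M * N := (ract x.1 a, ract x.2 a).

Fact dsum_linl a : linear (dsum_act^~ a).
Proof. by move=> k x y; congr pair; apply: ractPl. Qed.
Fact dsum_linr x : linear (dsum_act x).
Proof. by move=> k a b; congr pair; apply: ractPr. Qed.
Fact dsum_act1 x : dsum_act x 1 = x.
Proof. by case: x => x y; rewrite /dsum_act !ract1. Qed.
Fact dsum_actM x a b : dsum_act x (a * b) = dsum_act (dsum_act x a) b.
Proof. by rewrite /dsum_act !ractM. Qed.

Definition dsum : rmod A := RMod dsum_linl dsum_linr dsum_act1 dsum_actM.

End DirectSum.

Definition zeromod : rmod A := submod (zero_smod regmod).

Fixpoint bigdsum n : (nat -> rmod A) -> rmod A :=
  if n is n'.+1 then fun F => dsum (F 0%N) (bigdsum n' (fun i => F i.+1))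
  else fun _ => zeromod.

Definition direct_summand X M := exists Y, iso M (dsum X Y).

Definition indecomposable M :=
  ~ zero_rmod M /\
  forall X Y, iso M (dsum X Y) -> zero_rmod X \/ zero_rmod Y.

Definition simple S :=
  ~ zero_rmod S /\
  forall U : smod S, U = 0%VS :> {vspace S} \/ U = fullv :> {vspace S}.

Definition composition_series M m (U : nat -> smod M) :=
  [/\ U 0%N = 0%VS :> {vspace M}, U m = fullv :> {vspace M} &
      forall i, (i < m)%N ->
        (U i <= U i.+1)%VS /\ simple (subquo (U i.+1) (U i))].

Definition composition_factor S M :=
  exists m U, @composition_series M m U /\
    exists2 i, (i < m)%N & iso S (subquo (U i.+1) (U i)).

(* |M| = n, as a relation *)
Definition num_summands M n :=
  exists X : 'I_n -> rmod A,
    [/\ forall i, indecomposable (X i) /\ direct_summand (X i) M,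
        forall i j, iso (X i) (X j) -> i = j &
        forall Y, indecomposable Y -> direct_summand Y M ->
          exists i, iso Y (X i)].

Definition basic_module M :=
  exists m (X : nat -> rmod A),
    [/\ forall i, (i < m)%N -> indecomposable (X i),
        forall i j, (i < m)%N -> (j < m)%N -> iso (X i) (X j) -> i = j &
        iso M (bigdsum m X)].

Definition projective P :=
  forall M N (h : hom M N) (f : hom P N), surjective_hom h ->
    exists g : hom P M, (h \o g)%VF = f :> 'Hom(P, N).

Definition superfluous M (L : smod M) :=
  forall X : smod M, (L + X)%VS = fullv -> X = fullv :> {vspace M}.

(* P1 -p1-> P0 -p0-> M -> 0 is exact and p0 : P0 -> M, p1 : P1 -> ker p0 are
   projective covers. *)
Definition minimal_projective_presentation P1 P0 M
    (p1 : hom P1 P0) (p0 : hom P0 M) :=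
  [/\ projective P0, projective P1,
      surjective_hom p0 /\ limg p1 = lker p0,
      superfluous (hker p0) & superfluous (hker p1)].

Section HomSpace.
Variables M N : rmod A.

Definition hom_defect (a : A) (f : 'Hom(M, N)) : 'Hom(M, N) :=
  ((f \o ractf M a) - (ractf N a \o f))%VF.

Lemma hom_defectE a f x : hom_defect a f x = f (ract x a) - ract (f x) a.
Proof.
by rewrite /hom_defect add_lfunE opp_lfunE !comp_lfunE !ractfE.
Qed.

Fact hom_defect_is_linear a : linear (hom_defect a).
Proof.
move=> k f g; apply/lfunP=> x.
transitivity (k *: hom_defect a f x + hom_defect a g x); last first.
  by rewrite [RHS]add_lfunE; congr (_ + _); rewrite [RHS]scale_lfunE.
by rewrite !hom_defectE !add_lfunE !scale_lfunE ractPl scalerBr opprD addrACA.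
Qed.
HB.instance Definition _ a := GRing.isSemilinear.Build K 'Hom(M, N) 'Hom(M, N) _
  (hom_defect a) (GRing.semilinear_linear (hom_defect_is_linear a)).

(* Hom_A(M, N) as a subspace of Hom_K(M, N) *)
Definition homv : {vspace 'Hom(M, N)} :=
  (\bigcap_(i < \dim {:A}) lker (linfun (hom_defect (vbasis {:A})`_i)))%VS.

Lemma homvP (f : 'Hom(M, N)) :
  reflect (forall x a, f (ract x a) = ract (f x) a) (f \in homv).
Proof.
apply: (iffP idP) => [fH x a | fH]; last first.
  rewrite memvE; apply/subv_bigcapP => i _.
  rewrite -memvE memv_ker lfunE; apply/eqP/lfunP=> x.
  by rewrite hom_defectE fH subrr lfunE.
rewrite (coord_vbasis (memvf a)) !linear_sum /=; apply: eq_bigr => i _.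
rewrite !linearZ /=; congr (_ *: _); apply/eqP; rewrite -subr_eq0 -hom_defectE.
move: fH; rewrite memvE => /subv_bigcapP/(_ i isT).
by rewrite -memvE memv_ker lfunE => /eqP->; rewrite lfunE.
Qed.

End HomSpace.

Fact lmul_homP (a : A) (x : regmod) b :
  lmul a (ract x b) = ract (lmul a x : regmod) b.
Proof. by rewrite !lmulE mulrA. Qed.
Definition lmul_hom a : hom regmod regmod :=
  @Hom K A regmod regmod (lmul a) (lmul_homP a).

Definition eJ (e : A) (J : smod regmod) : smod regmod := himg (lmul_hom e) J.
Definition eA (e : A) : smod regmod := eJ e (full_smod regmod).

Definition basic_algebra :=
  exists n (e : 'I_n -> A), complete_primitive_orthogonal e /\
    forall i j, iso (submod (eA (e i))) (submod (eA (e j))) -> i = j.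

Definition maximal_right_ideal (J : smod regmod) :=
  J <> fullv :> {vspace A} /\
  forall L : smod regmod, (J <= L)%VS ->
    L = J :> {vspace A} \/ L = fullv :> {vspace A}.

Definition jacobson_radical (J : smod regmod) :=
  forall x : A, x \in J <->
    forall L : smod regmod, maximal_right_ideal L -> x \in L.

Definition sincere :=
  exists M, indecomposable M /\ forall S, simple S -> composition_factor S M.

End Modules.

Section Dual.
Variables (K : fieldType) (A : fdalgType K) (N : rmod A^c).

(* D N = Hom_K(N, K) for a left A-module N, i.e. a right A^c-module. *)
Definition dual_act (f : 'Hom(N, K^o)) (a : A) : 'Hom(N, K^o) :=
  (f \o ractf N (a : A^c))%VF.

Lemma dual_actE f a x : dual_act f a x = f (ract x (a : A^c)).
Proof. by rewrite comp_lfunE ractfE. Qed.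

Fact dual_linl a : linear (dual_act^~ a).
Proof.
by move=> k f g; apply/lfunP=> x; rewrite dual_actE !add_lfunE !scale_lfunE !dual_actE.
Qed.
Fact dual_linr f : linear (dual_act f).
Proof.
move=> k a b; apply/lfunP=> x.
by rewrite dual_actE ractPr linearP add_lfunE scale_lfunE !dual_actE.
Qed.
Fact dual_act1 f : dual_act f 1 = f.
Proof. by apply/lfunP=> x; rewrite dual_actE ract1. Qed.
Fact dual_actM f a b : dual_act f (a * b) = dual_act (dual_act f a) b.
Proof.
apply/lfunP=> x; rewrite !dual_actE -ractM; congr (f (ract x _)).
Qed.

Definition dual : rmod A := RMod dual_linl dual_linr dual_act1 dual_actM.

End Dual.

Section Transpose.
Variables (K : fieldType) (A : fdalgType K).
Implicit Types M N P : rmod A.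

Section HomA.
Variable M : rmod A.

(* The left A-module Hom_A(M, A), with (a f) x = a (f x). *)
Definition homA_act (f : subvs_of (homv M (regmod A))) (a : A^c) :
    subvs_of (homv M (regmod A)) :=
  vsproj (homv M (regmod A)) (lmul (a : A) \o vsval f)%VF.

Lemma homA_actE f a x : vsval (homA_act f a) x = (a : A) * vsval f x.
Proof.
rewrite vsprojK ?comp_lfunE ?lmulE //.
apply/homvP => y b; rewrite !comp_lfunE !lmulE.
by rewrite (homvP _ (subvsP f)) /= mulrA.
Qed.

Fact homA_linl a : linear (homA_act^~ a).
Proof.
move=> k f g; apply: subvs_inj; apply/lfunP => x.
rewrite homA_actE !linearP /= !add_lfunE !scale_lfunE !homA_actE.
by rewrite mulrDr -fdscalerAr.
Qed.
Fact homA_linr f : linear (homA_act f).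
Proof.
move=> k a b; apply: subvs_inj; apply/lfunP => x.
rewrite homA_actE !linearP /= !add_lfunE !scale_lfunE !homA_actE.
by rewrite mulrDl -fdscalerAl.
Qed.
Fact homA_act1 f : homA_act f 1 = f.
Proof. by apply: subvs_inj; apply/lfunP => x; rewrite homA_actE mul1r. Qed.
Fact homA_actM f a b : homA_act f (a * b) = homA_act (homA_act f a) b.
Proof.
by apply: subvs_inj; apply/lfunP => x; rewrite !homA_actE mulrA.
Qed.

Definition homA : rmod A^c := RMod homA_linl homA_linr homA_act1 homA_actM.

End HomA.

Section Precomposition.
Variables (M N : rmod A) (p : hom M N).

Definition precomp_fun (f : homA N) : homA M :=
  vsproj (homv M (regmod A)) (vsval f \o p)%VF.

Lemma precomp_funE f x : vsval (precomp_fun f) x = vsval f (p x).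
Proof.
rewrite vsprojK ?comp_lfunE //.
by apply/homvP => y b; rewrite !comp_lfunE homP (homvP _ (subvsP f)).
Qed.

Fact precomp_is_linear : linear precomp_fun.
Proof.
move=> k f g; apply: subvs_inj; apply/lfunP => x.
by rewrite precomp_funE !linearP /= !add_lfunE !scale_lfunE !precomp_funE.
Qed.
HB.instance Definition _ := GRing.isSemilinear.Build K (homA N) (homA M) _
  precomp_fun (GRing.semilinear_linear precomp_is_linear).

Fact precompP f a :
  linfun precomp_fun (ract f a) = ract (linfun precomp_fun f) a.
Proof.
rewrite !lfunE; apply: subvs_inj; apply/lfunP => x /=.
by rewrite precomp_funE !homA_actE precomp_funE.
Qed.

Definition precomp : hom (homA N) (homA M) := Hom precompP.

(* When p is the map P1 -> P0 of a minimal projective presentation of X, this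
   cokernel of Hom_A(p, A) is Tr X. *)
Definition transpose : rmod A^c := quomod (himg precomp (full_smod (homA N))).

End Precomposition.

(* tau M = D Tr M, which is determined up to isomorphism only. *)
Definition is_tau M (T : rmod A) :=
  exists P1 P0 (p1 : hom P1 P0) (p0 : hom P0 M),
    minimal_projective_presentation p1 p0 /\ iso T (dual (transpose p1)).

Definition tau_rigid M :=
  exists T, is_tau M T /\ forall f : hom M T, f = 0 :> 'Hom(M, T).

End Transpose.

Section Inflation.
Variables (K : fieldType) (A : fdalgType K) (I : ideal A) (N : rmod (quoalg I)).

Definition infl_act (x : N) (a : A) : N := ract x (quopi I a : quoalg I).

Fact infl_linl a : linear (infl_act^~ a).
Proof. by move=> k x y; rewrite /infl_act ractPl. Qed.
Fact infl_linr x : linear (infl_act x).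
Proof. by move=> k a b; rewrite /infl_act linearP ractPr. Qed.
Fact infl_act1 x : infl_act x 1 = x.
Proof. exact: ract1. Qed.
Fact infl_actM x a b : infl_act x (a * b) = infl_act (infl_act x a) b.
Proof. by rewrite /infl_act -ractM; congr ract; rewrite -qmul_pi. Qed.

Definition inflate : rmod A := RMod infl_linl infl_linr infl_act1 infl_actM.

End Inflation.

Section TauTilting.
Variables (K : fieldType) (A : fdalgType K).
Implicit Types M S : rmod A.

(* J = rad A, so that the subquotient is eA/(e rad A). *)
Definition support_idempotent (e : A) M :=
  idempotent e /\
  exists2 J : smod (regmod A), jacobson_radical J &
    forall S, indecomposable S /\ direct_summand S (subquo (eA e) (eJ e J))
              <-> composition_factor S M.

(* Here A_M = A/A(1-e)A, and N is M regarded as an A_M-module; tau_rigid N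
   therefore refers to the translation of A_M. *)
Definition support_tau_tilting_at (e : A) M :=
  support_idempotent e M /\
  exists N : rmod (quoalg (AeA (1 - e))),
    [/\ iso M (inflate N), tau_rigid N &
        exists2 n, num_summands M n & num_summands (regmod (quoalg (AeA (1 - e)))) n].

Definition support_tau_tilting M := exists e, support_tau_tilting_at e M.

Definition tau_tilting M :=
  exists2 e, support_tau_tilting_at e M & AeA (1 - e) = 0%VS :> {vspace A}.

(* Finitely many isomorphism classes: a finite list meets all of them. *)
Definition tau_tilting_finite :=
  exists m (X : 'I_m -> rmod A),
    forall M, tau_tilting M -> basic_module M -> exists i, iso M (X i).

End TauTilting.

(* Main.v *)
(* Call a module X rigid for a class C when Ext^1(X, Fac C) = 0.  Testing this on
   a minimal presentation P1 -> P0 -> X shows that Hom(X, tau X) = 0 if and only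
   if Ext^1(X, Fac X) = 0, a condition that does not mention tau.  Modules over
   A/AeA are closed under extensions when e is idempotent, so a module over A/AeA
   is tau-rigid there if and only if it is tau-rigid over A.

   Every tau-rigid M is a summand of a tau-tilting module T (Bongartz): if P1 -> P0
   presents M and f_1, ..., f_r span Hom(P1, Q), add to M the cokernels of
   P1^r -> P0^r + Q for the indecomposable projectives Q.  To count the
   summands T_k of T, pair g-vectors with modules, g_X(N) = hom(P0, N) - hom(P1, N).
   The g_{T_k} and the hom(Q, -) are integral combinations of each other, and each
   family is independent, so both have the same number of members.

   Hence an algebra is tau-tilting finite if and only if it has finitely many
   indecomposable tau-rigid modules.  If A is non-sincere, every indecomposable
   A-module is annihilated by some e_i, so the indecomposable tau-rigid A-modules
   are exactly those of the algebras A/Ae_iA. *)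

Require Import Defs.
From HB Require Import structures.
From mathcomp Require Import all_boot all_order all_algebra.
From mathcomp Require Import zify.
From Stdlib Require Import Classical ClassicalEpsilon.
Import Defs.

Set Implicit Arguments.
Unset Strict Implicit.
Unset Printing Implicit Defensive.

Import Order.TTheory GRing.Theory Num.Theory.
Local Open Scope ring_scope.

(** The class is a parameter of [rigid] because the completion needs every summand orthogonal to Fac
    of the whole family, not only to Fac of itself. The count rests on one fact: for X rigid against
    C and N in Fac C, the map Hom(P0, N) -> Hom(P1, N) is onto, so g_X(N) = hom(X, N). On Fac T a
    relation between g-vectors thus becomes a relation between dimensions, which are nonnegative and
    can be compared sign by sign; the quotients of the T_i by traces lie in Fac T and serve as test
    modules. The Bongartz modules B enter because g_B = hom(Q, -) + r g_M puts hom(Q, -) into the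
    span of the g_{T_k}. A tau-tilting module must moreover meet every simple module. If Hom(Q, T) =
    0 for an indecomposable projective Q, then hom(Q, -) vanishes on Fac T and has only zero
    coefficients in the g_{T_k}, against the invertibility of the matrix between the two
    families. *)

Lemma ex_max_measure T (P : T -> Prop) (mu : T -> nat) b x0 :
  P x0 -> (forall x, P x -> (mu x <= b)%N) ->
  exists2 x, P x & forall y, P y -> (mu y <= mu x)%N.
Proof.
move=> Px0 ub; have [d] := ubnP (b - mu x0).
elim: d x0 Px0 => // d IH x0 Px0 ltd.
have [[y [Py lty]]|nex] := classic (exists y, P y /\ (mu x0 < mu y)%N).
  by apply: (IH y) => //; have := ub _ Py; lia.
exists x0 => // y Py; rewrite leqNgt; apply/negP => lt; apply: nex.
by exists y.
Qed.

Lemma ex_min_measure T (P : T -> Prop) (mu : T -> nat) x0 :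
  P x0 -> exists2 x, P x & forall y, P y -> (mu x <= mu y)%N.
Proof.
move=> Px0; have [d] := ubnP (mu x0).
elim: d x0 Px0 => // d IH x0 Px0 ltd.
have [[y [Py lty]]|nex] := classic (exists y, P y /\ (mu y < mu x0)%N).
  by apply: (IH y) => //; lia.
exists x0 => // y Py; rewrite leqNgt; apply/negP => lt; apply: nex.
by exists y.
Qed.

(** * Subspaces given by predicates, and separating functionals *)

Section Subspaces.
Variables (K : fieldType).

Lemma linfunE (V W : vectType K) (f : V -> W) : linear f -> forall x, linfun f x = f x.
Proof.
move=> lf; pose fl := GRing.isLinear.Build K V W _ f lf.
pose g : {linear V -> W} := HB.pack f fl.
by move=> x; rewrite -[f]/(g : V -> W) lfunE.
Qed.

(** A subspace of largest dimension inside [P] absorbs every further vector of [P]. Preimages,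
    traces and intersections of arbitrary families are obtained from this principle. *)
Lemma vspace_compr (V : vectType K) (P : V -> Prop) :
  P 0 -> (forall k x y, P x -> P y -> P (k *: x + y)) ->
  exists U : {vspace V}, forall x, x \in U <-> P x.
Proof.
move=> P0 PZD.
have [||U PU maxU] := @ex_max_measure {vspace V} (fun U => forall x, x \in U -> P x)
  (fun U => \dim U) (\dim {:V}) 0%VS.
- by move=> x; rewrite memv0 => /eqP->.
- by move=> U _; exact/dimvS/subvf.
exists U => x; split=> [/PU //|Px].
have : (\dim (U + <[x]>)%VS <= \dim U)%N.
  apply: maxU => _ /memv_addP[u uU [_ /vlineP[k ->] ->]].
  by rewrite addrC; apply: PZD => //; apply: PU.
rewrite (geq_leqif (dimv_leqif_sup (addvSl U <[x]>))) => /subvP; apply.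
by have := memv_add (mem0v U) (memv_line x); rewrite add0r.
Qed.

Lemma eq_fullv (V : vectType K) (U : {vspace V}) : (forall x, x \in U) -> U = fullv.
Proof. by move=> Uf; apply/vspaceP => x; rewrite Uf memvf. Qed.

Lemma eq_0v (V : vectType K) (U : {vspace V}) : (forall x, x \in U -> x = 0) -> U = 0%VS.
Proof. by move=> U0; apply/eqP; rewrite -subv0; apply/subvP => x /U0 ->; apply: mem0v. Qed.

Lemma lfun_separate (V : vectType K) (U : {vspace V}) (x : V) :
  x \notin U -> exists xi : 'Hom(V, K^o), (forall u, u \in U -> xi u = 0) /\ xi x <> 0.
Proof.
move=> xU; have q0 : quopi U x != 0 by rewrite quopi_eq0.
set b := vbasis {:quov U}.
have [i ci] : exists i, coord b i (quopi U x) <> 0.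
  apply: NNPP => nex; move/eqP: q0; apply.
  rewrite (coord_vbasis (memvf (quopi U x))) big1 // => i _.
  have -> : coord b i (quopi U x) = 0 by apply: NNPP => ci; apply: nex; exists i.
  by rewrite scale0r.
have lin : linear (fun y : V => coord b i (quopi U y) : K^o).
  by move=> k y z; rewrite !linearP.
exists (linfun (fun y : V => coord b i (quopi U y) : K^o)); split=> [u uU|].
  by rewrite linfunE //; move: uU; rewrite -quopi_eq0 => /eqP->; rewrite linear0.
by rewrite linfunE.
Qed.

End Subspaces.

(** * Homomorphisms *)

Section Homs.
Variables (K : fieldType) (A : fdalgType K).
Implicit Types M N P X Y Z : rmod A.

Lemma ract0l M a : ract (0 : M) a = 0.
Proof. by rewrite -ractfE linear0. Qed.
Lemma ract0r M (x : M) : ract x 0 = 0.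
Proof. exact: linear0. Qed.
Lemma ract_sumr M I (r : seq I) (Q : pred I) (F : I -> A) (x : M) :
  ract x (\sum_(i <- r | Q i) F i) = \sum_(i <- r | Q i) ract x (F i).
Proof. by rewrite linear_sum. Qed.

Section MkHom.
Variables (M N : rmod A) (f : M -> N) (lf : linear f).
Hypothesis actf : forall x a, f (ract x a) = ract (f x) a.
Fact mkhom_subproof x a : linfun f (ract x a) = ract (linfun f x) a.
Proof. by rewrite !linfunE. Qed.
Definition mkhom : hom M N := Hom mkhom_subproof.
Lemma mkhomE x : mkhom x = f x.
Proof. exact: linfunE. Qed.
End MkHom.

Lemma hom_homv M N (f : hom M N) : (f : 'Hom(M, N)) \in homv M N.
Proof. by apply/homvP => x a; apply: homP. Qed.

Definition homh M N (f : 'Hom(M, N)) (fP : f \in homv M N) : hom M N :=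
  Hom (homvP f fP).

(* Homomorphisms are sealed behind their pointwise equations, as [simpl] would
   otherwise unfold them. *)
Fact idh_sig M : {h : hom M M | forall x, h x = x}.
Proof. by exists (@mkhom M M id (fun _ _ _ => erefl) (fun _ _ => erefl)) => x; apply: mkhomE. Qed.
Definition idh M := sval (idh_sig M).
Lemma idhE M (x : M) : idh M x = x. Proof. exact: (svalP (idh_sig M)). Qed.

Fact comph_sig M N P (g : hom N P) (f : hom M N) :
  {h : hom M P | forall x, h x = g (f x)}.
Proof.
have act x a : (g \o f)%VF (ract x a) = ract ((g \o f)%VF x) a.
  by rewrite !comp_lfunE !homP.
by exists (Hom act) => x; apply: comp_lfunE.
Qed.
Definition comph M N P (g : hom N P) (f : hom M N) := sval (comph_sig g f).
Lemma comphE M N P (g : hom N P) (f : hom M N) x : comph g f x = g (f x).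
Proof. exact: (svalP (comph_sig g f)). Qed.

Fact zeroh_sig M N : {h : hom M N | forall x, h x = 0}.
Proof. by exists (homh (mem0v (homv M N))) => x; apply: zero_lfunE. Qed.
Definition zeroh M N := sval (zeroh_sig M N).
Lemma zerohE M N x : zeroh M N x = 0. Proof. exact: (svalP (zeroh_sig M N)). Qed.

Fact addh_sig M N (f g : hom M N) : {h : hom M N | forall x, h x = f x + g x}.
Proof. by exists (homh (memvD (hom_homv f) (hom_homv g))) => x; apply: add_lfunE. Qed.
Definition addh M N (f g : hom M N) := sval (addh_sig f g).
Lemma addhE M N (f g : hom M N) x : addh f g x = f x + g x.
Proof. exact: (svalP (addh_sig f g)). Qed.

Fact subh_sig M N (f g : hom M N) : {h : hom M N | forall x, h x = f x - g x}.
Proof.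
exists (homh (memvB (hom_homv f) (hom_homv g))) => x.
by rewrite add_lfunE opp_lfunE.
Qed.
Definition subh M N (f g : hom M N) := sval (subh_sig f g).
Lemma subhE M N (f g : hom M N) x : subh f g x = f x - g x.
Proof. exact: (svalP (subh_sig f g)). Qed.

Fact sumh_sig M N (I : finType) (f : I -> hom M N) :
  {h : hom M N | forall x, h x = \sum_i f i x}.
Proof.
have sP : (\sum_i (f i : 'Hom(M, N))) \in homv M N.
  by apply: memv_suml => i _; apply: hom_homv.
by exists (homh sP) => x; apply: sum_lfunE.
Qed.
Definition sumh M N (I : finType) (f : I -> hom M N) := sval (sumh_sig f).
Lemma sumhE M N (I : finType) (f : I -> hom M N) x : sumh f x = \sum_i f i x.
Proof. exact: (svalP (sumh_sig f)). Qed.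

Fact scaleh_sig M N (k : K) (f : hom M N) : {h : hom M N | forall x, h x = k *: f x}.
Proof. by exists (homh (memvZ k (hom_homv f))) => x; apply: scale_lfunE. Qed.
Definition scaleh M N (k : K) (f : hom M N) := sval (scaleh_sig k f).
Lemma scalehE M N k (f : hom M N) x : scaleh k f x = k *: f x.
Proof. exact: (svalP (scaleh_sig k f)). Qed.

Definition homhE := (idhE, comphE, zerohE, addhE, subhE, sumhE, scalehE).

Definition inj M N (f : hom M N) := forall x, f x = 0 -> x = 0.
Definition surj M N (f : hom M N) := forall y, exists x, f x = y.

Lemma hom0 M N (f : hom M N) : f 0 = 0. Proof. exact: linear0. Qed.
Lemma homD M N (f : hom M N) x y : f (x + y) = f x + f y. Proof. exact: linearD. Qed.
Lemma homN M N (f : hom M N) x : f (- x) = - f x. Proof. exact: linearN. Qed.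
Lemma homB M N (f : hom M N) x y : f (x - y) = f x - f y. Proof. exact: linearB. Qed.
Lemma homZ M N (f : hom M N) k x : f (k *: x) = k *: f x. Proof. exact: linearZ. Qed.
Lemma hom_sum M N (f : hom M N) I (r : seq I) (Q : pred I) (F : I -> M) :
  f (\sum_(i <- r | Q i) F i) = \sum_(i <- r | Q i) f (F i).
Proof. exact: linear_sum. Qed.

Lemma injective_homP M N (f : hom M N) : injective_hom f <-> inj f.
Proof.
split=> [f0 x fx|fi]; last first.
  by apply: eq_0v => x; rewrite memv_ker => /eqP/fi.
by apply/eqP; rewrite -memv0 -f0 memv_ker fx.
Qed.

Lemma surjective_homP M N (f : hom M N) : surjective_hom f <-> surj f.
Proof.
split=> [fs y|fs]; last first.
  by apply: eq_fullv => y; have [x <-] := fs y; apply/memv_img/memvf.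
have: y \in limg f by rewrite fs memvf.
by move=> /memv_imgP[x _ ->]; exists x.
Qed.

Lemma inj_eqh M N (f : hom M N) x y : inj f -> f x = f y -> x = y.
Proof. by move=> fi fxy; apply/eqP; rewrite -subr_eq0; apply/eqP/fi; rewrite homB fxy subrr. Qed.

Lemma bij_inv M N (f : hom M N) : inj f -> surj f ->
  exists g : hom N M, cancel f g /\ cancel g f.
Proof.
move=> fi fs; have kf : lker f == 0%VS by apply/eqP/injective_homP.
have fV y : f (f^-1%VF y) = y by have [x <-] := fs y; rewrite lker0_lfunK.
have actV y a : f^-1%VF (ract y a) = ract (f^-1%VF y) a.
  by apply: (inj_eqh fi); rewrite homP !fV.
by exists (Hom actV); split=> x //=; rewrite lker0_lfunK.
Qed.

Lemma isoP M N : iso M N <-> exists (f : hom M N) (g : hom N M), cancel f g /\ cancel g f.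
Proof.
split=> [[f [/injective_homP fi /surjective_homP fs]]|[f [g [fK gK]]]].
  by exists f; apply: bij_inv.
exists f; split; first by apply/injective_homP => x fx; rewrite -(fK x) fx hom0.
by apply/surjective_homP => y; exists (g y).
Qed.

Lemma iso_bij M N (f : hom M N) : inj f -> surj f -> iso M N.
Proof. by move=> fi fs; exists f; split; [apply/injective_homP|apply/surjective_homP]. Qed.

Lemma iso_refl M : iso M M.
Proof. by apply/isoP; exists (idh M), (idh M); split=> x; rewrite !homhE. Qed.
Lemma iso_sym M N : iso M N -> iso N M.
Proof. by move/isoP=> [f [g [fK gK]]]; apply/isoP; exists g, f. Qed.
Lemma iso_trans N M P : iso M N -> iso N P -> iso M P.
Proof.
move=> /isoP[f [g [fK gK]]] /isoP[f' [g' [fK' gK']]].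
by apply/isoP; exists (comph f' f), (comph g g'); split=> x; rewrite !homhE ?fK' ?gK.
Qed.

Lemma dim_inj M N (f : hom M N) : inj f -> (\dim {:M} <= \dim {:N})%N.
Proof.
move=> /injective_homP fi; rewrite -(limg_dim_eq (f := f)) ?capfv //.
exact/dimvS/subvf.
Qed.

Lemma dim_surj M N (f : hom M N) : surj f -> (\dim {:N} <= \dim {:M})%N.
Proof. by move=> /surjective_homP <-; rewrite -(limg_ker_dim f fullv) leq_addl. Qed.

Lemma inj_surj M N (f : hom M N) : inj f -> (\dim {:N} <= \dim {:M})%N -> surj f.
Proof.
move=> /injective_homP fi le; apply/surjective_homP/eqP.
by rewrite eqEdim subvf limg_dim_eq // capfv.
Qed.

Lemma surj_inj M N (f : hom M N) : surj f -> (\dim {:M} <= \dim {:N})%N -> inj f.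
Proof.
move=> /surjective_homP fs le; apply/injective_homP/eqP.
have := limg_ker_dim f fullv; rewrite capfv -/(limg f) fs -dimv_eq0.
by move: le; lia.
Qed.

Lemma iso_dim M N : iso M N -> \dim {:M} = \dim {:N}.
Proof.
move=> [f [/injective_homP fi /surjective_homP fs]].
by apply/eqP; rewrite eqn_leq (dim_inj fi) (dim_surj fs).
Qed.

Lemma zero_rmodP M : zero_rmod M <-> forall x : M, x = 0.
Proof.
split=> [M0 x|M0]; first by apply/eqP; rewrite -memv0 -M0 memvf.
by apply: eq_0v => x _; apply: M0.
Qed.

(** The linear section [f^-1] need not respect the action, but its composite with [g] does, because
    [g] is constant on the fibres of [f]. *)
Lemma factor_surj M N P (f : hom M N) (g : hom M P) : surj f ->
  (forall x, f x = 0 -> g x = 0) -> exists h : hom N P, forall x, h (f x) = g x.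
Proof.
move=> fs ker; have fV y : f (f^-1%VF y) = y.
  by have [x <-] := fs y; rewrite limg_lfunVK // memv_img ?memvf.
have gE x y : f x = f y -> g x = g y.
  by move=> fxy; apply/eqP; rewrite -subr_eq0 -homB ker // homB fxy subrr.
have E x : (g \o f^-1)%VF (f x) = g x by rewrite comp_lfunE; apply: gE; rewrite fV.
have act y a : (g \o f^-1)%VF (ract y a) = ract ((g \o f^-1)%VF y) a.
  by have [x <-] := fs y; rewrite -homP !E homP.
by exists (Hom act).
Qed.

Lemma factor_inj M N P (f : hom N P) (g : hom M P) : inj f ->
  (forall x, exists y, g x = f y) -> exists h : hom M N, forall x, f (h x) = g x.
Proof.
move=> fi im; have fV y : f (f^-1%VF (g y)) = g y.
  by have [x ->] := im y; rewrite limg_lfunVK // memv_img ?memvf.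
have act y a : (f^-1 \o g)%VF (ract y a) = ract ((f^-1 \o g)%VF y) a.
  by apply: (inj_eqh fi); rewrite homP !comp_lfunE !fV homP.
by exists (Hom act) => x /=; rewrite comp_lfunE fV.
Qed.

Section SubQuo.
Variables (M : rmod A) (U : smod M).
Fact incl_sig : {h : hom (submod U) M | forall x, h x = vsval x}.
Proof.
exists (@mkhom (submod U) M vsval (fun _ _ _ => erefl) (fun x a => sub_actE x a)) => x.
exact: mkhomE.
Qed.
Definition incl := sval incl_sig.
Lemma inclE x : incl x = vsval x. Proof. exact: (svalP incl_sig). Qed.
Lemma incl_inj : inj incl.
Proof. by move=> x; rewrite inclE => x0; apply: subvs_inj; rewrite x0. Qed.
Lemma incl_mem x : incl x \in U.
Proof. by rewrite inclE; apply: subvsP. Qed.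
Lemma mem_incl x : x \in U -> exists y, incl y = x.
Proof. by move=> xU; exists (vsproj U x); rewrite inclE vsprojK. Qed.

Fact proj_sig : {h : hom M (quomod U) | forall x, h x = quopi U x}.
Proof.
exists (@mkhom M (quomod U) (@quopi K M U) (@quopi_is_linear K M U)
    (fun x a => esym (quo_act_pi U x a))) => x.
exact: mkhomE.
Qed.
Definition proj := sval proj_sig.
Lemma projE x : proj x = quopi U x. Proof. exact: (svalP proj_sig). Qed.
Lemma proj_surj : surj proj.
Proof. by move=> y; exists (quorep y); rewrite projE quorepK. Qed.
Lemma proj_eq0 x : proj x = 0 <-> x \in U.
Proof. by rewrite projE -quopi_eq0; split=> [->|/eqP]. Qed.
End SubQuo.


Lemma smod_compr M (P : M -> Prop) :
  P 0 -> (forall k x y, P x -> P y -> P (k *: x + y)) ->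
  (forall x a, P x -> P (ract x a)) ->
  exists U : smod M, forall x, x \in U <-> P x.
Proof.
move=> P0 PD PA; have [U UP] := vspace_compr P0 PD.
have actU x a : x \in U -> ract x a \in U by move=> /UP/PA xaP; apply/UP.
by exists (SMod actU).
Qed.

Lemma hom_smod_preim M N (f : hom M N) (U : smod N) :
  exists V : smod M, forall x, x \in V <-> f x \in U.
Proof.
apply: smod_compr => [|k x y xU yU|x a xU]; first by rewrite hom0 mem0v.
  by rewrite homD homZ memvD ?memvZ.
by rewrite homP smodP.
Qed.

Lemma mem_hker M N (f : hom M N) x : x \in hker f <-> f x = 0.
Proof. by rewrite memv_ker; split=> [/eqP|->]. Qed.

Lemma mem_himg M N (f : hom M N) (U : smod M) y :
  y \in himg f U <-> exists2 x, x \in U & y = f x.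
Proof. by split=> [/memv_imgP[x xU ->]|[x xU ->]]; [exists x|apply: memv_img]. Qed.

Lemma mem_himgf M N (f : hom M N) y :
  y \in himg f (full_smod M) <-> exists x, y = f x.
Proof.
rewrite mem_himg; split=> [[x _ ->]|[x ->]]; exists x => //; exact: memvf.
Qed.

Section DSum.
Variables X Y : rmod A.
Fact inlh_sig : {h : hom X (dsum X Y) | forall x, h x = (x, 0)}.
Proof.
have lin : linear (fun x : X => (x, 0) : dsum X Y).
  by move=> k x y; congr pair; rewrite /= scaler0 addr0.
have act (x : X) a : (ract x a, 0) = ract ((x, 0) : dsum X Y) a.
  by rewrite /ract /= /dsum_act /= ract0l.
by exists (mkhom lin act) => x; apply: mkhomE.
Qed.
Definition inlh := sval inlh_sig.
Lemma inlhE x : inlh x = (x, 0). Proof. exact: (svalP inlh_sig). Qed.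

Fact inrh_sig : {h : hom Y (dsum X Y) | forall y, h y = (0, y)}.
Proof.
have lin : linear (fun y : Y => (0, y) : dsum X Y).
  by move=> k x y; congr pair; rewrite /= scaler0 addr0.
have act (y : Y) a : (0, ract y a) = ract ((0, y) : dsum X Y) a.
  by rewrite /ract /= /dsum_act /= ract0l.
by exists (mkhom lin act) => x; apply: mkhomE.
Qed.
Definition inrh := sval inrh_sig.
Lemma inrhE x : inrh x = (0, x). Proof. exact: (svalP inrh_sig). Qed.

Fact fsth_sig : {h : hom (dsum X Y) X | forall z, h z = z.1}.
Proof.
by exists (@mkhom (dsum X Y) X (fun x => x.1) (fun _ _ _ => erefl) (fun _ _ => erefl)) => x;
   apply: mkhomE.
Qed.
Definition fsth := sval fsth_sig.
Lemma fsthE x : fsth x = x.1. Proof. exact: (svalP fsth_sig). Qed.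

Fact sndh_sig : {h : hom (dsum X Y) Y | forall z, h z = z.2}.
Proof.
by exists (@mkhom (dsum X Y) Y (fun x => x.2) (fun _ _ _ => erefl) (fun _ _ => erefl)) => x;
   apply: mkhomE.
Qed.
Definition sndh := sval sndh_sig.
Lemma sndhE x : sndh x = x.2. Proof. exact: (svalP sndh_sig). Qed.
End DSum.
Definition dsumE := (inlhE, inrhE, fsthE, sndhE).

Lemma dsum_split X Y (z : dsum X Y) : z = inlh X Y z.1 + inrh X Y z.2.
Proof. by rewrite !dsumE; case: z => x y; congr pair; rewrite /= ?addr0 ?add0r. Qed.

Definition fromdsum X Y Z (f : hom X Z) (g : hom Y Z) : hom (dsum X Y) Z :=
  addh (comph f (fsth X Y)) (comph g (sndh X Y)).
Lemma fromdsumE X Y Z (f : hom X Z) (g : hom Y Z) z : fromdsum f g z = f z.1 + g z.2.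
Proof. by rewrite !homhE !dsumE. Qed.

Definition todsum X Y Z (f : hom Z X) (g : hom Z Y) : hom Z (dsum X Y) :=
  addh (comph (inlh X Y) f) (comph (inrh X Y) g).
Lemma todsumE X Y Z (f : hom Z X) (g : hom Z Y) z : todsum f g z = (f z, g z).
Proof. by rewrite !homhE !dsumE; congr pair; rewrite /= ?addr0 ?add0r. Qed.

Lemma proj_lift P M N (h : hom M N) (f : hom P N) : projective P -> surj h ->
  exists g : hom P M, forall x, h (g x) = f x.
Proof.
move=> Pp /surjective_homP hs; have [g gE] := Pp _ _ h f hs.
by exists g => x; rewrite -comp_lfunE gE.
Qed.

Lemma projectiveI P : (forall M N (h : hom M N) (f : hom P N), surj h ->
  exists g : hom P M, forall x, h (g x) = f x) -> projective P.
Proof.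
move=> Pp M N h f /surjective_homP hs; have [g gE] := Pp _ _ h f hs.
by exists g; apply/lfunP => x; rewrite comp_lfunE gE.
Qed.

End Homs.

(** * Krull-Schmidt *)

Section KrullSchmidt.
Variables (K : fieldType) (A : fdalgType K).
Implicit Types M N P X Y Z : rmod A.

Definition retract X M := exists (i : hom X M) (p : hom M X), forall x, p (i x) = x.

Lemma retract_compl X M (i : hom X M) (p : hom M X) : (forall x, p (i x) = x) ->
  iso M (dsum X (submod (hker p))).
Proof.
move=> pi; have [h hE] : exists h : hom M (submod (hker p)),
    forall m, incl (hker p) (h m) = subh (idh M) (comph i p) m.
  apply: factor_inj; first exact: incl_inj.
  move=> m; have [|y <-] := @mem_incl _ _ _ (hker p) (subh (idh M) (comph i p) m).
    by apply/mem_hker; rewrite !homhE homB pi subrr.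
  by exists y.
apply: (iso_bij (f := todsum p h)) => [m|[x y]].
  rewrite todsumE => -[pm hm]; have := hE m.
  by rewrite hm hom0 !homhE pm hom0 subr0.
have py : p (incl _ y) = 0 by apply/mem_hker/incl_mem.
exists (i x + incl _ y); rewrite todsumE !homD pi py addr0; congr pair.
apply: (inj_eqh (f := incl _)); first exact: incl_inj.
rewrite homD !hE !homhE pi py hom0.
by rewrite subrr add0r subr0.
Qed.

Lemma retractP X M : direct_summand X M <-> retract X M.
Proof.
split=> [[Y /isoP[f [g [fK gK]]]]|[i [p pi]]]; last first.
  by exists (submod (hker p)); apply: retract_compl pi.
exists (comph g (inlh X Y)), (comph (fsth X Y) f) => x.
by rewrite !homhE gK !dsumE.
Qed.

Lemma iso_retract X M : iso X M -> retract X M.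
Proof. by move=> /isoP[f [g [fK _]]]; exists f, g. Qed.

Lemma retract_refl X : retract X X.
Proof. exact/iso_retract/iso_refl. Qed.

Lemma retract_trans X Y Z : retract X Y -> retract Y Z -> retract X Z.
Proof.
move=> [i [p pi]] [j [q qj]]; exists (comph j i), (comph p q) => x.
by rewrite !homhE qj pi.
Qed.

Lemma retract_dsuml X Y : retract X (dsum X Y).
Proof. by exists (inlh X Y), (fsth X Y) => x; rewrite !dsumE. Qed.
Lemma retract_dsumr X Y : retract Y (dsum X Y).
Proof. by exists (inrh X Y), (sndh X Y) => x; rewrite !dsumE. Qed.

Lemma indec_nonzero X : indecomposable X -> exists x : X, x <> 0.
Proof.
move=> [X0 _]; apply: NNPP => nex; apply/X0/zero_rmodP => x.
by apply: NNPP => x0; apply: nex; exists x.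
Qed.

Lemma indec_retract_id M X (i : hom X M) (p : hom M X) : indecomposable M ->
  (forall x, p (i x) = x) -> ~ zero_rmod X -> forall m, i (p m) = m.
Proof.
move=> [_ indM] pi X0 m; have [//|/zero_rmodP k0] := indM _ _ (retract_compl pi).
have [|y yE] := @mem_incl _ _ _ (hker p) (m - i (p m)).
  by apply/mem_hker; rewrite homB pi subrr.
by apply/eqP; rewrite eq_sym -subr_eq0 -yE (k0 y) hom0.
Qed.

Lemma indec_retract_iso M X : indecomposable M -> ~ zero_rmod X -> retract X M -> iso X M.
Proof.
move=> Mi X0 [i [p pi]]; apply/isoP; exists i, p; split=> // m.
exact: indec_retract_id.
Qed.

Lemma indec_iso X Y : iso X Y -> indecomposable X -> indecomposable Y.
Proof.
move=> XY [X0 indX]; split=> [/zero_rmodP Y0|U V YUV]; last exact/indX/(iso_trans XY).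
apply/X0/zero_rmodP => x; move: XY => /isoP[f [g [fK _]]].
by rewrite -(fK x) (Y0 (f x)) hom0.
Qed.

Lemma indecI M : ~ zero_rmod M ->
  (forall f : hom M M, (forall x, f (f x) = f x) ->
     (forall x, f x = 0) \/ (forall x, f x = x)) -> indecomposable M.
Proof.
move=> M0 idem; split=> // X Y /isoP[f [g [fK gK]]].
pose e := comph (comph g (comph (inlh X Y) (fsth X Y))) f.
have eE x : e x = g ((f x).1, 0) by rewrite !homhE !dsumE.
have [x|e0|e1] := idem e; first by rewrite !eE gK.
  left; apply/zero_rmodP => x; have := e0 (g (x, 0)).
  by rewrite eE gK /= => /(congr1 f); rewrite gK hom0 => -[].
right; apply/zero_rmodP => y; have := e1 (g (0, y)).
by rewrite eE gK /= => /(congr1 f); rewrite !gK => -[].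
Qed.

Fixpoint iterh M (f : hom M M) n : hom M M :=
  if n is n'.+1 then comph f (iterh f n') else idh M.
Lemma iterhE M (f : hom M M) n x : iterh f n x = iter n f x.
Proof. by elim: n => [|n IH]; rewrite homhE ?IH. Qed.

Lemma iter_hom0 M (f : hom M M) n : iter n f 0 = 0.
Proof. by elim: n => //= n ->; rewrite hom0. Qed.

(** Once the dimension of im f^n is minimal, f^n maps its image onto itself and is bijective there;
    inverting it on the image gives the retraction. The condition n > 0 keeps this image inside im
    f. *)
Lemma fitting M (f : hom M M) : exists2 n, (0 < n)%N &
  exists r : hom M (submod (himg (iterh f n) (full_smod M))),
    forall u, r (incl (himg (iterh f n) (full_smod M)) u) = u.
Proof.
have [n n0 minn] := @ex_min_measure nat (fun n => (0 < n)%N)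
   (fun n => \dim (limg (iterh f n))) 1%N erefl.
exists n => //; set g := iterh f n.
have gE x : g x = iter n f x by apply: iterhE.
have gimg y : exists z, g y = g (g z).
  have sub : (limg (iterh f (n + n)) <= limg g)%VS.
    apply/subvP => _ /memv_imgP[x _ ->]; rewrite iterhE iterD -gE.
    by apply: memv_img; apply: memvf.
  have : (\dim (limg g) <= \dim (limg (iterh f (n + n))))%N by apply: minn; lia.
  rewrite (geq_leqif (dimv_leqif_sup sub)) => /subvP sub'.
  have /sub' : g y \in limg g by apply: memv_img; apply: memvf.
  move=> /memv_imgP[z _]; rewrite iterhE iterD => E; exists z.
  by rewrite E !gE.
set U := himg g (full_smod M).
have [h hE] : exists h : hom M (submod U), forall x, incl U (h x) = g x.
  apply: factor_inj; first exact: incl_inj.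
  move=> x; have [|y yE] := @mem_incl _ _ _ U (g x); first by apply/mem_himgf; exists x.
  by exists y.
have hs : surj (comph h (incl U)).
  move=> u; have /mem_himgf[y uE] := incl_mem u.
  have [z zE] := gimg y; exists (h z).
  apply: (inj_eqh (f := incl U)); first exact: incl_inj.
  by rewrite homhE !hE uE zE.
have hi : inj (comph h (incl U)) by apply: surj_inj.
have [k [hK _]] := bij_inv hi hs.
by exists (comph k h) => u; rewrite homhE -[RHS]hK homhE.
Qed.

Lemma fitting_indec M (f : hom M M) : indecomposable M ->
  inj f \/ exists n, forall x, iter n f x = 0.
Proof.
move=> Mi; have [n n0 [r rE]] := fitting f; set U := himg _ _ in r rE.
have [/zero_rmodP U0|Un0] := classic (zero_rmod (submod U)).
  right; exists n => x; rewrite -iterhE.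
  have [|y <-] := @mem_incl _ _ _ U (iterh f n x); first by apply/mem_himgf; exists x.
  by rewrite (U0 y) hom0.
left=> x fx0; have gs : surj (iterh f n).
  move=> y; have /mem_himgf[z zE] := incl_mem (r y).
  by exists z; rewrite -zE (indec_retract_id Mi rE Un0).
apply: (surj_inj gs (leqnn _)); rewrite iterhE -(prednK n0) iterSr fx0; exact: iter_hom0.
Qed.

(** The endomorphism ring of an indecomposable is local: if f is nilpotent and g x = 0, then f x =
    x, so x = f^n x = 0. *)
Lemma indec_local M (f g : hom M M) : indecomposable M ->
  (forall x, f x + g x = x) -> inj f \/ inj g.
Proof.
move=> Mi fg; have [fi|[n fn]] := fitting_indec f Mi; first by left.
right=> x gx; have fx : f x = x by rewrite -[RHS]fg gx addr0.
by rewrite -(fn x); elim: n {fn} => //= n <-.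
Qed.

Lemma indec_idem M (f : hom M M) : indecomposable M -> (forall x, f (f x) = f x) ->
  (forall x, f x = 0) \/ (forall x, f x = x).
Proof.
move=> Mi ff; have [fi|[n fn]] := fitting_indec f Mi; [right|left] => x.
  by apply/eqP; rewrite -subr_eq0; apply/eqP/fi; rewrite homB ff subrr.
have [n0|n0] := posnP n; first by move: (fn (f x)); rewrite n0.
rewrite -(fn x) -(prednK n0); elim: (n.-1) => //= k IH.
by rewrite -IH ff.
Qed.

Lemma end_bij M (f : hom M M) : inj f -> exists g : hom M M, cancel f g /\ cancel g f.
Proof. by move=> fi; apply: bij_inv => //; apply: inj_surj. Qed.

Lemma noniso_add M (f g : hom M M) : indecomposable M ->
  ~ inj f -> ~ inj g -> ~ inj (addh f g).
Proof.
move=> Mi nf ng fgi; have [h [hK _]] := end_bij fgi.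
have [x|hf|hg] := @indec_local M (comph h f) (comph h g) Mi.
- by rewrite !comphE -homD -[RHS]hK addhE.
- by apply: nf => x fx; apply: hf; rewrite homhE fx hom0.
- by apply: ng => x gx; apply: hg; rewrite homhE gx hom0.
Qed.

Lemma noniso_compl M (f g : hom M M) : ~ inj f -> ~ inj (comph g f).
Proof. by move=> nf gf; apply: nf => x fx; apply: gf; rewrite homhE fx hom0. Qed.

Lemma noniso_compr M (f g : hom M M) : ~ inj f -> ~ inj (comph f g).
Proof.
move=> nf fg; have gi : inj g by move=> x gx; apply: fg; rewrite homhE gx hom0.
have [h [_ hK]] := end_bij gi.
by apply: nf => x fx; rewrite -(hK x) (fg (h x)) ?hom0 // homhE hK.
Qed.

(** The identity of [X] is the sum of its passages through [Y] and through [Z]; locality makes one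
    of the two invertible. *)
Lemma indec_retract_dsum X Y Z : indecomposable X -> retract X (dsum Y Z) ->
  retract X Y \/ retract X Z.
Proof.
move=> Xi [i [p pi]].
pose f := comph (comph p (inlh Y Z)) (comph (fsth Y Z) i).
pose g := comph (comph p (inrh Y Z)) (comph (sndh Y Z) i).
have fg x : f x + g x = x.
  rewrite /f /g !homhE -homD -[RHS]pi; congr (p _).
  by rewrite [RHS]dsum_split !dsumE.
have [/end_bij[h [hK _]]|/end_bij[h [hK _]]] := indec_local Xi fg.
  left; exists (comph (fsth Y Z) i), (comph h (comph p (inlh Y Z))) => x.
  by rewrite comphE -[RHS]hK; congr (h _); rewrite !homhE.
right; exists (comph (sndh Y Z) i), (comph h (comph p (inrh Y Z))) => x.
by rewrite comphE -[RHS]hK; congr (h _); rewrite !homhE.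
Qed.

Lemma zeromodP (x : zeromod A) : x = 0.
Proof. by apply: val_inj; apply/eqP; have := valP x; rewrite memv0. Qed.

Fixpoint bd_in n : forall (F : nat -> rmod A) i, hom (F i) (bigdsum n F) :=
  match n with
  | 0 => fun F i => zeroh (F i) (zeromod A)
  | n'.+1 => fun F i =>
    match i with
    | 0 => inlh (F 0%N) (bigdsum n' (fun j => F j.+1))
    | i'.+1 => comph (inrh (F 0%N) (bigdsum n' (fun j => F j.+1)))
                     (bd_in n' (fun j => F j.+1) i')
    end
  end.

Fixpoint bd_pr n : forall (F : nat -> rmod A) i, hom (bigdsum n F) (F i) :=
  match n with
  | 0 => fun F i => zeroh (zeromod A) (F i)
  | n'.+1 => fun F i =>
    match i with
    | 0 => fsth (F 0%N) (bigdsum n' (fun j => F j.+1))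
    | i'.+1 => comph (bd_pr n' (fun j => F j.+1) i')
                     (sndh (F 0%N) (bigdsum n' (fun j => F j.+1)))
    end
  end.

Lemma bd_in0E n F x : bd_in n.+1 F 0 x = inlh (F 0%N) (bigdsum n (fun j => F j.+1)) x.
Proof. by []. Qed.
Lemma bd_inSE n F i x : bd_in n.+1 F i.+1 x =
  inrh (F 0%N) (bigdsum n (fun j => F j.+1)) (bd_in n (fun j => F j.+1) i x).
Proof. exact: comphE. Qed.
Lemma bd_pr0E n F x : bd_pr n.+1 F 0 x = fsth (F 0%N) (bigdsum n (fun j => F j.+1)) x.
Proof. by []. Qed.
Lemma bd_prSE n F i x : bd_pr n.+1 F i.+1 x =
  bd_pr n (fun j => F j.+1) i (sndh (F 0%N) (bigdsum n (fun j => F j.+1)) x).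
Proof. exact: comphE. Qed.

Lemma bd_pr_in n F i : (i < n)%N -> forall x, bd_pr n F i (bd_in n F i x) = x.
Proof.
elim: n F i => // n IH F [|i] lt x; first by rewrite bd_in0E bd_pr0E !dsumE.
by rewrite bd_inSE bd_prSE !dsumE IH.
Qed.

Lemma bd_pr_in_neq n F i j : i <> j -> forall x, bd_pr n F i (bd_in n F j x) = 0.
Proof.
elim: n F i j => [|n IH] F i j ne x; first exact: zerohE.
case: i j ne x => [|i] [|j] // ne x.
- by rewrite bd_inSE bd_pr0E !dsumE.
- by rewrite bd_in0E bd_prSE !dsumE hom0.
- by rewrite bd_inSE bd_prSE !dsumE IH // => E; apply: ne; rewrite E.
Qed.

Lemma bd_sum n F (z : bigdsum n F) : z = \sum_(i < n) bd_in n F i (bd_pr n F i z).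
Proof.
elim: n F z => [|n IH] F z; first by rewrite big_ord0; apply: zeromodP.
rewrite big_ord_recl [LHS]dsum_split bd_in0E bd_pr0E; congr (_ + _); first by rewrite fsthE.
rewrite [in LHS](IH _ z.2) hom_sum; apply: eq_bigr => i _.
by rewrite bd_inSE bd_prSE !dsumE.
Qed.

Lemma retract_bd n F i : (i < n)%N -> retract (F i) (bigdsum n F).
Proof. by move=> lt; exists (bd_in n F i), (bd_pr n F i); apply: bd_pr_in. Qed.

Definition frombd n F Y (f : forall i, hom (F i) Y) : hom (bigdsum n F) Y :=
  sumh (fun i : 'I_n => comph (f i) (bd_pr n F i)).
#[global] Arguments frombd n [F Y] f.
Lemma frombdE n F Y (f : forall i, hom (F i) Y) z :
  frombd n f z = \sum_(i < n) f i (bd_pr n F i z).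
Proof. by rewrite homhE; apply: eq_bigr => i _; rewrite homhE. Qed.
Lemma frombd_in n F Y (f : forall i, hom (F i) Y) i x : (i < n)%N ->
  frombd n f (bd_in n F i x) = f i x.
Proof.
move=> lt; rewrite frombdE (bigD1 (Ordinal lt)) //= bd_pr_in // big1 ?addr0 // => j ne.
rewrite bd_pr_in_neq ?hom0 // => E; move/eqP: ne; apply; exact: val_inj.
Qed.

Lemma indec_retract_bd X n F : indecomposable X -> retract X (bigdsum n F) ->
  exists2 i, (i < n)%N & retract X (F i).
Proof.
move=> Xi; elim: n F => [|n IH] F.
  move=> [i [p pi]]; have [x []] := indec_nonzero Xi.
  by rewrite -(pi x) (zeromodP (i x)) hom0.
move=> /(indec_retract_dsum Xi)[XF|/IH[i lt XF]]; first by exists 0%N.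
by exists i.+1.
Qed.

Lemma dsum_iso X X' Y Y' : iso X X' -> iso Y Y' -> iso (dsum X Y) (dsum X' Y').
Proof.
move=> /isoP[f [f' [fK f'K]]] /isoP[g [g' [gK g'K]]]; apply/isoP.
exists (todsum (comph f (fsth X Y)) (comph g (sndh X Y))).
exists (todsum (comph f' (fsth X' Y')) (comph g' (sndh X' Y'))).
by split=> -[x y]; rewrite !todsumE !homhE !dsumE /= ?fK ?gK ?f'K ?g'K.
Qed.

Lemma dsumA_iso X Y Z : iso (dsum (dsum X Y) Z) (dsum X (dsum Y Z)).
Proof.
apply/isoP.
exists (todsum (comph (fsth X Y) (fsth (dsum X Y) Z))
   (todsum (comph (sndh X Y) (fsth (dsum X Y) Z)) (sndh (dsum X Y) Z))).
exists (todsum (todsum (fsth X (dsum Y Z)) (comph (fsth Y Z) (sndh X (dsum Y Z))))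
   (comph (sndh Y Z) (sndh X (dsum Y Z)))).
by split=> [[[x y] z]|[x [y z]]]; rewrite !todsumE !homhE !dsumE.
Qed.

Lemma dsum0_iso M : iso (dsum (zeromod A) M) M.
Proof.
apply: (iso_bij (f := sndh (zeromod A) M)) => [[x y]|y].
  by rewrite dsumE => /= ->; rewrite (zeromodP x).
by exists (0, y); rewrite dsumE.
Qed.

Lemma dsumz_iso M : iso (dsum M (zeromod A)) M.
Proof.
apply: (iso_bij (f := fsth M (zeromod A))) => [[y x]|y].
  by rewrite dsumE => /= ->; rewrite (zeromodP x).
by exists (y, 0); rewrite dsumE.
Qed.

Lemma zero_rmod_iso M : zero_rmod M -> iso M (zeromod A).
Proof.
move=> /zero_rmodP M0; apply: (iso_bij (f := zeroh _ _)) => [x _|y]; first exact: M0.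
by exists 0; rewrite hom0 (zeromodP y).
Qed.

Fixpoint catF n (F G : nat -> rmod A) : nat -> rmod A :=
  match n with
  | 0 => G
  | n'.+1 => fun i =>
    match i with 0 => F 0%N | i'.+1 => catF n' (fun j => F j.+1) G i' end
  end.

Lemma bigdsum_cat n m F G :
  iso (dsum (bigdsum n F) (bigdsum m G)) (bigdsum (n + m) (catF n F G)).
Proof.
elim: n F => [|n IH] F; first exact: dsum0_iso.
apply: (iso_trans (dsumA_iso _ _ _)); apply: dsum_iso; first exact: iso_refl.
exact: IH.
Qed.

Lemma catF_all (Q : rmod A -> Prop) n m F G :
  (forall i, (i < n)%N -> Q (F i)) -> (forall i, (i < m)%N -> Q (G i)) ->
  forall i, (i < n + m)%N -> Q (catF n F G i).
Proof.
move=> + QG; elim: n F => [|n IH] F QF //= [|i] lt; first exact: QF.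
by apply: IH => // j; apply: (QF j.+1).
Qed.

Lemma dim_dsum X Y : \dim {:dsum X Y} = (\dim {:X} + \dim {:Y})%N.
Proof. by rewrite !dimvf. Qed.

Lemma zero_rmod_dim X : ~ zero_rmod X -> (0 < \dim {:X})%N.
Proof. by move=> X0; rewrite lt0n dimv_eq0; apply/eqP. Qed.

Lemma indec_decomposition M : exists n F,
  (forall i, (i < n)%N -> indecomposable (F i)) /\ iso M (bigdsum n F).
Proof.
have [d] := ubnP (\dim {:M}); elim: d M => // d IH M ltd.
have [M0|M0] := classic (zero_rmod M).
  by exists 0%N, (fun _ => M); split=> //; apply: zero_rmod_iso.
have [Mi|nMi] := classic (indecomposable M).
  exists 1%N, (fun _ => M); split=> //=; apply/iso_sym/dsumz_iso.
have [X [Y [MXY X0 Y0]]] : exists X Y, [/\ iso M (dsum X Y), ~ zero_rmod X & ~ zero_rmod Y].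
  apply: NNPP => nex; apply: nMi; split=> // X Y MXY; apply: NNPP => nXY; apply: nex.
  by exists X, Y; split=> // Z0; apply: nXY; [left|right].
have := iso_dim MXY; rewrite dim_dsum => dM.
have := zero_rmod_dim X0; have := zero_rmod_dim Y0 => dY dX.
have [|n [F [Fi XF]]] := IH X; first by lia.
have [|m [G [Gi YG]]] := IH Y; first by lia.
exists (n + m)%N, (catF n F G); split; first exact: catF_all.
apply: (iso_trans MXY); apply: iso_trans (bigdsum_cat _ _ _ _).
exact: dsum_iso.
Qed.

End KrullSchmidt.

(** * Projective presentations and Ext-orthogonality *)

Section Projectives.
Variables (K : fieldType) (A : fdalgType K).
Implicit Types M N P X Y Z W : rmod A.

Lemma corestrict M N (U : smod N) (f : hom M N) : (forall x, f x \in U) ->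
  exists h : hom M (submod U), forall x, incl U (h x) = f x.
Proof.
move=> fU; apply: factor_inj; first exact: incl_inj.
by move=> x; have [y <-] := mem_incl (fU x); exists y.
Qed.

Fact acth_sig M (m : M) : {h : hom (regmod A) M | forall a : A, h a = ract m a}.
Proof.
by exists (@mkhom _ _ (regmod A) M (ract m) (ract_linr m) (ractM m)) => a; apply: mkhomE.
Qed.
Definition acth M (m : M) := sval (acth_sig m).
Lemma acthE M (m : M) (a : A) : acth m a = ract m a.
Proof. exact: (svalP (acth_sig m)). Qed.

Lemma ract_reg (x : regmod A) a : ract x a = (x : A) * a.
Proof. by []. Qed.

Lemma proj_regmod : projective (regmod A).
Proof.
apply: projectiveI => M N h f hs; have [m mE] := hs (f 1).
by exists (acth m) => a; rewrite acthE homP mE -homP ract_reg mul1r.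
Qed.

Lemma proj_retract P Q : retract P Q -> projective Q -> projective P.
Proof.
move=> [i [p pi]] Qp; apply: projectiveI => M N h f hs.
have [g gE] := proj_lift (comph f p) Qp hs.
by exists (comph g i) => x; rewrite homhE gE homhE pi.
Qed.

Lemma proj_dsum P Q : projective P -> projective Q -> projective (dsum P Q).
Proof.
move=> Pp Qp; apply: projectiveI => M N h f hs.
have [g gE] := proj_lift (comph f (inlh P Q)) Pp hs.
have [k kE] := proj_lift (comph f (inrh P Q)) Qp hs.
exists (fromdsum g k) => z; rewrite fromdsumE homD gE kE !homhE -homD.
by rewrite -dsum_split.
Qed.

Lemma proj_zeromod : projective (zeromod A).
Proof.
apply: projectiveI => M N h f hs; exists (zeroh _ _) => x.
by rewrite (zeromodP x) !hom0.
Qed.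

Lemma proj_bigdsum n F : (forall i, (i < n)%N -> projective (F i)) ->
  projective (bigdsum n F : rmod A).
Proof.
elim: n F => [|n IH] F Fp; first exact: proj_zeromod.
by apply: proj_dsum; [apply: Fp|apply: IH => i lt; apply: (Fp i.+1)].
Qed.

Lemma free_cover M : exists n (f : hom (bigdsum n (fun _ => regmod A)) M), surj f.
Proof.
exists (\dim {:M}).
exists (frombd (\dim {:M}) (fun i => acth ((vbasis {:M})`_i))) => y.
exists (\sum_(i < \dim {:M}) bd_in (\dim {:M}) (fun _ => regmod A) i
   (coord (vbasis {:M}) i y *: (1 : A))).
rewrite hom_sum [RHS](coord_vbasis (memvf y)); apply: eq_bigr => i _.
by rewrite frombd_in // acthE linearZ /= ract1.
Qed.

(** The coordinates come from a section of a free cover. They reduce a map out of [P] to its values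
    at the [p i], which is how Hom(P, N) is compared with N tensored with Hom(P, A) below. *)
Lemma dual_basis P : projective P -> exists n (p : 'I_n -> P) (phi : 'I_n -> hom P (regmod A)),
  forall y, y = \sum_i ract (p i) (phi i y : A).
Proof.
move=> Pp; have [n [f fs]] := free_cover P.
have [s sE] := proj_lift (idh P) Pp fs.
exists n, (fun i => f (bd_in n (fun _ => regmod A) i (1 : A))), (fun i => comph (bd_pr n (fun _ => regmod A) i) s).
move=> y; rewrite -[LHS](idhE y) -sE {1}(bd_sum (s y)) hom_sum; apply: eq_bigr => i _.
by rewrite -!homP comphE ract_reg mul1r.
Qed.

(** The hypothesis on [h] says im h + ker f = M, so this is superfluity of ker f, tested by maps
    into [M] instead of submodules. The map [f] itself may fail to be onto, as the first map of a
    presentation does. *)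
Definition superfluous_ker M N (f : hom M N) :=
  forall X (h : hom X M), (forall m, exists x, f (h x) = f m) -> surj h.

Lemma superfluous_kerP M N (f : hom M N) : superfluous (hker f) <-> superfluous_ker f.
Proof.
split=> [sup X h hE m|sup U kU].
  have : himg h (full_smod X) = fullv :> {vspace M}.
    apply: sup; apply: eq_fullv => y; have [x xE] := hE y.
    rewrite -(subrK (h x) y); apply: memv_add.
      by apply/mem_hker; rewrite homB xE subrr.
    by apply/mem_himgf; exists x.
  move=> full; have /mem_himgf[x ->] : m \in himg h (full_smod X) by rewrite full memvf.
  by exists x.
have iU : surj (incl U).
  apply: sup => m; have /memv_addP[l kl [x xU ->]] : m \in (hker f + U)%VS by rewrite kU memvf.
  have [y yE] := mem_incl xU; exists y; rewrite yE homD.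
  by have /mem_hker -> := kl; rewrite add0r.
by apply: eq_fullv => x; have [y <-] := iU x; apply: incl_mem.
Qed.

(* A projective of least dimension mapping onto [M] is a projective cover, by
   Fitting's lemma. *)
Lemma projective_cover M : exists P (f : hom P M), [/\ projective P, surj f & superfluous_ker f].
Proof.
have [k0 [f0 f0s]] := free_cover M.
have [|[P f] /= [Pp fs] minP] := @ex_min_measure {P : rmod A & hom P M}
  (fun Pf => projective (projT1 Pf) /\ surj (projT2 Pf)) (fun Pf => \dim {:projT1 Pf})
  (existT _ _ f0).
  by split=> //=; apply: proj_bigdsum => *; apply: proj_regmod.
exists P, f; split=> // X h hE.
have fhs : surj (comph f h).
  by move=> y; have [m <-] := fs y; have [x xE] := hE m; exists x; rewrite homhE.
have [g gE] := proj_lift f Pp fhs.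
(* The endomorphism h g of P lies over M, so its Fitting summand still maps onto M. Minimality
   forces this summand to be P, and it lies in the image of h. *)
have [n n0 [r rE]] := fitting (comph h g); set U := himg _ _ in r rE.
have fE k m : f (iterh (comph h g) k m) = f m.
  elim: k => [|k IH]; rewrite /= homhE // -[RHS]IH; set z := iterh _ _ _.
  by rewrite -[RHS]gE !homhE.
have iU : surj (incl U).
  apply: inj_surj; first exact: incl_inj.
  apply: (minP (existT _ (submod U) (comph f (incl U)))); split=> /=.
    by apply: (proj_retract _ Pp); exists (incl U), r.
  move=> y; have [m <-] := fs y.
  have [|u uE] := @mem_incl _ _ _ U (iterh (comph h g) n m).
    by apply/mem_himgf; exists m.
  by exists u; rewrite homhE uE fE.
move=> m; have [u <-] := iU m; have /mem_himgf[z ->] := incl_mem u.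
by rewrite -(prednK n0) /= !homhE; eexists.
Qed.

Definition exact2 P1 P0 X (p1 : hom P1 P0) (p0 : hom P0 X) :=
  forall x, p0 x = 0 <-> exists y, x = p1 y.

Lemma min_presentation M : exists P1 P0 (p1 : hom P1 P0) (p0 : hom P0 M),
  [/\ projective P0 /\ projective P1, surj p0, exact2 p1 p0, superfluous_ker p0 & superfluous_ker p1].
Proof.
have [P0 [p0 [P0p p0s p0k]]] := projective_cover M.
have [P1 [c [P1p cs ck]]] := projective_cover (submod (hker p0)).
exists P1, P0, (comph (incl _) c), p0; split=> //.
  move=> x; split=> [/mem_hker xk|[y ->]]; last first.
    by apply/mem_hker; rewrite homhE; apply: incl_mem.
  have [z zE] := mem_incl xk; have [y yE] := cs z.
  by exists y; rewrite homhE yE zE.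
move=> X h hE; apply: ck => m; have [x xE] := hE m; exists x.
by move: xE; rewrite !homhE; apply: inj_eqh; apply: incl_inj.
Qed.

Lemma min_presentationP P1 P0 M (p1 : hom P1 P0) (p0 : hom P0 M) :
  minimal_projective_presentation p1 p0 <->
  [/\ projective P0 /\ projective P1, surj p0, exact2 p1 p0, superfluous_ker p0 & superfluous_ker p1].
Proof.
split=> [[P0p P1p [/surjective_homP p0s lk] /superfluous_kerP k0 /superfluous_kerP k1]|
         [[P0p P1p] p0s ex /superfluous_kerP k0 /superfluous_kerP k1]].
  split=> // x; split=> [x0|[y ->]].
    have : x \in lker p0 by rewrite memv_ker x0.
    by rewrite -lk => /memv_imgP[y _ ->]; exists y.
  apply/eqP; rewrite -memv_ker -lk; apply: memv_img; exact: memvf.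
split=> //; split; first exact/surjective_homP.
apply/vspaceP => x; apply/memv_imgP/idP => [[y _ ->]|].
  by rewrite memv_ker; apply/eqP/ex; exists y.
by rewrite memv_ker => /eqP/ex[y ->]; exists y => //; apply: memvf.
Qed.

(* [W] is a quotient of a finite direct sum of members of [C]. *)
Definition gen (C : rmod A -> Prop) W :=
  forall U : smod W, (forall X (h : hom X W) x, C X -> h x \in U) -> forall w, w \in U.

Lemma gen_self (C : rmod A -> Prop) X : C X -> gen C X.
Proof. by move=> CX U CU w; rewrite -(idhE w); apply: CU. Qed.

Lemma gen_trans (C D : rmod A -> Prop) W : (forall X, D X -> gen C X) -> gen D W -> gen C W.
Proof.
move=> DC DW U CU; apply: DW => X h x /DC CX.
have [V VE] := hom_smod_preim h U; apply/VE; apply: CX => Y k y CY; apply/VE.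
by rewrite -comphE; apply: CU.
Qed.

Lemma gen_surj (C : rmod A -> Prop) X W (f : hom X W) : surj f -> gen C X -> gen C W.
Proof.
move=> fs CX U CU w; have [x <-] := fs w; have [V VE] := hom_smod_preim f U.
apply/VE; apply: CX => Y k y CY; apply/VE; rewrite -comphE; exact: CU.
Qed.

(** Among the pairs (Z, h) with [Phi Z], one whose image in [W] has largest dimension cannot gain
    from a further summand out of [C], so its image contains every image of a member of [C]. The
    predicate [Phi] stands for any property that passes to finite direct sums. *)
Lemma gen_cover (C Phi : rmod A -> Prop) W :
  Phi (zeromod A) -> (forall X Y, Phi X -> Phi Y -> Phi (dsum X Y)) ->
  (forall X, C X -> Phi X) -> gen C W ->
  exists Z (h : hom Z W), Phi Z /\ surj h.
Proof.
move=> Phi0 PhiD CPhi CW.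
have [||[Z h] /= ZPhi maxZ] := @ex_max_measure {Z : rmod A & hom Z W}
  (fun Zh => Phi (projT1 Zh)) (fun Zh => \dim (limg (projT2 Zh))) (\dim {:W})
  (existT _ _ (zeroh (zeromod A) W)) => //.
  by move=> x _; apply/dimvS/subvf.
exists Z, h; split=> // w.
suff /mem_himgf[x ->] : w \in himg h (full_smod Z) by exists x.
apply: CW => X g x CX.
have sub : (limg h <= limg (fromdsum g h))%VS.
  apply/subvP => _ /memv_imgP[z _ ->]; apply/memv_imgP; exists (inrh X Z z); first exact: memvf.
  by rewrite fromdsumE !dsumE hom0 add0r.
have := maxZ (existT _ (dsum X Z) (fromdsum g h)) (PhiD _ _ (CPhi _ CX) ZPhi).
rewrite (geq_leqif (dimv_leqif_sup sub)) => /subvP/(_ (g x)); apply.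
apply/memv_imgP; exists (inlh X Z x); first exact: memvf.
by rewrite fromdsumE !dsumE hom0 addr0.
Qed.

(* [Hom(N, tau X) = 0] when [p1] is the map of a minimal presentation of [X]. *)
Definition factors_thru P1 P0 (p1 : hom P1 P0) N :=
  forall g : hom P1 N, exists u : hom P0 N, forall y, g y = u (p1 y).

Lemma factors_thru_zeromod P1 P0 (p1 : hom P1 P0) : factors_thru p1 (zeromod A).
Proof.
by move=> g; exists (zeroh _ _) => y; rewrite zerohE; apply: zeromodP.
Qed.

Lemma factors_thru_dsum P1 P0 (p1 : hom P1 P0) X Y : factors_thru p1 X -> factors_thru p1 Y -> factors_thru p1 (dsum X Y).
Proof.
move=> EX EY g; have [u uE] := EX (comph (fsth X Y) g).
have [v vE] := EY (comph (sndh X Y) g); exists (todsum u v) => y.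
by rewrite todsumE -uE -vE !homhE !dsumE; case: (g y).
Qed.

Lemma factors_thru_surj P1 P0 (p1 : hom P1 P0) X Y (f : hom X Y) : projective P1 -> surj f ->
  factors_thru p1 X -> factors_thru p1 Y.
Proof.
move=> P1p fs EX g; have [k kE] := proj_lift g P1p fs; have [u uE] := EX k.
by exists (comph f u) => y; rewrite -kE uE homhE.
Qed.

Lemma factors_thru_gen (C : rmod A -> Prop) P1 P0 (p1 : hom P1 P0) W : projective P1 ->
  (forall N, C N -> factors_thru p1 N) -> gen C W -> factors_thru p1 W.
Proof.
move=> P1p CE CW.
have [Z [h [EZ hs]]] := gen_cover (factors_thru_zeromod p1) (@factors_thru_dsum _ _ p1) CE CW.
exact: factors_thru_surj hs EZ.
Qed.

(* [Ext^1(X, Fac C) = 0] *)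
Definition rigid X (C : rmod A -> Prop) :=
  forall Y Z (f : hom Y Z) (h : hom X Z), surj f -> gen C (submod (hker f)) ->
    exists h' : hom X Y, forall x, f (h' x) = h x.

Lemma rigid_sub X (C D : rmod A -> Prop) : (forall N, D N -> gen C N) -> rigid X C -> rigid X D.
Proof. by move=> DC XC Y Z f h fs Dk; apply: XC => //; apply: gen_trans Dk. Qed.

Lemma rigid_retract X X' C : retract X' X -> rigid X C -> rigid X' C.
Proof.
move=> [i [p pi]] XC Y Z f h fs Ck; have [g gE] := XC _ _ f (comph h p) fs Ck.
by exists (comph g i) => x; rewrite homhE gE homhE pi.
Qed.

Lemma rigid_dsum X Y C : rigid X C -> rigid Y C -> rigid (dsum X Y) C.
Proof.
move=> XC YC U V f h fs Ck; have [g gE] := XC _ _ f (comph h (inlh X Y)) fs Ck.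
have [k kE] := YC _ _ f (comph h (inrh X Y)) fs Ck.
by exists (fromdsum g k) => z; rewrite fromdsumE homD gE kE !homhE -homD -dsum_split.
Qed.

Lemma rigid_proj X C : projective X -> rigid X C.
Proof. by move=> Xp Y Z f h fs _; apply: proj_lift. Qed.

Lemma rigid_zeromod C : rigid (zeromod A) C.
Proof. exact/rigid_proj/proj_zeromod. Qed.

Lemma rigid_bigdsum n F C : (forall i, (i < n)%N -> rigid (F i) C) -> rigid (bigdsum n F) C.
Proof.
elim: n F => [|n IH] F FC; first exact: rigid_zeromod.
by apply: rigid_dsum; [apply: FC|apply: IH => i; apply: (FC i.+1)].
Qed.

(** A lift a : P0 -> Y of h p0 sends the image of p1 into ker f. There a p1 = u p1 for some u : P0
    -> ker f, and a - u descends to X. *)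
Lemma factors_thru_rigid P1 P0 X (p1 : hom P1 P0) (p0 : hom P0 X) (C : rmod A -> Prop) :
  projective P0 -> projective P1 -> surj p0 -> exact2 p1 p0 ->
  (forall N, C N -> factors_thru p1 N) -> rigid X C.
Proof.
move=> P0p P1p p0s ex CE Y Z f h fs Ck.
have [a aE] := proj_lift (comph h p0) P0p fs.
have p01 y : p0 (p1 y) = 0 by apply/ex; exists y.
have [|b bE] := @corestrict _ _ (hker f) (comph a p1).
  by move=> y; apply/mem_hker; rewrite homhE aE homhE p01 hom0.
have [u uE] := factors_thru_gen P1p CE Ck b.
have [|h' hE] := @factor_surj _ _ _ _ _ p0 (subh a (comph (incl _) u)) p0s.
  by move=> x /ex[y ->]; rewrite !homhE -uE bE homhE subrr.
exists h' => x; have [z <-] := p0s x; rewrite hE !homhE homB aE homhE.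
by have /mem_hker -> := incl_mem (u z); rewrite subr0.
Qed.

(* Split the pushout of [P0] along [g]: this changes [g], modulo maps through [p1],
   into a map with image in [g (ker p1)], which is smaller because [ker p1] is
   superfluous. *)
Lemma rigid_factors_thru P1 P0 X (p1 : hom P1 P0) (p0 : hom P0 X) (C : rmod A -> Prop) N :
  projective P0 -> surj p0 -> exact2 p1 p0 -> superfluous_ker p1 ->
  rigid X C -> gen C N -> factors_thru p1 N.
Proof.
move=> P0p p0s ex supk XC CN g.
have [d] := ubnP (\dim (limg g)); elim: d g => // d IH g ltd.
have p01 y : p0 (p1 y) = 0 by apply/ex; exists y.
pose D := himg (todsum g (subh (zeroh _ _) p1)) (full_smod P1).
have DP n p : (n, p) \in D <-> exists y, n = g y /\ p = - p1 y.
  split=> [/mem_himgf[y]|[y [-> ->]]].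
    by rewrite todsumE !homhE sub0r => -[-> ->]; exists y.
  by apply/mem_himgf; exists y; rewrite todsumE !homhE sub0r.
have [|f fE] := @factor_surj _ _ _ _ _ (proj D) (fromdsum (zeroh N X) p0) (@proj_surj _ _ _ D).
  by move=> [n p] /proj_eq0/DP[y [-> ->]]; rewrite fromdsumE /= zerohE homN p01 oppr0 addr0.
have fs : surj f.
  move=> x; have [p pE] := p0s x; exists (proj D (0, p)).
  by rewrite fE fromdsumE /= hom0 add0r.
have [|j jE] := @corestrict _ _ (hker f) (comph (proj D) (inlh N P0)).
  by move=> n; apply/mem_hker; rewrite homhE fE fromdsumE dsumE /= zerohE hom0 addr0.
have js : surj j.
  move=> y; have [[n p] npE] := proj_surj (incl _ y).
  have : f (incl _ y) = 0 by apply/mem_hker/incl_mem.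
  rewrite -npE fE fromdsumE zerohE add0r => /ex[z /= pz].
  exists (n + g z); apply: (inj_eqh (f := incl (hker f))); first exact: incl_inj.
  rewrite jE homhE -npE; apply/eqP; rewrite -subr_eq0 -homB; apply/eqP/proj_eq0.
  rewrite dsumE; apply/DP; exists z; split; first by rewrite /= addrC addKr.
  by rewrite /= pz sub0r.
have [s sE] := XC _ _ f (idh X) fs (gen_surj js CN).
(* The inclusion of P0 into the pushout and s p0 agree after f, so their difference t takes values
   in the image of N; u lifts t to N along j. *)
have [|t tE] := @corestrict _ _ (hker f) (subh (comph (proj D) (inrh N P0)) (comph s p0)).
  move=> p; apply/mem_hker; rewrite !homhE homB sE homhE fE fromdsumE dsumE.
  by rewrite zerohE add0r subrr.
have [u uE] := proj_lift t P0p js.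
(* The element g y - u (p1 y) of N dies in the pushout, so it comes from a relation (g z, - p1 z)
   whose second component is zero. *)
have key y : exists2 z, g y - u (p1 y) = g z & p1 z = 0.
  have : proj D (g y - u (p1 y), 0) = 0.
    have -> : (g y - u (p1 y), 0) = inlh N P0 (g y) - inlh N P0 (u (p1 y)).
      by rewrite -homB dsumE.
    have := jE (u (p1 y)); rewrite uE tE !homhE p01 hom0 subr0 homB => <-.
    rewrite -homB; apply/proj_eq0; rewrite !dsumE; apply/DP; exists y.
    by rewrite /= subr0 sub0r.
  move=> /proj_eq0/DP[z [gz pz]]; exists z => //.
  by rewrite -[LHS]opprK -pz oppr0.
have [g0|gn0] := classic (forall y, g y = 0).
  by exists (zeroh _ _) => y; rewrite g0 homhE.
have [|v vE] := IH (subh g (comph u p1)); last first.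
  by exists (addh v u) => y; rewrite addhE -vE !homhE subrK.
rewrite -ltnS; apply: leq_trans ltd; rewrite ltnS ltnNge; apply/negP => le; apply: gn0.
have sub : (limg (subh g (comph u p1)) <= limg g)%VS.
  apply/subvP => _ /memv_imgP[y _ ->]; rewrite !homhE; have [z -> _] := key y.
  by apply: memv_img; apply: memvf.
have ksurj : surj (incl (hker g)).
  apply: supk => m; have : g m \in limg (subh g (comph u p1)).
    move: le; rewrite (geq_leqif (dimv_leqif_sup sub)) => /subvP; apply.
    by apply: memv_img; apply: memvf.
  move=> /memv_imgP[y _]; rewrite !homhE; have [z -> pz] := key y => gmz.
  have [|x xE] := @mem_incl _ _ _ (hker g) (m - z).
    by apply/mem_hker; rewrite homB gmz subrr.
  by exists x; rewrite xE homB pz subr0.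
by move=> y; have [x <-] := ksurj y; apply/mem_hker/incl_mem.
Qed.

End Projectives.

(** * tau-rigidity without tau *)

Section TauRigid.
Variables (K : fieldType) (A : fdalgType K).
Implicit Types M N P X Y Z W : rmod A.

Section Transpose.
Variables (P1 P0 N : rmod A) (p1 : hom P1 P0).
Hypotheses (P1p : projective P1) (P0p : projective P0).

Let U := himg (precomp p1) (full_smod (homA P0)).

Definition homA_of (P : rmod A) (phi : hom P (regmod A)) : homA P :=
  vsproj (homv P (regmod A)) phi.
Lemma homA_ofE (P : rmod A) (phi : hom P (regmod A)) y : vsval (homA_of phi) y = phi y.
Proof. by rewrite vsprojK // hom_homv. Qed.

Lemma homA_hom (P : rmod A) (phi : homA P) x a :
  vsval phi (ract x a) = (vsval phi x : A) * a.
Proof. by rewrite (homvP _ (subvsP phi)). Qed.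

Lemma precomp_mem (psi : homA P0) : precomp p1 psi \in U.
Proof. by apply/mem_himgf; exists psi. Qed.

Lemma precompE (psi : homA P0) y : vsval (precomp p1 psi) y = vsval psi (p1 y).
Proof. by rewrite lfunE precomp_funE. Qed.

(** Half of the duality between Hom(N, D Tr X) and the cokernel of Hom(P0, N) -> Hom(P1, N). A
    functional xi that vanishes on the maps through p1 but not on g yields the pairing xi(x phi) of
    N with Hom(P1, A); it kills the image of Hom(P0, A), hence is a map N -> D Tr X and vanishes. By
    a dual basis of P1, g is a sum of maps x phi, so xi(g) = 0. *)
Lemma factors_thru_of_tau_orthogonal :
  (forall (f : hom N (dual (transpose p1))) x, f x = 0) -> factors_thru p1 N.
Proof.
move=> f0 g; have [||B BP] := @vspace_compr K 'Hom(P1, N)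
  (fun g => exists u : hom P0 N, forall y, g y = u (p1 y)).
- by exists (zeroh _ _) => y; rewrite zerohE lfunE.
- move=> k g1 g2 /= [u uE] [v vE]; exists (addh (scaleh k u) v) => y.
  by rewrite !homhE add_lfunE scale_lfunE uE vE.
have [/BP//|gB] := boolP ((g : 'Hom(P1, N)) \in B).
have [xi [xiB xig]] := lfun_separate gB; case: xig.
(* The map y |-> x phi(y), the image of the tensor of x and phi in Hom(P1, N). *)
pose pr (x : N) (phi : homA P1) : 'Hom(P1, N) := ((acth x : 'Hom(regmod A, N)) \o vsval phi)%VF.
have prE x phi y : pr x phi y = ract x (vsval phi y : A).
  by rewrite comp_lfunE; exact: acthE.
pose Psi x phi : K^o := xi (pr x phi).
have Psi_linr x : linear (Psi x).
  move=> k phi psi; rewrite /Psi -linearP; congr (xi _); apply/lfunP => y.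
  rewrite add_lfunE scale_lfunE !prE linearP add_lfunE scale_lfunE.
  by rewrite ractPr.
have Psi_linl phi : linear (Psi^~ phi).
  move=> k x y; rewrite /Psi -linearP; congr (xi _); apply/lfunP => z.
  by rewrite add_lfunE scale_lfunE !prE ractPl.
have PsiU x phi : phi \in U -> Psi x phi = 0.
  move=> /mem_himgf[psi ->]; apply: xiB; apply/BP.
  exists (comph (acth x) (homh (subvsP psi))) => y.
  by rewrite prE precompE comphE acthE.
pose Phi x (c : quov U) : K^o := Psi x (quorep c).
have Phi_lin x : linear (Phi x) by move=> k c d; rewrite /Phi linearP Psi_linr.
have PhiE x phi : Phi x (quopi U phi) = Psi x phi.
  apply/eqP; rewrite -subr_eq0; apply/eqP; rewrite /Phi.
  have := PsiU x _ (quorepP U phi); rewrite -scaleN1r addrC Psi_linr.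
  by rewrite scaleN1r addrC.
pose F (x : N) : dual (transpose p1) := linfun (Phi x).
have FE x c : (F x : 'Hom(quov U, K^o)) c = Phi x c by apply: linfunE.
have F_lin : linear F.
  move=> k x y; apply/lfunP => c.
  by rewrite add_lfunE scale_lfunE !FE /Phi Psi_linl.
have F_act x a : F (ract x a) = ract (F x) a.
  apply/lfunP => c; rewrite FE.
  have -> : (ract (F x) a : 'Hom(quov U, K^o)) c =
     (F x : 'Hom(quov U, K^o)) (ract (c : transpose p1) (a : A^c)) by exact: (@dual_actE K A (transpose p1) (F x) a c).
  rewrite FE [X in Phi x X](_ : _ = quopi U (ract (quorep c) (a : A^c))) // PhiE /Phi /Psi.
  congr (xi _); apply/lfunP => y; rewrite !prE homA_actE.
  by rewrite ractM.
have F0 x : F x = 0 by rewrite -(mkhomE F_lin F_act) f0.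
have [n [p [phi pE]]] := dual_basis P1p.
have -> : (g : 'Hom(P1, N)) = \sum_i pr (g (p i)) (homA_of (phi i)).
  apply/lfunP => y; rewrite sum_lfunE {1}(pE y) hom_sum; apply: eq_bigr => i _.
  by rewrite prE homA_ofE homP.
rewrite linear_sum big1 // => i _.
by rewrite -[LHS]/(Psi _ _) -PhiE -FE F0 lfunE.
Qed.

(** The pairing F(x, phi) given by f is balanced over A, so by a dual basis of P1 it depends only on
    the map x phi : P1 -> N. That map is u p1; expanding u by a dual basis (q_l, d_l) of P0 turns
    F(x, phi) into the sum of the F(u(q_l), d_l p1), and each d_l p1 is zero in the transpose. *)
Lemma tau_orthogonal_of_factors_thru : factors_thru p1 N ->
  forall (f : hom N (dual (transpose p1))) x, f x = 0.
Proof.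
move=> E f x; apply/lfunP => c; rewrite [RHS]zero_lfunE -(quorepK c).
pose F (x : N) (phi : homA P1) : K^o := (f x : 'Hom(quov U, K^o)) (quopi U phi).
rewrite -/(F x (quorep c)); set phi := quorep c.
have F_add z I (r : seq I) (G : I -> homA P1) : F z (\sum_(i <- r) G i) = \sum_(i <- r) F z (G i).
  by rewrite /F !linear_sum.
have F_act z a psi : F (ract z a) psi = F z (ract psi (a : A^c)).
  rewrite /F homP; transitivity ((f z : 'Hom(quov U, K^o)) (ract (quopi U psi : transpose p1) (a : A^c))).
    exact: (@dual_actE K A (transpose p1) (f z) a (quopi U psi)).
  by congr (fun_of_lfun _ _); apply: (quo_act_pi U).
have [n [p [b pE]]] := dual_basis P1p.
have FE z psi : F z psi = \sum_i F (ract z (vsval psi (p i) : A)) (homA_of (b i)).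
  have {1}-> : psi = \sum_i ract (homA_of (b i)) (vsval psi (p i) : A^c).
    apply: subvs_inj; apply/lfunP => y.
    rewrite {1}(pE y) linear_sum linear_sum /= sum_lfunE; apply: eq_bigr => i _.
    by rewrite homA_actE homA_hom homA_ofE.
  by rewrite F_add; apply: eq_bigr => i _; rewrite F_act.
have [u uE] := E (comph (acth x) (homh (subvsP phi))).
have [m [q [d qE]]] := dual_basis P0p.
rewrite FE.
transitivity (\sum_l \sum_i F (ract (u (q l)) (vsval (precomp p1 (homA_of (d l))) (p i) : A)) (homA_of (b i))).
  rewrite exchange_big; apply: eq_bigr => i _.
  have -> : ract x (vsval phi (p i) : A) = u (p1 (p i)).
    by rewrite -uE comphE acthE.
  rewrite {1}(qE (p1 (p i))) hom_sum /F hom_sum sum_lfunE; apply: eq_bigr => l _.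
  by rewrite homP precompE homA_ofE.
rewrite big1 // => l _; rewrite -FE /F.
suff -> : quopi U (precomp p1 (homA_of (d l))) = 0 by rewrite linear0.
by apply/eqP; rewrite quopi_eq0; apply: precomp_mem.
Qed.

End Transpose.

Lemma tau_rigidP M : tau_rigid M <-> rigid M (eq M).
Proof.
split=> [[T [[P1 [P0 [p1 [p0 [/min_presentationP[[P0p P1p] p0s ex _ _] TE]]]]] T0]]|Mr].
  apply: (factors_thru_rigid P0p P1p p0s ex) => N <-; apply: factors_thru_of_tau_orthogonal => // f x.
  have /isoP[h [k [hK kK]]] := TE.
  by rewrite -(kK (f x)) -(comphE k f) (T0 (comph k f)) zero_lfunE hom0.
have [P1 [P0 [p1 [p0 mp]]]] := min_presentation M.
have [[P0p P1p] p0s ex _ k1] := mp.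
exists (dual (transpose p1)); split.
  exists P1, P0, p1, p0; split; [exact/min_presentationP|exact: iso_refl].
move=> f; apply/lfunP => x; rewrite zero_lfunE; apply: tau_orthogonal_of_factors_thru => //.
by apply: (rigid_factors_thru P0p p0s ex k1 Mr); apply: gen_self.
Qed.

End TauRigid.

(** * Linear independence of hom dimensions *)

Section HomDimension.
Variables (K : fieldType) (A : fdalgType K).
Implicit Types M N P X Y Z W : rmod A.

Definition hdim M N := \dim (homv M N).

Lemma hdim_eq0P M N : hdim M N = 0%N <-> forall (f : hom M N) x, f x = 0.
Proof.
split=> [/eqP|f0].
  rewrite dimv_eq0 => /eqP h0 f x; have := hom_homv f.
  by rewrite h0 memv0 => /eqP->; rewrite zero_lfunE.
apply/eqP; rewrite dimv_eq0; apply/eqP/eq_0v => f fP; apply/lfunP => x.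
by rewrite zero_lfunE -[LHS]/(homh fP x) f0.
Qed.

(** The condition [factors_thru d N] is surjectivity of Hom(R0, N) -> Hom(R1, N), which completes
    the left exact Hom sequence to a short exact one. Additivity and isomorphism invariance of
    [hdim] are obtained as special cases. *)
Lemma hdim_exact R1 R0 X (d : hom R1 R0) (p : hom R0 X) N :
  surj p -> exact2 d p -> factors_thru d N -> hdim R0 N = (hdim X N + hdim R1 N)%N.
Proof.
move=> ps ex E.
have precomp_lin U V (g : 'Hom(U, V)) : linear (fun f : 'Hom(V, N) => (f \o g)%VF).
  move=> k f h; apply/lfunP => x.
  by rewrite comp_lfunE !add_lfunE !scale_lfunE !comp_lfunE.
pose D := linfun (fun f : 'Hom(R0, N) => (f \o d)%VF).
pose Q := linfun (fun f : 'Hom(X, N) => (f \o p)%VF).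
have DE f x : D f x = f (d x) by rewrite linfunE ?comp_lfunE //; apply: precomp_lin.
have QE f x : Q f x = f (p x) by rewrite linfunE ?comp_lfunE //; apply: precomp_lin.
have pd x : p (d x) = 0 by apply/ex; exists x.
rewrite /hdim -(limg_ker_dim D (homv R0 N)); congr (_ + _)%N; last first.
  congr (\dim _); apply/vspaceP => g; apply/memv_imgP/idP => [[f fP ->]|gP].
    by apply/homvP => x a; rewrite !DE homP (homvP _ fP).
  have [u uE] := E (homh gP); exists (u : 'Hom(R0, N)); first exact: hom_homv.
  by apply/lfunP => x; rewrite DE -uE.
transitivity (\dim (Q @: homv X N)); last first.
  apply: limg_dim_eq; apply: eq_0v => f; rewrite memv_cap memv_ker => /andP[_ /eqP Qf].
  by apply/lfunP => x; have [y <-] := ps x; rewrite -QE Qf !zero_lfunE.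
congr (\dim _); apply/vspaceP => f; apply/idP/memv_imgP => [|[g gP ->]].
  rewrite memv_cap memv_ker => /andP[fP /eqP Df].
  have [|h hE] := @factor_surj _ _ _ _ _ p (homh fP) ps.
    by move=> x /ex[y ->]; rewrite -[LHS]/(f (d y)) -DE Df zero_lfunE.
  exists (h : 'Hom(X, N)); first exact: hom_homv.
  by apply/lfunP => x; rewrite QE hE.
rewrite memv_cap memv_ker; apply/andP; split.
  by apply/homvP => x a; rewrite !QE homP (homvP _ gP).
by apply/eqP/lfunP => x; rewrite DE QE pd linear0 zero_lfunE.
Qed.

Lemma hdim_zeromod N : hdim (zeromod A) N = 0%N.
Proof. by apply/hdim_eq0P => f x; rewrite (zeromodP x) hom0. Qed.

Lemma hdim_dsum X Y N : hdim (dsum X Y) N = (hdim X N + hdim Y N)%N.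
Proof.
apply: (hdim_exact (d := inrh X Y) (p := fsth X Y)).
- by move=> x; exists (inlh X Y x); rewrite !dsumE.
- move=> z; rewrite fsthE; split=> [z0|[y ->]]; last by rewrite dsumE.
  by exists z.2; rewrite [LHS]dsum_split z0 hom0 add0r.
- by move=> g; exists (comph g (sndh X Y)) => y; rewrite comphE !dsumE.
Qed.

Lemma hdim_iso X Y N : iso X Y -> hdim X N = hdim Y N.
Proof.
move=> /isoP[f [g [fK gK]]].
rewrite (hdim_exact (d := zeroh (zeromod A) X) (p := f) (N := N)) ?hdim_zeromod ?addn0 //.
- by move=> y; exists (g y).
- move=> x; split=> [fx|[y ->]]; last by rewrite zerohE hom0.
  by exists 0; rewrite hom0 -(fK x) fx hom0.
- by move=> h; exists (zeroh _ _) => y; rewrite zerohE (zeromodP y) hom0.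
Qed.

Lemma hdim_bigdsum n F N : hdim (bigdsum n F) N = (\sum_(i < n) hdim (F i) N)%N.
Proof.
elim: n F => [|n IH] F; first by rewrite big_ord0 hdim_zeromod.
by rewrite big_ord_recl hdim_dsum IH.
Qed.

End HomDimension.

(** * Traces, and Nakayama's lemma over a local endomorphism ring *)

Section Trace.
Variables (K : fieldType) (A : fdalgType K).
Implicit Types M N P X Y Z W : rmod A.

(** The smallest subspace containing all images from [C] is already a submodule, so generation may
    be tested on subspaces. Nakayama's lemma below produces subspaces stable under endomorphisms but
    not under [A]. *)
Lemma gen_vspace (C : rmod A -> Prop) W (V : {vspace W}) : gen C W ->
  (forall X (h : hom X W) x, C X -> h x \in V) -> forall w, w \in V.
Proof.
move=> CW CV w.
pose inV (V : {vspace W}) := forall X (h : hom X W) x, C X -> h x \in V.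
have [||x a xP V' V'P|U UP] := @smod_compr _ _ W (fun w => forall V, inV V -> w \in V).
- by move=> V' _; apply: mem0v.
- by move=> k x y xV yV V' V'P; rewrite memvD ?memvZ ?xV ?yV.
- have := xP (ractf W a @^-1: V')%VS; rewrite -memv_preim ractfE; apply.
  by move=> X h y CX; rewrite -memv_preim ractfE -homP; apply: V'P.
by have /UP := CW U (fun X h x CX => (UP (h x)).2 (fun V' V'P => V'P X h x CX)) w; apply.
Qed.

(** This [U] is the trace of [C] in [W], the largest submodule of [W] in Fac [C]. *)
Lemma trace_exists (C : rmod A -> Prop) W : exists U : smod W,
  [/\ forall X (h : hom X W) x, C X -> h x \in U,
      forall V : {vspace W}, (forall X (h : hom X W) x, C X -> h x \in V) ->
        forall w, w \in U -> w \in V &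
      gen C (submod U)].
Proof.
pose inV (V : {vspace W}) := forall X (h : hom X W) x, C X -> h x \in V.
have [||x a xP V' V'P|U UP] := @smod_compr _ _ W (fun w => forall V, inV V -> w \in V).
- by move=> V' _; apply: mem0v.
- by move=> k x y xV yV V' V'P; rewrite memvD ?memvZ ?xV ?yV.
- have := xP (ractf W a @^-1: V')%VS; rewrite -memv_preim ractfE; apply.
  by move=> X h y CX; rewrite -memv_preim ractfE -homP; apply: V'P.
have CU X (h : hom X W) x : C X -> h x \in U.
  by move=> CX; apply/UP => V VP; apply: VP.
exists U; split=> // [V VP w /UP|V VP u]; first exact.
suff /mem_himg[v vV uv] : incl U u \in himg (incl U) V.
  by rewrite (inj_eqh (@incl_inj _ _ _ U) uv).
have /UP := incl_mem u; apply=> X h x CX.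
have [h' hE] := corestrict (fun x => CU X h x CX).
by apply/mem_himg; exists (h' x); rewrite ?hE // VP.
Qed.

(** A map from X to W modulo the trace lifts to W, since the trace lies in Fac [D]. The lift has
    image in the trace because X belongs to [C], so the map was zero. *)
Lemma trace_quo_hom0 (C D : rmod A -> Prop) W (U : smod W) X :
  (forall Y (h : hom Y W) x, C Y -> h x \in U) -> gen C (submod U) ->
  (forall Y, C Y -> gen D Y) -> C X -> rigid X D -> hdim X (quomod U) = 0%N.
Proof.
move=> CU Ck CD CX XD; apply/hdim_eq0P => h x.
have [|h' h'E] := XD _ _ (proj U) h (@proj_surj _ _ _ U).
  apply: (gen_trans CD); have [|c cE] := @corestrict _ _ _ _ (hker (proj U)) (incl U).
    by move=> u; apply/mem_hker/proj_eq0/incl_mem.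
  apply: (gen_surj (f := c) _ Ck) => y.
  have /mem_hker/proj_eq0 /mem_incl[u uE] := incl_mem y.
  exists u; apply: (inj_eqh (f := incl (hker (proj U)))); first exact: incl_inj.
  by rewrite cE.
by rewrite -h'E; apply/proj_eq0/CU.
Qed.

(* Nakayama's lemma for [X] as a module over the local ring [End X]. *)
Lemma nakayama_indec X (U : {vspace X}) : indecomposable X ->
  (forall (e : hom X X) x, x \in U -> e x \in U) ->
  (forall V : {vspace X}, (U <= V)%VS ->
     (forall (r : hom X X) x, ~ inj r -> r x \in V) -> V = fullv) ->
  U = fullv.
Proof.
move=> Xi Uinv gV; apply: NNPP => Un.
have [||W [UW Winv Wn] maxW] := @ex_max_measure {vspace X}
  (fun W : {vspace X} => [/\ (U <= W)%VS, forall (e : hom X X) x, x \in W -> e x \in W & W <> fullv])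
  (fun W : {vspace X} => \dim W) (\dim {:X}) U => //.
  by move=> W _; apply/dimvS/subvf.
have [v vW] : exists v, v \notin W.
  apply: NNPP => nex; apply: Wn; apply: eq_fullv => x; apply/negPn/negP => xW.
  by apply: nex; exists x.
have [||W' W'P] := @vspace_compr K X
  (fun y => exists w (e : hom X X), w \in W /\ y = w + e v).
- by exists 0, (zeroh _ _); rewrite mem0v homhE addr0.
- move=> k y1 y2 [w1 [e1 [w1W ->]]] [w2 [e2 [w2W ->]]].
  exists (k *: w1 + w2), (addh (scaleh k e1) e2); rewrite memvD ?memvZ //; split=> //.
  by rewrite !homhE scalerDr addrACA.
have W'f : W' = fullv.
  apply: NNPP => W'n; have WW' : (W <= W')%VS.
    by apply/subvP => w wW; apply/W'P; exists w, (zeroh _ _); rewrite homhE addr0.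
  have : (\dim W' <= \dim W)%N.
    apply: maxW; split=> //; first exact: subv_trans WW'.
    move=> e x /W'P[w [e' [wW ->]]]; apply/W'P; exists (e w), (comph e e').
    by rewrite homD homhE; split=> //; apply: Winv.
  rewrite (geq_leqif (dimv_leqif_sup WW')) => /subvP sub; case/negP: vW; apply: sub.
  by apply/W'P; exists 0, (idh X); rewrite mem0v homhE add0r.
have nz : ~ inj (zeroh X X).
  by move=> z0; have [x []] := indec_nonzero Xi; apply: z0; rewrite homhE.
(* V = W + rad(End X) v contains U and, as X = W + End(X) v, every r x with r not invertible. Hence
   V = X and v = w + r v; since 1 - r is invertible, v lies in W, a contradiction. *)
have [||V VP] := @vspace_compr K X
  (fun y => exists w (r : hom X X), [/\ w \in W, ~ inj r & y = w + r v]).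
- by exists 0, (zeroh _ _); rewrite mem0v homhE addr0.
- move=> k y1 y2 [w1 [e1 [w1W n1 ->]]] [w2 [e2 [w2W n2 ->]]].
  exists (k *: w1 + w2), (addh (comph (scaleh k (idh X)) e1) e2).
  rewrite memvD ?memvZ //; split=> //; first by apply: noniso_add => //; apply: noniso_compl.
  by rewrite !homhE scalerDr addrACA.
have /VP[w [r [wW rn vE]]] : v \in V.
  rewrite (gV V) ?memvf //.
    by apply/subvP => u uU; apply/VP; exists u, (zeroh _ _); rewrite homhE addr0 (subvP UW).
  move=> r x rn; have /W'P[w [e [wW ->]]] : x \in W' by rewrite W'f memvf.
  apply/VP; exists (r w), (comph r e); rewrite homD homhE; split=> //; first exact: Winv.
  exact: noniso_compr.
have [||/end_bij[g [gK _]]] := @indec_local _ _ X r (subh (idh X) r) Xi => //.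
  by move=> x; rewrite !homhE addrC subrK.
case/negP: vW; rewrite -(gK v) !homhE; apply: Winv.
by rewrite {1}vE addrK.
Qed.

End Trace.

(** * Independence of the functions hom(T_i, -) on Fac T *)

Section Independence.
Variables (K : fieldType) (A : fdalgType K).
Implicit Types M N P X Y Z W : rmod A.
Variables (I : finType) (T : I -> rmod A).
Hypothesis Tindec : forall i, indecomposable (T i).
Hypothesis Tiso : forall i j, iso (T i) (T j) -> i = j.

Definition among (S : {set I}) X := exists2 i, i \in S & X = T i.

(* In a minimal subfamily of [S] generating [S'], each [T k] is generated by the
   others and by non-invertible endomorphisms through [S'], hence by the others. *)
Lemma mutual_gen_empty (S S' : {set I}) : [disjoint S & S'] ->
  (forall l, l \in S' -> gen (among S) (T l)) ->
  (forall k, k \in S -> gen (among S') (T k)) -> S = set0 /\ S' = set0.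
Proof.
move=> dis gS gS'.
have gen0 i : ~ gen (among set0) (T i).
  move=> g0; have [x x0] := indec_nonzero (Tindec i).
  apply: x0; apply/eqP; rewrite -memv0; apply: (g0 (zero_smod (T i))).
  by move=> X h y [j]; rewrite inE.
have [|J [JS gJ] minJ] := @ex_min_measure {set I}
  (fun J => J \subset S /\ forall l, l \in S' -> gen (among J) (T l)) (fun J => #|J|) S.
  by [].
have J0 : J = set0.
  apply/eqP; apply: contraT => /set0Pn[k kJ].
  have kS := subsetP JS _ kJ.
  have gk : gen (among (J :\ k)) (T k).
    have [U [UP Umin Ugen]] := trace_exists (among (J :\ k)) (T k).
    suff Uf : U = fullv :> {vspace T k}.
      by move=> V VP w; apply: (Umin V VP); rewrite Uf memvf.
    apply: nakayama_indec => //.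
      move=> e x xU; have [V VP] := hom_smod_preim e U; apply/VP.
      by apply: Umin xU => X h y CX; apply/VP; rewrite -comphE; apply: UP.
    move=> V UV rV; apply: eq_fullv; apply: (gen_vspace (gS' k kS)).
    move=> X h x [l lS' XE]; subst X; rewrite memv_preim; move: x.
    apply: (gen_vspace (gJ l lS')) => X g x [k' k'J XE]; subst X.
    rewrite -memv_preim -comphE; have [kk'|kk'] := eqVneq k' k; last first.
      by apply: (subvP UV); apply: UP; exists k' => //; rewrite !inE kk'.
    (* An invertible composite T k -> T l -> T k would make T k isomorphic to T l, although the two
       index sets are disjoint. *)
    move: g x; rewrite kk' => g x; apply: rV => hgi.
    have [m [mK _]] := end_bij hgi.
    have kl : k = l.
      apply: Tiso; apply: indec_retract_iso => //; first by case: (Tindec k).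
      by exists g, (comph m h) => y; rewrite homhE -[RHS]mK homhE.
    by move: (disjointFr dis kS); rewrite kl lS'.
  have : (#|J| <= #|J :\ k|)%N.
    apply: minJ; split; first by apply: subset_trans JS; apply: subsetDl.
    move=> l lS'; apply: gen_trans (gJ l lS') => _ [i iJ ->].
    have [->//|ik] := eqVneq i k.
    by apply: gen_self; exists i => //; rewrite !inE ik.
  by rewrite [X in (X <= _)%N](cardsD1 k) kJ ltnn.
have S'0 : S' = set0.
  apply/eqP; apply: contraT => /set0Pn[l lS'].
  by case: (gen0 l); rewrite -J0; apply: gJ.
split=> //; apply/eqP; apply: contraT => /set0Pn[k kS].
by case: (gen0 k); rewrite -S'0; apply: gS'.
Qed.

Hypothesis Trigid : forall i, rigid (T i) (among setT).

(* The positive and negative parts of a relation vanish on the same [N]; applied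
   to quotients of [T i] by traces, this makes the two parts generate each other. *)
Lemma hdim_independent (c : I -> int) :
  (forall N, gen (among setT) N -> \sum_i c i * (hdim (T i) N)%:Z = 0) ->
  forall i, c i = 0.
Proof.
move=> cE.
have sign (d : I -> int) N : \sum_i d i * (hdim (T i) N)%:Z = 0 ->
  (forall i, 0 < d i -> hdim (T i) N = 0%N) -> forall i, d i < 0 -> hdim (T i) N = 0%N.
  move=> sum0 pos i di.
  have : \sum_i - (d i * (hdim (T i) N)%:Z) = 0 by rewrite sumrN sum0 oppr0.
  move/psumr_eq0P => sum1; have := sum1 _ i isT.
  have term j : 0 <= - (d j * (hdim (T j) N)%:Z).
    have [/pos->|dj] := ltP 0 (d j); first by rewrite mulr0 oppr0.
    by rewrite oppr_ge0 mulr_le0_ge0.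
  move=> /(_ (fun j _ => term j))/eqP.
  by rewrite oppr_eq0 mulf_eq0 (lt_eqF di) => /eqP[].
have generates (d : I -> int) : (forall N, gen (among setT) N ->
    \sum_i d i * (hdim (T i) N)%:Z = 0) ->
    forall l, l \in [set i | d i < 0] -> gen (among [set i | 0 < d i]) (T l).
  move=> dE l; rewrite inE => dl.
  (* The quotient of T l by the trace of the positive part lies in Fac T and receives no nonzero map
     from that part. By the relation it receives none from T l either, not even the projection, so
     the trace is all of T l. *)
  have [U [UP Umin Ugen]] := trace_exists (among [set i | 0 < d i]) (T l).
  have Qgen : gen (among setT) (quomod U).
    by apply: (gen_surj (@proj_surj _ _ _ U)); apply: gen_self; exists l; rewrite ?inE.
  have pos i : 0 < d i -> hdim (T i) (quomod U) = 0%N.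
    move=> di; apply: (trace_quo_hom0 UP Ugen (D := among setT)) => //.
      by move=> _ [j _ ->]; apply: gen_self; exists j; rewrite ?inE.
    by exists i; rewrite ?inE.
  have /hdim_eq0P p0 := sign d _ (dE _ Qgen) pos l dl.
  move=> V VP w; apply: (Umin V VP); apply/proj_eq0; exact: p0.
have [|||pos neg] := @mutual_gen_empty [set i | 0 < c i] [set i | c i < 0].
- rewrite -setI_eq0; apply/eqP/setP => i; rewrite !inE.
  by apply/negP => /andP[/lt_trans h /h]; rewrite ltxx.
- exact: generates.
- have gN := generates (fun i => - c i).
  move=> k kS; have -> : [set i | c i < 0] = [set i | 0 < - c i].
    by apply/setP => i; rewrite !inE oppr_gt0.
  apply: gN; last by move: kS; rewrite !inE oppr_lt0.
  move=> N NC; have /(congr1 -%R) := cE N NC; rewrite oppr0 -sumrN => sum0; rewrite -[RHS]sum0.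
  by apply: eq_bigr => i _; rewrite mulNr.
move=> i; have /setP/(_ i) := pos; have /setP/(_ i) := neg; rewrite !inE.
by case: ltgtP.
Qed.

End Independence.

(** * g-vectors and the Bongartz completion *)

Section Presentations.
Variables (K : fieldType) (A : fdalgType K).
Implicit Types M N P Q X Y Z W : rmod A.

Lemma superfluous_ker_sub M N N' (f : hom M N) (f' : hom M N') :
  (forall x, f' x = 0 -> f x = 0) -> superfluous_ker f -> superfluous_ker f'.
Proof.
move=> sub sup X h hE; apply: sup => m; have [x xE] := hE m; exists x.
apply/eqP; rewrite -subr_eq0 -homB; apply/eqP/sub.
by rewrite homB xE subrr.
Qed.

Lemma superfluous_ker_id M : superfluous_ker (idh M).
Proof. by move=> X h hE m; have [x] := hE m; rewrite !idhE; exists x. Qed.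

Definition dsummap X X' Y Y' (f : hom X X') (g : hom Y Y') : hom (dsum X Y) (dsum X' Y') :=
  todsum (comph f (fsth X Y)) (comph g (sndh X Y)).
Lemma dsummapE X X' Y Y' (f : hom X X') (g : hom Y Y') z : dsummap f g z = (f z.1, g z.2).
Proof. by rewrite todsumE !homhE !dsumE. Qed.

Lemma superfluous_ker_dsum X X' Y Y' (f : hom X X') (g : hom Y Y') :
  superfluous_ker f -> superfluous_ker g -> superfluous_ker (dsummap f g).
Proof.
move=> fk gk Z h hE.
(* Among the elements whose second component is killed by g, the first component still takes every
   value. A preimage can thus be corrected in the first component without changing its image under
   g. *)
have fstP m : exists x, (h x).1 = m /\ g (h x).2 = 0.
  pose V := hker (comph g (comph (sndh X Y) h)).
  have VP x : x \in V <-> g (h x).2 = 0 by rewrite mem_hker !homhE dsumE.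
  have [|x xE] := fk _ (comph (comph (fsth X Y) h) (incl V)) _ m.
    move=> m'; have [x] := hE (m', 0); rewrite !dsummapE => -[E1 E2].
    have [|y yE] := @mem_incl _ _ _ V x; first by apply/VP; rewrite E2 hom0.
    by exists y; rewrite !homhE yE dsumE.
  exists (incl V x); rewrite -xE !homhE dsumE; split=> //.
  by apply/VP; apply: incl_mem.
have sndP n : exists x, h x = (0, n).
  pose V := hker (comph (fsth X Y) h).
  have VP x : x \in V <-> (h x).1 = 0 by rewrite mem_hker !homhE dsumE.
  have [|x xE] := gk _ (comph (comph (sndh X Y) h) (incl V)) _ n.
    move=> n'; have [x] := hE (0, n'); rewrite !dsummapE => -[E1 E2].
    have [x2 [E3 E4]] := fstP (h x).1.
    have [|y yE] := @mem_incl _ _ _ V (x - x2).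
      by apply/VP; rewrite homB -fsthE homB !fsthE E3 subrr.
    by exists y; rewrite !homhE yE homB homB !dsumE homB E2 E4 subr0.
  exists (incl V x); rewrite [LHS](surjective_pairing (h (incl V x))); congr pair.
    by apply/VP; apply: incl_mem.
  by rewrite -xE !homhE dsumE.
move=> [m n]; have [x [E1 _]] := fstP m; have [y yE] := sndP (n - (h x).2).
exists (x + y); rewrite homD yE [h x]surjective_pairing E1.
by congr pair; rewrite /= ?addr0 // addrC subrK.
Qed.

Definition pres X P0 P1 := exists (p1 : hom P1 P0) (p0 : hom P0 X),
  [/\ projective P0, projective P1, surj p0, exact2 p1 p0 & superfluous_ker p1].

Lemma pres_exists X : exists P0 P1, pres X P0 P1.
Proof.
have [P1 [P0 [p1 [p0 [[P0p P1p] p0s ex _ k1]]]]] := min_presentation X.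
by exists P0, P1, p1, p0.
Qed.

Lemma pres_iso X X' P0 P1 : iso X X' -> pres X P0 P1 -> pres X' P0 P1.
Proof.
move=> /isoP[f [g [fK gK]]] [p1 [p0 [P0p P1p p0s ex k1]]].
exists p1, (comph f p0); split=> //.
  by move=> x; have [y yE] := p0s (g x); exists y; rewrite homhE yE gK.
move=> x; rewrite homhE -ex; split=> [E|->]; last by rewrite hom0.
by rewrite -(fK (p0 x)) E hom0.
Qed.

Lemma pres_dsum X Y P0 P1 Q0 Q1 : pres X P0 P1 -> pres Y Q0 Q1 ->
  pres (dsum X Y) (dsum P0 Q0) (dsum P1 Q1).
Proof.
move=> [p1 [p0 [P0p P1p p0s exp kp]]] [q1 [q0 [Q0p Q1p q0s exq kq]]].
exists (dsummap p1 q1), (dsummap p0 q0); split.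
- exact: proj_dsum.
- exact: proj_dsum.
- move=> [x y]; have [a <-] := p0s x; have [b <-] := q0s y.
  by exists (a, b); rewrite dsummapE.
- move=> [a b]; rewrite dsummapE /=; split=> [[/exp[x ->] /exq[y ->]]|[[x y]]].
    by exists (x, y); rewrite dsummapE.
  rewrite dsummapE => -[-> ->]; congr pair; first by apply/exp; exists x.
  by apply/exq; exists y.
- exact: superfluous_ker_dsum.
Qed.

Lemma pres_proj P : projective P -> pres P P (zeromod A).
Proof.
move=> Pp; exists (zeroh _ _), (idh P); split=> //; first exact: proj_zeromod.
- by move=> x; exists x; rewrite idhE.
- move=> x; rewrite idhE; split=> [->|[y ->]]; last exact: zerohE.
  by exists 0; rewrite hom0.
- by move=> X h _ y; exists 0; rewrite hom0 (zeromodP y).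
Qed.

Lemma cover_unique P P' Z (f : hom P Z) (g : hom P' Z) : projective P -> projective P' ->
  surj f -> surj g -> superfluous_ker f -> superfluous_ker g -> iso P P'.
Proof.
move=> Pp P'p fs gs fk gk.
have [u uE] := proj_lift f Pp gs; have [v vE] := proj_lift g P'p fs.
have us : surj u by apply: gk => m; have [x xE] := fs (g m); exists x; rewrite uE.
have vs : surj v by apply: fk => m; have [x xE] := gs (f m); exists x; rewrite vE.
apply: (iso_bij (f := u)) => //; apply: surj_inj us _; exact: dim_surj vs.
Qed.

(* Both sides of [pres_unique] are projective covers of the pullback of [p0] and
   [q0]. *)
Lemma pullback_cover X P0 P1 Q0 (p1 : hom P1 P0) (p0 : hom P0 X) (q0 : hom Q0 X)
  (a : hom Q0 P0) (Z : smod (dsum Q0 P0)) :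
  (forall x, p0 (a x) = q0 x) -> exact2 p1 p0 -> superfluous_ker p1 ->
  (forall z, z \in Z <-> q0 z.1 = p0 z.2) ->
  exists f : hom (dsum Q0 P1) (submod Z), surj f /\ superfluous_ker f.
Proof.
move=> aE ex k1 ZP.
have p01 y : p0 (p1 y) = 0 by apply/ex; exists y.
pose g := todsum (fsth Q0 P1) (fromdsum a p1).
have gE x y : g (x, y) = (x, a x + p1 y) by rewrite todsumE fromdsumE dsumE.
have [|f fE] := @corestrict _ _ _ _ Z g.
  by move=> [x y]; apply/ZP; rewrite gE /= homD aE p01 addr0.
exists f; split.
  move=> z; have := incl_mem z; rewrite ZP; case zE: (incl Z z) => [x y] /= E.
  have /ex[w wE] : p0 (y - a x) = 0 by rewrite homB aE E subrr.
  exists (x, w); apply: (inj_eqh (f := incl Z)); first exact: incl_inj.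
  by rewrite fE gE zE -wE addrC subrK.
apply: superfluous_ker_sub (superfluous_ker_dsum (@superfluous_ker_id Q0) k1) => -[x y] fz.
have := fE (x, y); rewrite fz hom0 gE => -[x0].
by rewrite -x0 hom0 add0r => y0; rewrite dsummapE idhE /= -y0.
Qed.

Lemma pres_unique X P0 P1 Q0 Q1 : pres X P0 P1 -> pres X Q0 Q1 ->
  iso (dsum Q0 P1) (dsum P0 Q1).
Proof.
move=> [p1 [p0 [P0p P1p p0s exp kp]]] [q1 [q0 [Q0p Q1p q0s exq kq]]].
have [a aE] := proj_lift q0 Q0p p0s; have [b bE] := proj_lift p0 P0p q0s.
pose Z := hker (subh (comph q0 (fsth Q0 P0)) (comph p0 (sndh Q0 P0))).
have ZP z : z \in Z <-> q0 z.1 = p0 z.2.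
  rewrite mem_hker !homhE !dsumE; split=> [/eqP|->]; last by rewrite subrr.
  by rewrite subr_eq0 => /eqP.
pose Z' := hker (subh (comph p0 (fsth P0 Q0)) (comph q0 (sndh P0 Q0))).
have Z'P z : z \in Z' <-> p0 z.1 = q0 z.2.
  rewrite mem_hker !homhE !dsumE; split=> [/eqP|->]; last by rewrite subrr.
  by rewrite subr_eq0 => /eqP.
have [f [fs fk]] := pullback_cover aE exp kp ZP.
have [g [gs gk]] := pullback_cover bE exq kq Z'P.
pose sw := todsum (sndh P0 Q0) (fsth P0 Q0).
have swE x y : sw (x, y) = (y, x) by rewrite todsumE !dsumE.
have [|s sE] := @corestrict _ _ _ _ Z (comph sw (incl Z')).
  move=> z; apply/ZP; rewrite homhE; have := incl_mem z; rewrite Z'P.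
  by case: (incl Z' z) => x y; rewrite swE.
have si : inj s.
  move=> z sz; apply: (incl_inj (U := Z')); have := sE z; rewrite sz hom0 homhE.
  by case: (incl Z' z) => x y; rewrite swE => -[<- <-].
have ss : surj s.
  move=> z; have := incl_mem z; rewrite ZP; case zE : (incl Z z) => [x y] /= E.
  have [|w wE] := @mem_incl _ _ _ Z' (y, x); first by apply/Z'P.
  exists w; apply: (inj_eqh (f := incl Z)); first exact: incl_inj.
  by rewrite sE homhE wE swE zE.
apply: (cover_unique (f := f) (g := comph s g)) => //; try exact: proj_dsum.
  by move=> z; have [w <-] := ss z; have [v <-] := gs w; exists v; rewrite homhE.
by apply: superfluous_ker_sub gk => z; rewrite homhE => /si.
Qed.

Definition pres_pair X : rmod A * rmod A :=
  let s := constructive_indefinite_description _ (pres_exists X) in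
  (sval s, sval (constructive_indefinite_description _ (svalP s))).

Lemma pres_pairP X : pres X (pres_pair X).1 (pres_pair X).2.
Proof.
rewrite /pres_pair; case: constructive_indefinite_description => P0 ex /=.
by case: constructive_indefinite_description.
Qed.

(* The pairing of the g-vector of [X] with the dimension vector of [N]. *)
Definition gpair X N : int :=
  (hdim (pres_pair X).1 N)%:Z - (hdim (pres_pair X).2 N)%:Z.

Lemma gpairE X P0 P1 N : pres X P0 P1 -> gpair X N = (hdim P0 N)%:Z - (hdim P1 N)%:Z.
Proof.
move=> PX; have := hdim_iso N (pres_unique PX (pres_pairP X)).
rewrite !hdim_dsum /gpair; lia.
Qed.

Lemma gpair_iso X Y N : iso X Y -> gpair X N = gpair Y N.
Proof.
move=> XY; have [P0 [P1 PX]] := pres_exists X.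
by rewrite (gpairE N PX) (gpairE N (pres_iso XY PX)).
Qed.

Lemma gpair_dsum X Y N : gpair (dsum X Y) N = gpair X N + gpair Y N.
Proof.
have [P0 [P1 PX]] := pres_exists X; have [Q0 [Q1 PY]] := pres_exists Y.
rewrite (gpairE N PX) (gpairE N PY) (gpairE N (pres_dsum PX PY)) !hdim_dsum; lia.
Qed.

Lemma gpair_proj P N : projective P -> gpair P N = (hdim P N)%:Z.
Proof. by move=> Pp; rewrite (gpairE N (pres_proj Pp)) hdim_zeromod subr0. Qed.

(** On Fac [C] the map Hom(P0, N) -> Hom(P1, N) is onto, with kernel Hom(X, N). *)
Lemma gpair_rigid X (C : rmod A -> Prop) N : rigid X C -> gen C N ->
  gpair X N = (hdim X N)%:Z.
Proof.
move=> XC CN; have [P0 [P1 PX]] := pres_exists X; rewrite (gpairE N PX).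
have [p1 [p0 [P0p P1p p0s ex k1]]] := PX.
rewrite (hdim_exact p0s ex (rigid_factors_thru P0p p0s ex k1 XC CN)); lia.
Qed.

Definition bdmap n (F G : nat -> rmod A) (h : forall i, hom (F i) (G i)) : hom (bigdsum n F) (bigdsum n G) :=
  frombd n (fun i => comph (bd_in n G i) (h i)).
#[global] Arguments bdmap n [F G] h.

Lemma bd_pr_map n (F G : nat -> rmod A) (h : forall i, hom (F i) (G i)) i z : (i < n)%N ->
  bd_pr n G i (bdmap n h z) = h i (bd_pr n F i z).
Proof.
move=> lt; rewrite /bdmap frombdE hom_sum (bigD1 (Ordinal lt)) //= homhE bd_pr_in //.
rewrite big1 ?addr0 // => j ne; rewrite homhE bd_pr_in_neq // => E.
by move/eqP: ne; apply; apply: val_inj.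
Qed.

Lemma bd_eq0 n (F : nat -> rmod A) (z : bigdsum n F) : (forall i, (i < n)%N -> bd_pr n F i z = 0) -> z = 0.
Proof. by move=> z0; rewrite [LHS]bd_sum big1 // => i _; rewrite z0 // hom0. Qed.

Lemma bdmap_eq0 n (F G : nat -> rmod A) (h : forall i, hom (F i) (G i)) z :
  bdmap n h z = 0 <-> forall i, (i < n)%N -> h i (bd_pr n F i z) = 0.
Proof.
split=> [z0 i lt|h0]; first by rewrite -bd_pr_map // z0 hom0.
by apply: bd_eq0 => i lt; rewrite bd_pr_map // h0.
Qed.

Lemma superfluous_ker_bdmap n (F G : nat -> rmod A) (h : forall i, hom (F i) (G i)) :
  (forall i, (i < n)%N -> superfluous_ker (h i)) -> superfluous_ker (bdmap n h).
Proof.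
elim: n F G h => [|n IH] F G h hk.
  by move=> X g _ y; exists 0; rewrite hom0 (zeromodP y).
have := superfluous_ker_dsum (hk 0%N isT) (IH _ _ (fun i => h i.+1) (fun i => hk i.+1)).
apply: superfluous_ker_sub => z /bdmap_eq0 z0; rewrite dsummapE; congr pair.
  by rewrite -(z0 0%N) // bd_pr0E fsthE.
apply/bdmap_eq0 => i lt; rewrite -[RHS](z0 i.+1) //.
by rewrite bd_prSE sndhE.
Qed.

Lemma factors_thru_bigdsum P1 P0 (p1 : hom P1 P0) n F : (forall i, (i < n)%N -> factors_thru p1 (F i)) ->
  factors_thru p1 (bigdsum n F).
Proof.
elim: n F => [|n IH] F E; first exact: factors_thru_zeromod.
by apply: factors_thru_dsum; [apply: E|apply: IH => i; apply: (E i.+1)].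
Qed.

Lemma bdmap_surj n (F G : nat -> rmod A) (h : forall i, hom (F i) (G i)) :
  (forall i, surj (h i)) -> surj (bdmap n h).
Proof.
move=> hs z; have [x xE] : exists x : forall i, F i, forall i, h i (x i) = bd_pr n G i z.
  pose s i := constructive_indefinite_description _ (hs i (bd_pr n G i z)).
  by exists (fun i => sval (s i)) => i; apply: (svalP (s i)).
exists (\sum_(i < n) bd_in n F i (x i)); rewrite hom_sum [RHS]bd_sum.
by apply: eq_bigr => i _; rewrite frombd_in // homhE xE.
Qed.

(** * The Bongartz module attached to a projective Q *)

Section Bongartz.
Variables (M P1 P0 Q : rmod A) (p1 : hom P1 P0) (p0 : hom P0 M).
Hypotheses (P0p : projective P0) (P1p : projective P1) (Qp : projective Q).
Hypotheses (p0s : surj p0) (ex : exact2 p1 p0) (k1 : superfluous_ker p1).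

Let r := \dim (homv P1 Q).

(** Maps out of [bigdsum] are given by families over all natural numbers, so an index past the basis
    must yield a homomorphism too; the default of [nth] makes it 0. *)
Fact bongartz_homP i : (vbasis (homv P1 Q))`_i \in homv P1 Q.
Proof.
have [lt|ge] := ltnP i r; first by apply/vbasis_mem/mem_nth; rewrite size_tuple.
by rewrite nth_default ?size_tuple // mem0v.
Qed.

Let f i : hom P1 Q := homh (bongartz_homP i).
Let R1 := bigdsum r (fun _ => P1).
Let R0 := bigdsum r (fun _ => P0).
Let d0 : hom R1 R0 := bdmap r (fun _ => p1).
Let dQ : hom R1 Q := frombd r f.

Definition bongartz_map : hom R1 (dsum R0 Q) := todsum d0 dQ.
Definition bongartz_mod : rmod A := quomod (himg bongartz_map (full_smod R1)).

Let pi : hom (dsum R0 Q) bongartz_mod := proj (himg bongartz_map (full_smod R1)).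

Let piP z : pi z = 0 <-> exists y, z = bongartz_map y.
Proof. by rewrite proj_eq0 mem_himgf. Qed.

Lemma pres_bongartz : pres bongartz_mod (dsum R0 Q) R1.
Proof.
exists bongartz_map, pi; split.
- by apply: proj_dsum => //; apply: proj_bigdsum.
- exact: proj_bigdsum.
- exact: proj_surj.
- exact: piP.
- apply: (superfluous_ker_sub (f := d0)) (superfluous_ker_bdmap (fun _ _ => k1)) => x.
  by rewrite todsumE => -[].
Qed.

(** Read backwards, this writes hom(Q, -) as an integral combination of g-vectors of the summands of
    the completion. *)
Lemma gpair_bongartz N : gpair bongartz_mod N = (hdim Q N)%:Z + r%:Z * gpair M N.
Proof.
rewrite (gpairE N pres_bongartz) hdim_dsum !hdim_bigdsum !sum_nat_const !card_ord.
rewrite (gpairE (P0 := P0) (P1 := P1)); last by exists p1, p0.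
by rewrite PoszD !PoszM; lia.
Qed.

(** A map R1 -> N extends along d0, one copy of P1 at a time, hence along [bongartz_map] with value
    0 on Q. *)
Lemma rigid_bongartz (C : rmod A -> Prop) :
  (forall N, C N -> factors_thru p1 N) -> rigid bongartz_mod C.
Proof.
move=> CE; have [d [p [R0p R1p ps exd _]]] := pres_bongartz.
apply: (factors_thru_rigid (p1 := bongartz_map) (p0 := pi) R0p R1p (@proj_surj _ _ _ _) piP).
move=> N /CE E g.
pose s i := constructive_indefinite_description _ (E (comph g (bd_in r (fun _ => P1) i))).
exists (fromdsum (frombd r (fun i => sval (s i))) (zeroh Q N)) => y.
rewrite fromdsumE zerohE addr0 todsumE frombdE /= {1}(bd_sum y) hom_sum.
apply: eq_bigr => i _; rewrite bd_pr_map //.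
by rewrite -(svalP (s i)) homhE.
Qed.

(** For a minimal presentation the conclusion reads Hom(B, tau M) = 0, B being the Bongartz module.
    A map P1 -> B is lifted to R0 + Q, and the lift is changed by elements of the image of
    [bongartz_map] until it factors through p1. *)
Lemma factors_thru_bongartz : factors_thru p1 M -> factors_thru p1 bongartz_mod.
Proof.
move=> EM g; have [G GE] := proj_lift g P1p (@proj_surj _ _ _ _ : surj pi).
pose e0 : hom R0 (bigdsum r (fun _ => M)) := bdmap r (fun _ => p0).
have e0s : surj e0 by apply: bdmap_surj.
(* Pushed to M^r, the R0 component of the lift factors through p1 by hypothesis. After lifting that
   factor to b : P0 -> R0, the difference lies in the kernel of R0 -> M^r, the image of d0, and so
   equals d0 a. *)
have [w wE] := factors_thru_bigdsum (n := r) (F := fun _ => M) (fun _ _ => EM)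
  (comph e0 (comph (fsth R0 Q) G)).
have [b bE] := proj_lift w P0p e0s.
have [|c cE] := @corestrict _ _ _ _ (hker e0) d0.
  move=> z; apply/mem_hker/bdmap_eq0 => i lt; rewrite bd_pr_map //.
  by apply/ex; eexists.
have cs : surj c.
  move=> z; have /mem_hker/bdmap_eq0 zk := incl_mem z.
  have [y yE] : exists y : nat -> P1, forall i, (i < r)%N ->
      bd_pr r (fun _ => P0) i (incl _ z) = p1 (y i).
    have yex i : exists y, (i < r)%N -> bd_pr r (fun _ => P0) i (incl _ z) = p1 y.
      by have [/zk/ex[y yE]|] := boolP (i < r)%N; [exists y|exists 0].
    pose s i := constructive_indefinite_description _ (yex i).
    by exists (fun i => sval (s i)) => i; apply: (svalP (s i)).
  exists (\sum_(i < r) bd_in r (fun _ => P1) i (y i)).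
  apply: (inj_eqh (f := incl _)); first exact: incl_inj.
  rewrite cE hom_sum [RHS]bd_sum; apply: eq_bigr => i _.
  by rewrite frombd_in // homhE yE.
have [|k kE] := @corestrict _ _ _ _ (hker e0) (subh (comph (fsth R0 Q) G) (comph b p1)).
  by move=> y; apply/mem_hker; rewrite subhE homB comphE comphE bE -wE !homhE subrr.
have [a aE] := proj_lift k P1p cs.
have d0a y : d0 (a y) = (G y).1 - b (p1 y).
  by rewrite -cE aE kE !homhE dsumE.
(* Modulo the image of [bongartz_map], g is now represented by (b p1, v) with v : P1 -> Q. As the
   f_i span Hom(P1, Q), some (m0 p1, v) lies in that image, so g is also represented by ((b - m0)
   p1, 0). *)
pose v := subh (comph (sndh R0 Q) G) (comph dQ a).
have [cf vE] : exists cf : 'I_r -> K, forall y, v y = \sum_(i < r) cf i *: f i y.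
  exists (fun i => coord (vbasis (homv P1 Q)) i (v : 'Hom(P1, Q))) => y.
  rewrite -[LHS]/((v : 'Hom(P1, Q)) y) {1}(coord_vbasis (hom_homv v)) sum_lfunE.
  by apply: eq_bigr => i _; rewrite scale_lfunE.
pose m1 := sumh (fun i : 'I_r => scaleh (cf i) (bd_in r (fun _ => P1) i)).
pose m0 := sumh (fun i : 'I_r => scaleh (cf i) (bd_in r (fun _ => P0) i)).
have m1E y : m1 y = \sum_(i < r) cf i *: bd_in r (fun _ => P1) i y.
  by rewrite [LHS]sumhE; apply: eq_bigr => i _; rewrite scalehE.
have m0E y : m0 y = \sum_(i < r) cf i *: bd_in r (fun _ => P0) i y.
  by rewrite [LHS]sumhE; apply: eq_bigr => i _; rewrite scalehE.
have dm y : bongartz_map (m1 y) = (m0 (p1 y), v y).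
  rewrite [LHS]todsumE; congr pair.
    rewrite m1E m0E hom_sum; apply: eq_bigr => i _.
    by rewrite homZ /d0 /bdmap frombd_in // homhE.
  rewrite vE m1E hom_sum; apply: eq_bigr => i _.
  by rewrite homZ /dQ frombd_in.
exists (comph pi (comph (inlh R0 Q) (subh b m0))) => y.
apply/eqP; rewrite -subr_eq0 -GE !comphE subhE -homB; apply/eqP/piP.
exists (a y + m1 y); rewrite [RHS]homD dm.
have -> : bongartz_map (a y) = (d0 (a y), dQ (a y)) by apply: todsumE.
have -> : v y = (G y).2 - dQ (a y) by rewrite subhE !comphE sndhE.
rewrite d0a inlhE; case: (G y) => u q; congr pair; rewrite /=; last by rewrite subr0 addrC subrK.
by rewrite opprB addrA [RHS]addrAC.
Qed.

End Bongartz.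

End Presentations.

(** * The completion and the number of its summands *)

Section Completion.
Variables (K : fieldType) (A : fdalgType K).
Implicit Types M N P Q X Y Z W : rmod A.

Lemma bigdsum_iso n (F G : nat -> rmod A) : (forall i, (i < n)%N -> iso (F i) (G i)) ->
  iso (bigdsum n F) (bigdsum n G).
Proof.
elim: n F G => [|n IH] F G FG; first exact: iso_refl.
by apply: dsum_iso; [apply: FG|apply: IH => i; apply: (FG i.+1)].
Qed.

Lemma iso_representatives n (F : nat -> rmod A) : exists t (rho : nat -> nat),
  [/\ forall k, (k < t)%N -> (rho k < n)%N,
      forall i j, (i < t)%N -> (j < t)%N -> iso (F (rho i)) (F (rho j)) -> i = j &
      forall i, (i < n)%N -> exists2 k, (k < t)%N & iso (F i) (F (rho k))].
Proof.
elim: n => [|n [t [rho [rhol rhoi rhoc]]]]; first by exists 0%N, id.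
have [[k kt kE]|nk] := classic (exists2 k, (k < t)%N & iso (F n) (F (rho k))).
  exists t, rho; split=> // [j /rhol/ltnW //|i].
  by rewrite ltnS leq_eqVlt => /predU1P[->|/rhoc //]; exists k.
pose rho' k := if k == t then n else rho k.
have rhoE k : (k < t)%N -> rho' k = rho k by move=> lt; rewrite /rho' ltn_eqF.
have rhot : rho' t = n by rewrite /rho' eqxx.
exists t.+1, rho'; split.
- by move=> k; rewrite ltnS leq_eqVlt => /predU1P[->|lt]; rewrite ?rhot ?rhoE // ltnW // ltnS rhol.
- move=> i j; rewrite (ltnS i) (ltnS j) (leq_eqVlt i) (leq_eqVlt j) => /predU1P[->|il] /predU1P[->|jl] //.
  + by rewrite rhot rhoE // => E; case: nk; exists j.
  + by rewrite rhot rhoE // => /iso_sym E; case: nk; exists i.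
  + by rewrite !rhoE //; apply: rhoi.
- move=> i; rewrite ltnS leq_eqVlt => /predU1P[->|/rhoc[k kt kE]].
    by exists t => //; rewrite rhot; apply: iso_refl.
  by exists k; rewrite ?rhoE // ltnW.
Qed.

Definition summand_list M t (T : 'I_t -> rmod A) :=
  [/\ forall k, indecomposable (T k) /\ retract (T k) M,
      forall i j, iso (T i) (T j) -> i = j &
      forall Y, indecomposable Y -> retract Y M -> exists k, iso Y (T k)].

Lemma summand_listP M t T : @summand_list M t T -> num_summands M t.
Proof.
move=> [T1 T2 T3]; exists T; split=> // [i|Y Yi /retractP].
  by have [Ti /retractP Ts] := T1 i.
exact: T3.
Qed.

Lemma summand_list_exists M : exists t T, @summand_list M t T.
Proof.
have [n [F [Fi MF]]] := indec_decomposition M.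
have [t [rho [rhol rhoi rhoc]]] := iso_representatives n F.
exists t, (fun k => F (rho k)); split.
- move=> k; split; first exact/Fi/rhol.
  apply: (retract_trans _ (iso_retract (iso_sym MF))); exact/retract_bd/rhol.
- by move=> i j /rhoi E; apply: val_inj; apply: E.
- move=> Y Yi YM; have [i lt YF] := indec_retract_bd Yi (retract_trans YM (iso_retract MF)).
  have [k kt kE] := rhoc i lt; exists (Ordinal kt) => /=.
  apply: iso_trans kE; apply: indec_retract_iso => //; first exact: Fi.
  by case: Yi.
Qed.

Lemma gpair_span t (T : 'I_t -> rmod A) M :
  (forall Y, indecomposable Y -> retract Y M -> exists k, iso Y (T k)) ->
  exists c : 'I_t -> int, forall N, gpair M N = \sum_k c k * gpair (T k) N.
Proof.
have [n [F [Fi MF]]] := indec_decomposition M.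
have gM N : gpair M N = gpair (bigdsum n F) N by apply: gpair_iso.
move=> Tc; have {Tc} : forall i, (i < n)%N -> exists k, iso (F i) (T k).
  move=> i lt; apply: Tc; first exact: Fi.
  by apply: (retract_trans (retract_bd F lt)); apply/iso_retract/iso_sym.
suff: (forall i, (i < n)%N -> exists k, iso (F i) (T k)) ->
    exists c : 'I_t -> int, forall N, gpair (bigdsum n F) N = \sum_k c k * gpair (T k) N.
  by move=> H /H[c cE]; exists c => N; rewrite gM.
elim: n F {Fi MF gM} => [|n IH] F FT.
  exists (fun _ => 0) => N; rewrite gpair_proj; last exact: proj_zeromod.
  by rewrite hdim_zeromod big1 // => i _; rewrite mul0r.
have [k kE] := FT 0%N isT; have [|c cE] := IH (fun i => F i.+1).
  by move=> i; apply: (FT i.+1).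
exists (fun j => (j == k)%:R + c j) => N.
rewrite [LHS]gpair_dsum cE (gpair_iso N kE).
under [RHS]eq_bigr do rewrite mulrDl; rewrite big_split; congr (_ + _).
by rewrite (bigD1 k) //= eqxx mul1r big1 ?addr0 // => j /negPf->; rewrite mul0r.
Qed.

Lemma proj_summand m (Q : 'I_m -> rmod A) P : summand_list (regmod A) Q ->
  projective P -> exists c : 'I_m -> int,
  forall N, (hdim P N)%:Z = \sum_j c j * (hdim (Q j) N)%:Z.
Proof.
move=> [Q1 Q2 Q3] Pp.
have Qp j : projective (Q j) by apply: proj_retract (Q1 j).2 (@proj_regmod _ A).
have [|c cE] := @gpair_span m Q P.
  move=> Y Yi YP; have [n [f fs]] := free_cover P.
  have [s sE] := proj_lift (idh P) Pp fs.
  have Pfree : retract P (bigdsum n (fun _ => regmod A)).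
    by exists s, f => x; rewrite sE idhE.
  have [i _ YA] := indec_retract_bd Yi (retract_trans YP Pfree).
  exact: Q3.
exists c => N; rewrite -gpair_proj // cE; apply: eq_bigr => j _.
by rewrite gpair_proj.
Qed.

Lemma sum_id_mx n (k : 'I_n) (F : 'I_n -> int) :
  \sum_l (1%:M : 'M[int]_n) k l * F l = F k.
Proof.
rewrite (bigD1 k) //= mxE eqxx mul1r big1 ?addr0 // => i ne.
by rewrite mxE eq_sym (negPf ne) mul0r.
Qed.

(* The matrices [G] and [H] below express the two families of functionals in terms
   of each other; they are inverse, so comparing traces gives [t = m]. *)
Theorem tau_tilting_completion M : rigid M (eq M) ->
  exists t (T : 'I_t -> rmod A),
  [/\ forall k, indecomposable (T k) /\ rigid (T k) (among T setT),
      forall i j, iso (T i) (T j) -> i = j,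
      num_summands (regmod A) t,
      forall Y, indecomposable Y -> retract Y M -> exists k, iso Y (T k) &
      forall Y, indecomposable Y -> retract Y (regmod A) ->
        exists k (f : hom Y (T k)) x, f x <> 0].
Proof.
move=> Mr.
have [P1 [P0 [p1 [p0 [[P0p P1p] p0s ex _ k1]]]]] := min_presentation M.
have EM : factors_thru p1 M by apply: (rigid_factors_thru P0p p0s ex k1 Mr); apply: gen_self.
have [m [Q Ql]] := summand_list_exists (regmod A); have [Q1 Q2 Q3] := Ql.
have Qp j : projective (Q j) by apply: proj_retract (Q1 j).2 (@proj_regmod _ A).
pose B (j : nat) : rmod A :=
  if insub j is Some j' then bongartz_mod (Q j') p1 else zeromod A.
have BE (j : 'I_m) : B j = bongartz_mod (Q j) p1 by rewrite /B valK.
pose T0 := dsum M (bigdsum m B).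
have [t [T Tl]] := summand_list_exists T0; have [T1 T2 T3] := Tl.
(* In terms of tau, Hom(T0, tau M) = 0. This makes M and all Bongartz modules, hence T0 itself,
   Ext-orthogonal to Fac T. *)
have ET0 : factors_thru p1 T0.
  apply: factors_thru_dsum => //; apply: factors_thru_bigdsum => j lt.
  rewrite (BE (Ordinal lt)); exact: factors_thru_bongartz.
pose C := among T setT.
have EC N : C N -> factors_thru p1 N.
  move=> [k _ ->]; have [i [p pi]] := (T1 k).2.
  by apply: (factors_thru_surj P1p _ ET0 (f := p)) => x; exists (i x).
have rM : rigid M C by apply: (factors_thru_rigid P0p P1p p0s ex).
have rT0 : rigid T0 C.
  apply: rigid_dsum => //; apply: rigid_bigdsum => j lt.
  by rewrite (BE (Ordinal lt)); apply: rigid_bongartz.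
have rT k : rigid (T k) C by apply: rigid_retract (T1 k).2 rT0.
have span X : retract X T0 ->
    exists c : 'I_t -> int, forall N, gpair X N = \sum_k c k * gpair (T k) N.
  move=> XT; apply: gpair_span => Y Yi YX; apply: T3 => //; exact: retract_trans XT.
have [a aE] := span M (retract_dsuml _ _).
pose bs j := constructive_indefinite_description _
  (span (B (j : 'I_m)) (retract_trans (retract_bd B (ltn_ord j)) (retract_dsumr _ _))).
have projspan k : exists c : 'I_m -> int,
    forall N, gpair (T k) N = \sum_j c j * (hdim (Q j) N)%:Z.
  have [R0 [R1 PT]] := pres_exists (T k); have [_ [_ [R0p R1p _ _ _]]] := PT.
  have [c0 c0E] := proj_summand Ql R0p; have [c1 c1E] := proj_summand Ql R1p.
  exists (fun j => c0 j - c1 j) => N; rewrite (gpairE N PT) c0E c1E -sumrB.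
  by apply: eq_bigr => j _; rewrite mulrBl.
pose cs k := constructive_indefinite_description _ (projspan k).
pose G : 'M[int]_(t, m) := \matrix_(k, j) sval (cs k) j.
pose H : 'M[int]_(m, t) := \matrix_(j, k)
  (sval (bs j) k - (\dim (homv P1 (Q j)))%:Z * a k).
have GE k N : gpair (T k) N = \sum_j G k j * (hdim (Q j) N)%:Z.
  by rewrite (svalP (cs k)); apply: eq_bigr => j _; rewrite mxE.
have HE j N : (hdim (Q j) N)%:Z = \sum_k H j k * gpair (T k) N.
  have := gpair_bongartz P0p P1p (Qp j) p0s ex k1 N; rewrite -BE (svalP (bs j)) aE => E.
  under eq_bigr do rewrite mxE mulrBl -mulrA.
  by rewrite sumrB -mulr_sumr E addrK.
have Tgen N : gen C N -> forall k, gpair (T k) N = (hdim (T k) N)%:Z.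
  by move=> CN k; apply: gpair_rigid (rT k) CN.
(* On Fac T each g_{T_k} equals hom(T_k, -), so row k of G H - 1 is a relation between the hom(T_l,
   -) there and vanishes. *)
have GH1 : G *m H = 1%:M.
  apply/matrixP => k l; apply/eqP; rewrite -subr_eq0; apply/eqP.
  apply: (@hdim_independent _ A _ T (fun k => (T1 k).1) T2 rT
    (fun l => (G *m H) k l - 1%:M k l)) => N CN.
  under eq_bigr do rewrite mulrBl; rewrite sumrB.
  apply/eqP; rewrite subr_eq0; apply/eqP.
  rewrite [RHS]sum_id_mx.
  rewrite -Tgen // GE.
  under [LHS]eq_bigr => i _ do rewrite mxE mulr_suml.
  rewrite exchange_big; apply: eq_bigr => j _; rewrite HE mulr_sumr.
  by apply: eq_bigr => i _; rewrite mulrA Tgen.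
(* Projectives are rigid against every class, so the independence result also applies to the family
   Q. *)
have rQ i : rigid (Q i) (among Q setT) by apply: rigid_proj.
have HG1 : H *m G = 1%:M.
  apply/matrixP => k l; apply/eqP; rewrite -subr_eq0; apply/eqP.
  apply: (@hdim_independent _ A _ Q (fun k => (Q1 k).1) Q2
    rQ (fun l => (H *m G) k l - 1%:M k l)) => N CN.
  under eq_bigr do rewrite mulrBl; rewrite sumrB.
  apply/eqP; rewrite subr_eq0; apply/eqP.
  rewrite [RHS]sum_id_mx.
  rewrite HE.
  under [LHS]eq_bigr => i _ do rewrite mxE mulr_suml.
  rewrite exchange_big; apply: eq_bigr => j _; rewrite GE mulr_sumr.
  by apply: eq_bigr => i _; rewrite mulrA.
have tm : t = m.
  by have := mxtrace_mulC G H; rewrite GH1 HG1 !mxtrace1 !natz => -[].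
exists t, T; split=> //.
- by move=> k; split; [apply: (T1 k).1|apply: rT].
- by rewrite tm; apply: summand_listP Ql.
- move=> Y Yi YM; apply: T3 => //; apply: (retract_trans YM); exact: retract_dsuml.
move=> Y Yi YA; have [j Yj] := Q3 Y Yi YA.
apply: NNPP => nex.
have Yp : projective Y by apply: proj_retract YA (@proj_regmod _ A).
(* If Y has no nonzero map to any T k, then hom(Y, -) vanishes on Fac T, since maps from the
   projective Y lift along covers. Its expansion in the hom(T_k, -) is then a zero row of H, against
   H G = 1 at the entry (j, j). *)
have Hj0 k : H j k = 0.
  apply: (@hdim_independent _ A _ T (fun k => (T1 k).1) T2 rT) => N CN.
  under eq_bigr => i _ do rewrite -Tgen //.
  rewrite -HE -(hdim_iso N Yj); congr Posz.
  have [|||Z [h [Zh hs]]] := @gen_cover _ A C (fun Z => hdim Y Z = 0%N) N _ _ _ CN.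
  - by apply/hdim_eq0P => f x; apply: zeromodP.
  - move=> X X' /hdim_eq0P X0 /hdim_eq0P X'0; apply/hdim_eq0P => f x.
    rewrite [LHS]dsum_split -sndhE -fsthE -(comphE (fsth X X') f) -(comphE (sndh X X') f).
    by rewrite X0 X'0 !hom0 addr0.
  - move=> _ [i _ ->]; apply/hdim_eq0P => f x; apply: NNPP => fx; apply: nex.
    by exists i, f, x.
  apply/hdim_eq0P => f x; have [g <-] := proj_lift f Yp hs.
  by move/hdim_eq0P: Zh => ->; rewrite hom0.
have := congr1 (fun M : 'M[int]_m => M j j) HG1; rewrite !mxE eqxx.
by rewrite big1 // => k _; rewrite Hj0 mul0r.
Qed.

End Completion.

(** * Composition factors and the radical *)

Section CompositionFactors.
Variables (K : fieldType) (A : fdalgType K).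
Implicit Types M N P Q X Y Z S : rmod A.

Lemma simple_nonzero S : simple S -> exists s : S, s <> 0.
Proof.
move=> [S0 _]; apply: NNPP => nex; apply/S0/zero_rmodP => x.
by apply: NNPP => x0; apply: nex; exists x.
Qed.

Lemma simple_hom_surj M S (f : hom M S) x : simple S -> f x <> 0 -> surj f.
Proof.
move=> [_ Ss] fx y; have [E|E] := Ss (himg f (full_smod M)).
  case: fx; apply/eqP; rewrite -memv0 -E; apply/mem_himgf; by exists x.
have /mem_himgf[z ->] : y \in himg f (full_smod M) by rewrite E memvf.
by exists z.
Qed.

Lemma simple_hom_inj M S (f : hom S M) x : simple S -> f x <> 0 -> inj f.
Proof.
move=> [_ Ss] fx y fy; have [E|E] := Ss (hker f).
  by apply/eqP; rewrite -memv0 -E; apply/mem_hker.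
by case: fx; apply/mem_hker; rewrite E memvf.
Qed.

Lemma simple_hom_iso S S' (f : hom S S') x : simple S -> simple S' -> f x <> 0 -> iso S S'.
Proof.
move=> Ss S's fx; apply: (iso_bij (f := f)); first exact: simple_hom_inj fx.
exact: simple_hom_surj fx.
Qed.

Lemma simple_iso S S' : iso S S' -> simple S -> simple S'.
Proof.
move=> /isoP[f [g [fK gK]]] [S0 Ss]; split=> [/zero_rmodP S'0|U].
  by apply/S0/zero_rmodP => x; rewrite -(fK x) (S'0 (f x)) hom0.
have [V VP] := hom_smod_preim f U; have [V0|Vf] := Ss V; [left|right].
  apply: eq_0v => x xU; have : g x \in V by apply/VP; rewrite gK.
  by rewrite V0 memv0 => /eqP gx; rewrite -(gK x) gx hom0.
by apply: eq_fullv => x; rewrite -(gK x); apply/VP; rewrite Vf memvf.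
Qed.

Lemma simple_indec S : simple S -> indecomposable S.
Proof.
move=> Ss; apply: indecI; first by case: Ss.
move=> f ff; have [f0|nf0] := classic (forall x, f x = 0); first by left.
right=> x; have [y fy] : exists y, f y <> 0.
  by apply: NNPP => nex; apply: nf0 => y; apply: NNPP => fy; apply: nex; exists y.
apply/eqP; rewrite -subr_eq0; apply/eqP; apply: (simple_hom_inj Ss fy).
by rewrite homB ff subrr.
Qed.

Section SubQuotient.
Variables (M : rmod A) (V U : smod M).

Fact subquo_map_sig : {q : hom (submod V) (subquo V U) |
  surj q /\ forall x, q x = 0 <-> incl V x \in U}.
Proof.
exists (proj (SMod (@preim_smodP K A M V U))); split; first exact: proj_surj.
by move=> x; rewrite proj_eq0 -memv_preim lfunE /= inclE.
Qed.

Lemma subquo_iso S (X : smod M) (h : hom (submod X) S) : surj h ->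
  (forall x, x \in V <-> x \in X) -> (forall x, h x = 0 <-> incl X x \in U) ->
  iso (subquo V U) S.
Proof.
move=> hs VX hk; have [q [qs qk]] := subquo_map_sig.
have [|c cE] := @corestrict _ _ _ _ X (incl V); first by move=> x; apply/VX/incl_mem.
have [|k kE] := @factor_surj _ _ _ _ _ q (comph h c) qs.
  by move=> x /qk xU; rewrite homhE; apply/hk; rewrite cE.
apply: (iso_bij (f := k)) => [z|s].
  have [x <-] := qs z; rewrite kE homhE => /hk; rewrite cE => xU.
  exact/qk.
have [x <-] := hs s; have /VX/mem_incl[y yE] := incl_mem x.
exists (q y); rewrite kE homhE; congr (h _).
by apply: (inj_eqh (f := incl X)); [exact: incl_inj|rewrite cE].
Qed.

(** Simplicity of V/U expressed by the submodules of [M] in between. It depends only on the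
    underlying subspaces, so chains can be glued at submodules that agree elementwise but are
    different records. *)
Definition simple_step := [/\ (U <= V)%VS, ~ (V <= U)%VS &
  forall W : smod M, (U <= W)%VS -> (W <= V)%VS -> (W <= U)%VS \/ (V <= W)%VS].

Lemma simple_step_subquo : simple_step -> simple (subquo V U).
Proof.
move=> [UV nVU max]; have [q [qs qk]] := subquo_map_sig; split.
  move=> /zero_rmodP z0; apply: nVU; apply/subvP => x /mem_incl[y <-].
  by apply/qk; apply: z0.
move=> W'; have [||x a [y [yE yW]]|W WP] := @smod_compr _ _ M
  (fun x => exists y, incl V y = x /\ q y \in W').
- by exists 0; rewrite !hom0 mem0v.
- move=> k x1 x2 [y1 [<- y1W]] [y2 [<- y2W]]; exists (k *: y1 + y2).
  by rewrite !homD !homZ memvD ?memvZ.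
- by exists (ract y a); rewrite !homP yE smodP.
have [||WU|VW] := max W.
- apply/subvP => x xU; apply/WP.
  have /mem_incl[y yE] := subvP UV _ xU; exists y; split=> //.
  by have -> : q y = 0 by [apply/qk; rewrite yE]; apply: mem0v.
- by apply/subvP => x /WP[y [<- _]]; apply: incl_mem.
- left; apply: eq_0v => z zW; have [y yE] := qs z; rewrite -yE; apply/qk.
  by apply: (subvP WU); apply/WP; exists y; rewrite yE.
right; apply: eq_fullv => z; have [y <-] := qs z.
have /WP[y' [/(inj_eqh (@incl_inj _ _ _ _)) -> //]] : incl V y \in W.
by apply: (subvP VW); apply: incl_mem.
Qed.

End SubQuotient.

Definition chain M (U V : smod M) m (c : nat -> smod M) :=
  [/\ forall x, x \in c 0%N <-> x \in U, forall x, x \in c m <-> x \in V &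
      forall i, (i < m)%N -> simple_step (c i.+1) (c i)].

Lemma simple_step_eq M (V U V' U' : smod M) : (forall x, x \in V <-> x \in V') ->
  (forall x, x \in U <-> x \in U') -> simple_step V U -> simple_step V' U'.
Proof.
move=> VV UU.
have E : forall (X Y : smod M), (forall x, x \in X <-> x \in Y) -> X = Y :> {vspace M}.
  by move=> X Y XY; apply/vspaceP => x; apply/idP/idP => /XY.
by rewrite /simple_step (E _ _ VV) (E _ _ UU).
Qed.

Lemma chain_exists M (U V : smod M) : (U <= V)%VS -> exists m c, chain U V m c.
Proof.
have [d] := ubnP (\dim V - \dim U); elim: d U => // d IH U ltd UV.
have [VU|nVU] := boolP (V <= U)%VS.
  exists 0%N, (fun _ => U); split=> // x.
  by split=> xU; [apply: (subvP UV)|apply: (subvP VU)].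
have [|W [UW WV nWU] minW] := @ex_min_measure (smod M)
  (fun W => [/\ (U <= W)%VS, (W <= V)%VS & ~ (W <= U)%VS]) (fun W => \dim W) V.
  by split=> //; apply/negP.
have lt : (\dim U < \dim W)%N.
  by rewrite ltnNge (geq_leqif (dimv_leqif_sup UW)); apply/negP.
have [||m [c [c0 cm cs]]] := IH W => //; first by have := dimvS WV; lia.
exists m.+1, (fun i => if i is i'.+1 then c i' else U); split=> // -[_|i]; last exact: cs.
apply: (@simple_step_eq _ W U) => // [x|]; first by rewrite c0.
split=> // X UX XW; have [XU|nXU] := boolP (X <= U)%VS; [by left|right].
rewrite -(geq_leqif (dimv_leqif_sup XW)); apply: minW; split=> //; last exact/negP.
exact: subv_trans XW WV.
Qed.

(** The pair ker h < X is a simple step with quotient S; chains from 0 to ker h and from X to M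
    complete it to a composition series. *)
Lemma composition_factorI M S (X : smod M) (h : hom (submod X) S) :
  simple S -> surj h -> composition_factor S M.
Proof.
move=> Ss hs; pose X' := himg (incl X) (hker h).
have X'P x : incl X x \in X' <-> h x = 0.
  rewrite mem_himg; split=> [[y yk xy]|hx]; last by exists x => //; apply/mem_hker.
  by rewrite (inj_eqh (@incl_inj _ _ _ X) xy); apply/mem_hker.
have X'X : (X' <= X)%VS.
  by apply/subvP => _ /mem_himg[y _ ->]; apply: incl_mem.
have st : simple_step X X'.
  split=> //.
    move=> XX'; have [s s0] := simple_nonzero Ss; have [x xE] := hs s; apply: s0.
    by rewrite -xE; apply/X'P; apply: (subvP XX'); apply: incl_mem.
  move=> W X'W WX; have [V VP] := hom_smod_preim (incl X) W.
  have [_ /(_ (himg h V))[E|E]] := Ss; [left|right]; apply/subvP => x.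
    move=> xW; have /mem_incl[y yE] := subvP WX _ xW.
    rewrite -yE; apply/X'P/eqP; rewrite -memv0 -E; apply/mem_himg.
    by exists y => //; apply/VP; rewrite yE.
  move=> /mem_incl[y <-]; have /mem_himg[v vV hv] : h y \in himg h V by rewrite E memvf.
  rewrite -(subrK v y) homD memvD //; last exact/VP.
  by apply: (subvP X'W); apply/X'P; rewrite homB hv subrr.
have [m1 [c1 [c10 c1m c1s]]] := chain_exists (introT subvP (fun x xz =>
  subvP (sub0v X') x xz) : (zero_smod M <= X')%VS).
have [m2 [c2 [c20 c2m c2s]]] := chain_exists (subvf X : (X <= full_smod M)%VS).
(* The lower chain ends at index m1 and the upper one begins at index m1 + 1, so the step from X' to
   X has index m1 and the total length is m1 + 1 + m2. *)
pose c i := if (i <= m1)%N then c1 i else c2 (i - m1.+1)%N.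
have cl i : (i <= m1)%N -> c i = c1 i by rewrite /c => ->.
have cr i : c (m1.+1 + i)%N = c2 i by rewrite /c leqNgt ltnS leq_addr /= addKn.
have cr0 : c m1.+1 = c2 0%N by rewrite -(cr 0%N) addn0.
exists (m1.+1 + m2)%N, c; split; last first.
  exists m1; first by rewrite ltn_addr.
  apply: iso_sym; rewrite cr0 cl //; apply: (subquo_iso hs) => // x.
  by rewrite c1m X'P.
split.
- rewrite cl //; apply: eq_0v => x; rewrite c10 memv0 => /eqP //.
- by rewrite cr; apply: eq_fullv => x; apply/c2m; apply: memvf.
move=> i lt; have stp : simple_step (c i.+1) (c i).
  have [il|il|->] := ltngtP i m1.
  - by rewrite !cl //; [apply: c1s|apply: ltnW].
  - have [j jE] : exists j, i = (m1.+1 + j)%N by exists (i - m1.+1)%N; lia.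
    rewrite jE -addnS !cr; apply: c2s; lia.
  - by rewrite cr0 cl //; apply: simple_step_eq st => x; rewrite ?c20 ?c1m.
by split; [case: stp|apply: simple_step_subquo].
Qed.

Lemma composition_factor_simple S M : composition_factor S M -> simple S.
Proof.
by move=> [m [U [[_ _ Us] [i lt SE]]]]; apply: simple_iso (iso_sym SE) (Us i lt).2.
Qed.

(** The map g factors through the image of f, which exhibits S as a subquotient of M. Otherwise g
    maps ker f onto S, and lifting g gives an endomorphism e of Y with image in ker f and g e = g.
    By Fitting e is bijective, forcing f = 0, or nilpotent, forcing g = 0. *)
Lemma proj_indec_composition_factor Y S M (f : hom Y M) (g : hom Y S) y z :
  projective Y -> indecomposable Y -> simple S -> f y <> 0 -> g z <> 0 ->
  composition_factor S M.
Proof.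
move=> Yp Yi Ss fy gz; pose X := himg f (full_smod Y).
have [|c cE] := @corestrict _ _ _ _ X f; first by move=> x; apply/mem_himgf; exists x.
have cs : surj c.
  move=> u; have /mem_himgf[x xE] := incl_mem u; exists x.
  by apply: (inj_eqh (@incl_inj _ _ _ X)); rewrite cE.
have gs := simple_hom_surj Ss gz.
have [|h hE] := @factor_surj _ _ _ _ _ c g cs.
  move=> x cx; apply: NNPP => gx; have fx : f x = 0 by rewrite -cE cx hom0.
  have [|u uE] := @mem_incl _ _ _ (hker f) x; first exact/mem_hker.
  have ks : surj (comph g (incl (hker f))).
    by apply: (simple_hom_surj (x := u) Ss); rewrite homhE uE.
  have [k kE] := proj_lift g Yp ks.
  have geE w : g (comph (incl (hker f)) k w) = g w by rewrite -[RHS]kE !homhE.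
  have [ei|[n en]] := fitting_indec (comph (incl (hker f)) k) Yi.
    have [v vE] := inj_surj ei (leqnn _) y; apply: fy; rewrite -vE homhE.
    by apply/mem_hker/incl_mem.
  apply: gz; rewrite -(hom0 g) -(en z); elim: n {en} => //= n IH.
  by rewrite geE.
apply: (composition_factorI (X := X) (h := h)) => // s.
by have [x <-] := gs s; exists (c x); rewrite hE.
Qed.

End CompositionFactors.

(** * The semisimple quotient of the algebra by its radical *)

Section Radical.
Variables (K : fieldType) (A : fdalgType K).
Implicit Types M N P Q X Y Z S : rmod A.

Lemma jacobson_radical_exists : exists J : smod (regmod A), jacobson_radical J.
Proof.
have [||x a xP L Lm|J JP] := @smod_compr _ _ (regmod A) (fun x =>
  forall L : smod (regmod A), maximal_right_ideal L -> x \in L).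
- by move=> L _; apply: mem0v.
- by move=> k x y xP yP L Lm; rewrite memvD ?memvZ ?xP ?yP.
- by apply: smodP; apply: xP.
by exists J => x; apply: JP.
Qed.

Lemma maximal_ideal_simple (L : smod (regmod A)) : maximal_right_ideal L ->
  simple (quomod L).
Proof.
move=> [Ln Lm]; split.
  move=> /zero_rmodP z0; apply: Ln; apply: eq_fullv => x.
  have /proj_eq0 xL := z0 (proj L x); exact: xL.
move=> U; have [V VP] := hom_smod_preim (proj L) U.
have [|E|E] := Lm V.
- by apply/subvP => x /proj_eq0 x0; apply/VP; rewrite x0 mem0v.
- left; apply: eq_0v => z; have [x <-] := @proj_surj _ _ _ L z => /VP.
  by rewrite E => xL; apply/proj_eq0.
- right; apply: eq_fullv => z; have [x <-] := @proj_surj _ _ _ L z; apply/VP.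
  by rewrite E memvf.
Qed.

Lemma annihilator_maximal S (s : S) : simple S -> s <> 0 ->
  maximal_right_ideal (hker (acth s)).
Proof.
move=> Ss s0; have as1 : acth s (1 : A) = s by rewrite acthE ract1.
have ass : surj (acth s) by apply: (@simple_hom_surj _ _ (regmod A) S (acth s) (1 : A) Ss); rewrite as1.
split=> [E|L kL].
  apply: s0; rewrite -as1; apply/mem_hker; rewrite E; exact: memvf.
have [_ /(_ (himg (acth s) L))[E|E]] := Ss; [left|right].
  have sub (x : regmod A) : x \in L -> x \in hker (acth s).
    move=> xL; apply/mem_hker/eqP; rewrite -memv0 -E; apply/mem_himg; by exists x.
  by apply/eqP; rewrite eqEsubv kL andbT; apply/subvP => x; apply: sub.
have sub (x : regmod A) : x \in L.
  have /mem_himg[y yL xy] : acth s x \in himg (acth s) L by rewrite E memvf.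
  rewrite -(subrK y x) memvD //; apply: (subvP kL); rewrite memv_ker; apply/eqP.
  by rewrite homB xy subrr.
by apply: eq_fullv => x; apply: sub.
Qed.

Variable J : smod (regmod A).
Hypothesis JP : jacobson_radical J.

Let W := subquo (eA (1 : A)) (eJ 1 J).

(** [W] is eA/(e rad A) at e = 1, a subquotient by construction; here it is recovered as a quotient
    of [A] with kernel the radical. *)
Lemma radical_quotient : exists q : hom (regmod A) W,
  surj q /\ forall x, q x = 0 <-> x \in J.
Proof.
have [q [qs qk]] := subquo_map_sig (eA (1 : A)) (eJ 1 J).
have [|c cE] := @corestrict _ _ _ _ (eA (1 : A)) (idh (regmod A)).
  move=> x; rewrite idhE; apply/mem_himgf; exists x.
  by rewrite [RHS]lmulE mul1r.
exists (comph q c); split=> [w|x].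
  have [z <-] := qs w; exists (incl _ z); rewrite homhE; congr (q _).
  by apply: (inj_eqh (@incl_inj _ _ _ _)); rewrite cE idhE.
rewrite homhE qk cE idhE mem_himg; split=> [[y yJ ->]|xJ].
  by rewrite [X in X \in _]lmulE mul1r.
by exists x => //; rewrite [RHS]lmulE mul1r.
Qed.

(** Maps to simple modules separate the elements of X, because the radical is the intersection of
    the maximal right ideals. A submodule U of least dimension among the nonzero ones is simple; a
    map X -> S that is nonzero on U restricts to an isomorphism there and splits U off, so U is
    isomorphic to X. *)
Lemma semisimple_indec_summand X : indecomposable X -> retract X W -> simple X.
Proof.
move=> Xi [i [p pi]]; have [q [qs qk]] := radical_quotient.
have sep (x : X) : x <> 0 -> exists S (f : hom X S), simple S /\ f x <> 0.
  move=> x0; have [a aE] := qs (i x).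
  have [L Lm aL] : exists2 L : smod (regmod A), maximal_right_ideal L & ~ (a \in L).
    apply: NNPP => nex; apply: x0; rewrite -(pi x) -aE.
    have -> : q a = 0.
      apply/qk/JP => L Lm; apply: NNPP => aL; apply: nex; by exists L.
    by rewrite hom0.
  have [|f fE] := @factor_surj _ _ _ _ _ q (proj L) qs.
    by move=> b /qk/JP bL; apply/proj_eq0/bL.
  exists (quomod L), (comph f i); split; first exact: maximal_ideal_simple.
  by rewrite homhE -aE fE => /proj_eq0.
have [x0 x0n] := indec_nonzero Xi.
have [|U [u [uU un]] minU] := @ex_min_measure (smod X)
  (fun U => exists u, u \in U /\ u <> 0) (fun U => \dim U) (full_smod X).
  by exists x0; rewrite memvf.
have Us : simple (submod U).
  split=> [/zero_rmodP z0|V].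
    by apply: un; have [y <-] := mem_incl uU; rewrite (z0 y) hom0.
  have [[v [vV vn]]|V0] := classic (exists v, v \in V /\ v <> 0); last first.
    left; apply: eq_0v => v vV; apply: NNPP => vn; apply: V0; by exists v.
  right; have sub : (himg (incl U) V <= U)%VS.
    by apply/subvP => _ /mem_himg[z _ ->]; apply: incl_mem.
  have : (\dim U <= \dim (himg (incl U) V))%N.
    apply: minU; exists (incl U v); split; first by apply/mem_himg; exists v.
    by move/(@incl_inj _ _ _ U).
  rewrite (geq_leqif (dimv_leqif_sup sub)) => /subvP sub'.
  apply: eq_fullv => z; have /mem_himg[w wV zw] := sub' _ (incl_mem z).
  by rewrite (inj_eqh (@incl_inj _ _ _ U) zw).
have [S [f [Ss fu]]] := sep u un; have [y yE] := mem_incl uU.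
have fy : comph f (incl U) y <> 0 by rewrite homhE yE.
have [g [gK _]] := bij_inv (simple_hom_inj Us fy) (simple_hom_surj Ss fy).
apply: (simple_iso _ Us); apply: indec_retract_iso => //; first by case: Us.
by exists (incl U), (comph g f) => z; rewrite homhE -[RHS]gK homhE.
Qed.

Lemma nonzero_component n F M S (f : hom M S) : iso M (bigdsum n F) ->
  (exists x, f x <> 0) ->
  exists2 i, (i < n)%N & exists (g : hom (F i) S) x, g x <> 0.
Proof.
move=> /isoP[h [k [hK kK]]] [x fx]; apply: NNPP => nex; apply: fx.
rewrite -(hK x) [h x]bd_sum !hom_sum big1 // => i _.
apply: NNPP => ne; apply: nex; exists i => //.
by exists (comph f (comph k (bd_in n F i))), (bd_pr n F i (h x)); rewrite !homhE.
Qed.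

Lemma semisimple_summandP S : indecomposable S /\ direct_summand S W <-> simple S.
Proof.
split=> [[Si /retractP]|Ss]; first exact: semisimple_indec_summand.
split; first exact: simple_indec.
have [q [qs qk]] := radical_quotient; have [s s0] := simple_nonzero Ss.
have [|g gE] := @factor_surj _ _ _ _ _ q (acth s) qs.
  by move=> a /qk/JP aJ; apply/mem_hker/aJ/annihilator_maximal.
have [n [F [Fi WF]]] := indec_decomposition W.
have [|i lt [h [x hx]]] := nonzero_component (f := g) WF.
  by exists (q (1 : A)); rewrite gE acthE ract1.
have FW : retract (F i) W.
  apply: (retract_trans (retract_bd F lt)); exact/iso_retract/iso_sym.
apply/retractP; apply: (retract_trans _ FW); apply/iso_retract/iso_sym.
by apply: simple_hom_iso hx => //; apply: semisimple_indec_summand => //; apply: Fi.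
Qed.

End Radical.

(** * Sincerity and primitive idempotents *)

Section Sincerity.
Variables (K : fieldType) (A : fdalgType K).
Implicit Types M N P Q X Y Z S : rmod A.

Lemma support_idempotent1 M : (forall S, simple S -> composition_factor S M) ->
  support_idempotent (1 : A) M.
Proof.
move=> sincM; split; first exact: mulr1.
have [J JP] := jacobson_radical_exists A; exists J => // S.
rewrite semisimple_summandP //; split; first exact: sincM.
exact: composition_factor_simple.
Qed.

(** Some indecomposable summand Y of the regular module maps nontrivially to S; together with a
    nonzero map Y -> M this makes S a composition factor of M. *)
Lemma sincere_of_projectives M :
  (forall Y, indecomposable Y -> retract Y (regmod A) -> exists (f : hom Y M) x, f x <> 0) ->
  forall S, simple S -> composition_factor S M.
Proof.
move=> YM S Ss; have [s s0] := simple_nonzero Ss.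
have [n [F [Fi AF]]] := indec_decomposition (regmod A).
have [|i lt [g [z gz]]] := nonzero_component (f := acth s) AF.
  by exists (1 : A); rewrite acthE ract1.
have FA : retract (F i) (regmod A).
  apply: (retract_trans (retract_bd F lt)); exact/iso_retract/iso_sym.
have [f [y fy]] := YM (F i) (Fi i lt) FA.
apply: (proj_indec_composition_factor _ (Fi i lt) Ss fy gz).
exact: proj_retract FA (@proj_regmod _ A).
Qed.

(** An endomorphism p of eA is left multiplication by f = p(e), an element of eAe. If p is
    idempotent, then e = f + (e - f) is an orthogonal decomposition. *)
Lemma primitive_indec (e : A) : primitive_idempotent e -> indecomposable (submod (eA e)).
Proof.
move=> [ee e0 prim].
have memE (x : A) : x \in eA e <-> e * x = x.
  rewrite mem_himgf; split=> [[y ->]|xE]; last by exists x; rewrite [RHS]lmulE.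
  by rewrite [X in _ * X = X]lmulE mulrA ee.
have [u uE] : exists u, incl (eA e) u = e by apply: mem_incl; apply/memE.
have uA (x : submod (eA e)) : x = ract u (incl _ x : A).
  apply: (inj_eqh (@incl_inj _ _ _ (eA e))); rewrite homP uE ract_reg.
  by have /memE -> := incl_mem x.
apply: indecI => [/zero_rmodP z0|p pp]; first by apply: e0; rewrite -uE (z0 u) hom0.
pose f : A := incl _ (p u).
have fe : e * f = f by apply/memE/incl_mem.
have ef : f * e = f.
  rewrite /f -[LHS]/(ract (incl (eA e) (p u)) e) -!homP; congr (incl _ (p _)).
  by rewrite [RHS]uA uE.
have ff : f * f = f.
  rewrite {1}/f -[LHS]/(ract (incl (eA e) (p u)) f) -!homP; rewrite /f -uA.
  by rewrite pp.
have pE x : p x = ract (p u) (incl _ x : A) by rewrite {1}(uA x) homP.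
have [|||||f0|g0] := prim f (e - f).
- exact: ff.
- by rewrite /idempotent mulrBl !mulrBr ee fe ef ff subrr subr0.
- by rewrite mulrBr ef ff subrr.
- by rewrite mulrBl fe ff subrr.
- by rewrite addrC subrK.
- left=> x; rewrite pE; apply: (@incl_inj _ _ _ (eA e)).
  by rewrite homP ract_reg -/f f0 mul0r.
right=> x; rewrite pE [RHS]uA; congr (ract _ _).
apply: (inj_eqh (@incl_inj _ _ _ (eA e))); rewrite uE -/f.
by apply/eqP; rewrite eq_sym -subr_eq0; apply/eqP.
Qed.

Lemma proj_eA (e : A) : idempotent e -> projective (submod (eA e)).
Proof.
move=> ee; apply: proj_retract (@proj_regmod _ A).
have [|c cE] := @corestrict _ _ _ _ (eA e) (lmul_hom e).
  by move=> x; apply/mem_himgf; exists x.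
exists (incl _), c => x; apply: (inj_eqh (@incl_inj _ _ _ (eA e))); rewrite cE.
have /mem_himgf[y ->] := incl_mem x.
by rewrite /= !lmulE mulrA ee.
Qed.

(** Suppose every e_i acts nontrivially on X. For a simple S some e_i acts nontrivially on S, so
    e_iA has nonzero maps to both S and X, and S is a composition factor of X. Then X would witness
    sincerity. *)
Lemma nonsincere_annihilated n (e : 'I_n -> A) X : complete_primitive_orthogonal e ->
  ~ sincere A -> indecomposable X -> exists i, forall x : X, ract x (e i) = 0.
Proof.
move=> [ep _ e1] ns Xi; apply: NNPP => nex; apply: ns; exists X; split=> // S Ss.
have [s s0] := simple_nonzero Ss.
have [i si] : exists i, ract s (e i) <> 0.
  apply: NNPP => nx; apply: s0; rewrite -(ract1 s) -e1 ract_sumr big1 // => i _.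
  by apply: NNPP => si; apply: nx; exists i.
have [x xi] : exists x : X, ract x (e i) <> 0.
  apply: NNPP => nx; apply: nex; exists i => x; apply: NNPP => xi; apply: nx.
  by exists x.
have [ee _ _] := ep i.
have [u uE] : exists u, incl (eA (e i)) u = e i.
  by apply: mem_incl; apply/mem_himgf; exists (1 : A); rewrite [RHS]lmulE mulr1.
apply: (proj_indec_composition_factor (Y := submod (eA (e i)))
  (f := comph (acth x) (incl _)) (g := comph (acth s) (incl _)) (y := u) (z := u)) => //.
- exact: proj_eA.
- exact: primitive_indec.
- by rewrite homhE uE acthE.
- by rewrite homhE uE acthE.
Qed.

End Sincerity.

(** * Modules over quotient algebras *)

Section InflationTheory.
Variables (K : fieldType) (A : fdalgType K) (I : ideal A).
Implicit Types M Y Z : rmod A.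
Implicit Types N W : rmod (quoalg I).

Definition killed M := forall (x : M) a, a \in I -> ract x a = 0.

Lemma inflateE N (x : inflate N) a : ract x a = ract (x : N) (quopi I a : quoalg I).
Proof. by []. Qed.

Lemma quoalg_mulE (a b : A) :
  (quopi I a : FdAlgebra.sort (quoalg I)) * (quopi I b : FdAlgebra.sort (quoalg I)) =
  quopi I (a * b).
Proof. exact: qmul_pi. Qed.

Lemma killed_inflate N : killed (inflate N).
Proof.
move=> x a aI; rewrite inflateE.
have -> : quopi I a = 0 by apply/eqP; rewrite quopi_eq0.
exact: (@ract0r K (quoalg I) N x).
Qed.

Lemma inflate_homP N N' (f : hom N N') (x : inflate N) a :
  (f : 'Hom(inflate N, inflate N')) (ract x a) =
  ract ((f : 'Hom(inflate N, inflate N')) x) a.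
Proof. by rewrite !inflateE -homP. Qed.
Definition inflate_hom N N' (f : hom N N') : hom (inflate N) (inflate N') :=
  Hom (@inflate_homP N N' f).

Lemma deflate_homP N N' (f : hom (inflate N) (inflate N')) (x : N) (b : quoalg I) :
  (f : 'Hom(N, N')) (ract x b) = ract ((f : 'Hom(N, N')) x) b.
Proof.
have := homP f (x : inflate N) (quorep b); rewrite !inflateE quorepK.
by apply.
Qed.
Definition deflate_hom N N' (f : hom (inflate N) (inflate N')) : hom N N' :=
  Hom (@deflate_homP N N' f).

Section Deflate.
Variables (M : rmod A) (Mk : killed M).

Lemma killed_quorep (x : M) a : ract x (quorep (quopi I a)) = ract x a.
Proof.
apply/eqP; rewrite -subr_eq0 -linearB /=; apply/eqP/Mk; exact: quorepP.
Qed.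

Definition defl_act (x : M) (b : (quoalg I : fdalgType K)) : M := ract x (quorep b).

Fact defl_linl b : linear (defl_act^~ b).
Proof. by move=> k x y; rewrite /defl_act ractPl. Qed.
Fact defl_linr x : linear (defl_act x).
Proof.
move=> k b c; rewrite /defl_act -ractPr; congr (ract x _).
Qed.
Fact defl_act1 x : defl_act x 1 = x.
Proof. by rewrite /defl_act killed_quorep ract1. Qed.
Fact defl_actM x b c : defl_act x (b * c) = defl_act (defl_act x b) c.
Proof.
rewrite /defl_act -[in LHS](quorepK b) -[in LHS](quorepK c) quoalg_mulE killed_quorep.
exact: ractM.
Qed.

Definition deflate : rmod (quoalg I) := RMod defl_linl defl_linr defl_act1 defl_actM.

Lemma inflate_deflate : exists (f : hom (inflate deflate) M) (g : hom M (inflate deflate)),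
  cancel f g /\ cancel g f.
Proof.
have fP (x : inflate deflate) a :
    (\1%VF : 'Hom(inflate deflate, M)) (ract x a) = ract ((\1%VF : 'Hom(inflate deflate, M)) x) a.
  by rewrite !id_lfunE; apply: killed_quorep.
have gP (x : M) a :
    (\1%VF : 'Hom(M, inflate deflate)) (ract x a) = ract ((\1%VF : 'Hom(M, inflate deflate)) x) a.
  by rewrite !id_lfunE; symmetry; apply: killed_quorep.
exists (Hom fP), (Hom gP); split=> x /=; by rewrite !id_lfunE.
Qed.

Lemma inflate_deflate_iso : iso (inflate deflate) M.
Proof. by have [f [g fg]] := inflate_deflate; apply/isoP; exists f, g. Qed.

End Deflate.

Lemma iso_inflate N N' : iso N N' <-> iso (inflate N) (inflate N').
Proof.
split=> /isoP[f [g [fK gK]]]; apply/isoP; first by exists (inflate_hom f), (inflate_hom g).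
by exists (deflate_hom f), (deflate_hom g).
Qed.

Lemma retract_inflate N N' : retract N N' <-> retract (inflate N) (inflate N').
Proof.
split=> -[i [p pi]]; first by exists (inflate_hom i), (inflate_hom p).
by exists (deflate_hom i), (deflate_hom p).
Qed.

Lemma zero_rmod_inflate N : zero_rmod N <-> zero_rmod (inflate N).
Proof. by rewrite !zero_rmodP. Qed.

Lemma indec_inflate N : indecomposable N <-> indecomposable (inflate N).
Proof.
split=> Ni; apply: indecI.
- by move=> /zero_rmod_inflate; case: Ni.
- by move=> f ff; apply: (indec_idem (f := deflate_hom f) Ni).
- by move=> /zero_rmod_inflate; case: Ni.
- by move=> f ff; apply: (indec_idem (f := inflate_hom f) Ni).
Qed.

Lemma killed_hom M M' (f : hom M M') : inj f -> killed M' -> killed M.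
Proof. by move=> fi M'k x a aI; apply: fi; rewrite homP M'k. Qed.

Lemma killed_surj M M' (f : hom M M') : surj f -> killed M -> killed M'.
Proof. by move=> fs Mk y a aI; have [x <-] := fs y; rewrite -homP Mk // hom0. Qed.

Lemma killed_retract M M' : retract M M' -> killed M' -> killed M.
Proof.
move=> [i [p pi]]; apply: (killed_hom (f := i)) => x ix.
by rewrite -(pi x) ix hom0.
Qed.

Lemma killed_gen (C : rmod A -> Prop) M : (forall X, C X -> killed X) -> gen C M -> killed M.
Proof.
move=> Ck CM; have [||x a xP|U UP] := @smod_compr _ _ M (fun x => forall a, a \in I -> ract x a = 0).
- by move=> a _; apply: ract0l.
- by move=> k x y xP yP a aI; rewrite ractPl xP // yP // scaler0 addr0.
- by move=> b bI; rewrite -ractM; apply: xP; apply: idealMl.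
by move=> x; apply/UP; apply: CM => X h y CX; apply/UP => a aI; rewrite -homP Ck ?hom0.
Qed.

Lemma gen_inflate N W : gen (eq N) W <-> gen (eq (inflate N)) (inflate W).
Proof.
split=> NW U UP w.
  have actU (x : W) (b : (quoalg I : fdalgType K)) :
      x \in (U : {vspace W}) -> ract x b \in (U : {vspace W}).
    by move=> xU; have := smodP (quorep b) (xU : (x : inflate W) \in U); rewrite inflateE quorepK.
  apply: (NW (SMod actU)) => X h x XE; subst X.
  exact: (UP _ (inflate_hom h) x erefl).
have actU (x : inflate W) a :
    x \in (U : {vspace inflate W}) -> ract x a \in (U : {vspace inflate W}).
  by move=> xU; rewrite inflateE; apply: (smodP (_ : quoalg I) xU).
apply: (NW (SMod actU)) => X h x XE; subst X.
exact: (UP _ (deflate_hom h) x erefl).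
Qed.

(** A lifting problem over the quotient algebra is one over [A], on the same underlying spaces. *)
Lemma rigid_deflate N : rigid (inflate N) (eq (inflate N)) -> rigid N (eq N).
Proof.
move=> NR Y Z f h fs Nk.
have [||h' hE] := NR _ _ (inflate_hom f) (inflate_hom h).
- exact: fs.
- have [|c cE] := @corestrict _ _ _ _ (hker (inflate_hom f)) (inflate_hom (incl (hker f))).
    by move=> x; apply/mem_hker; have /mem_hker := incl_mem (x : submod (hker f)).
  apply: (gen_surj (f := c)); last exact: (gen_inflate N (submod (hker f))).1 Nk.
  move=> y; have /mem_hker yk := incl_mem y.
  have [|x xE] := @mem_incl _ _ _ (hker f) (incl _ y : Y); first exact/mem_hker.
  by exists x; apply: (inj_eqh (@incl_inj _ _ _ (hker (inflate_hom f)))); rewrite cE.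
by exists (deflate_hom h').
Qed.

End InflationTheory.

(** * Extensions of modules killed by an idempotent *)

Section IdempotentQuotient.
Variables (K : fieldType) (A : fdalgType K) (e : A).
Implicit Types M Y Z : rmod A.

Local Notation B := (quoalg (AeA e)).

Lemma killed_AeA M : (forall x : M, ract x e = 0) -> killed (AeA e) M.
Proof.
move=> Me x a aI.
have /subvP sub : (AeA_vs e <= lker (linfun (ract x)))%VS.
  apply: AeA_least => b c; rewrite memv_ker lfunE /=.
  by rewrite -mulrA !ractM Me ract0l.
by have := sub a aI; rewrite memv_ker lfunE /= => /eqP.
Qed.

Hypothesis ee : idempotent e.

(** The element y e lies in ker f because Z is killed, so y e = (y e) e = 0. *)
Lemma killed_extension Y Z (f : hom Y Z) : killed (AeA e) Z ->
  killed (AeA e) (submod (hker f)) -> killed (AeA e) Y.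
Proof.
move=> Zk Kk; apply: killed_AeA => y.
have eI : e \in AeA e by have := mem_AeA e 1 1; rewrite mul1r mulr1.
have [|k kE] := @mem_incl _ _ _ (hker f) (ract y e).
  by apply/mem_hker; rewrite homP Zk.
by rewrite -ee ractM -kE -homP Kk // hom0.
Qed.

(* Modules killed by an idempotent ideal are closed under extensions, so
   [Ext^1] may be computed over the quotient algebra. *)
Lemma rigid_inflate (N : rmod B) : rigid N (eq N) -> rigid (inflate N) (eq (inflate N)).
Proof.
move=> NR Y Z f h fs Nk.
(* Z need not be killed by e. The problem is cut down to the image Z' of h and its preimage Y', an
   extension of Z' by ker f; both are killed and descend to the quotient algebra. *)
pose Z' := himg h (full_smod (inflate N)); have [Y' Y'P] := hom_smod_preim f Z'.
have [|h1 h1E] := @corestrict _ _ _ _ Z' h; first by move=> x; apply/mem_himgf; exists x.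
have Z'k : killed (AeA e) (submod Z').
  apply: (killed_surj (f := h1)) (@killed_inflate _ _ _ N) => z.
  have /mem_himgf[x xE] := incl_mem z; exists x.
  by apply: (inj_eqh (@incl_inj _ _ _ Z')); rewrite h1E.
have [|f1 f1E] := @corestrict _ _ _ _ Z' (comph f (incl Y')).
  by move=> y; rewrite homhE; apply/Y'P/incl_mem.
have f1s : surj f1.
  move=> z; have [y yE] := fs (incl _ z).
  have [|u uE] := @mem_incl _ _ _ Y' y; first by apply/Y'P; rewrite yE; apply: incl_mem.
  by exists u; apply: (inj_eqh (@incl_inj _ _ _ Z')); rewrite f1E homhE uE.
have [|c cE] := @corestrict _ _ _ _ Y' (incl (hker f)).
  by move=> y; apply/Y'P; have /mem_hker -> := incl_mem y; apply: mem0v.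
have [|c1 c1E] := @corestrict _ _ _ _ (hker f1) c.
  move=> y; apply/mem_hker/(@incl_inj _ _ _ Z'); rewrite f1E homhE cE.
  exact/mem_hker/incl_mem.
have Nk1 : gen (eq (inflate N)) (submod (hker f1)).
  apply: (gen_surj (f := c1) _ Nk) => y; have /mem_hker y0 := incl_mem y.
  have [|x xE] := @mem_incl _ _ _ (hker f) (incl Y' (incl _ y)).
    by apply/mem_hker; rewrite -comphE -f1E y0 hom0.
  exists x; apply: (inj_eqh (@incl_inj _ _ _ (hker f1))); rewrite c1E.
  by apply: (inj_eqh (@incl_inj _ _ _ Y')); rewrite cE.
have Y'k : killed (AeA e) (submod Y').
  apply: (killed_extension (f := f1)) => //.
  by apply: killed_gen Nk1 => X <-; apply: killed_inflate.
have [u [u' [uK u'K]]] := inflate_deflate Y'k.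
have [v [v' [vK v'K]]] := inflate_deflate Z'k.
pose f2 := deflate_hom (comph v' (comph f1 u)).
have f2E x : f2 x = v' (f1 (u x)) by rewrite -[LHS]/(comph v' (comph f1 u) x) !homhE.
have f2s : surj f2.
  move=> z; have [y yE] := f1s (v z); exists (u' y).
  by rewrite f2E u'K yE vK.
have Nk2 : gen (eq N) (submod (hker f2)).
  apply/gen_inflate.
  have [|x|g gE] := @factor_inj _ _ (submod (hker f1)) (inflate (submod (hker f2)))
      (inflate (deflate Y'k)) (inflate_hom (incl (hker f2))) (comph u' (incl (hker f1))).
  - exact: (@incl_inj _ _ _ (hker f2)).
  - have [|y yE] := @mem_incl _ _ _ (hker f2) (u' (incl _ x)).
      apply/mem_hker; rewrite f2E u'K; have /mem_hker -> := incl_mem x; exact: (hom0 v').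
    by exists y; rewrite homhE -yE.
  apply: (gen_surj (f := g)) Nk1 => y.
  have /mem_hker := incl_mem (y : submod (hker f2)); rewrite f2E => E.
  have [|x xE] := @mem_incl _ _ _ (hker f1) (u (incl (hker f2) y)).
    by apply/mem_hker; rewrite -(v'K (f1 _)) E hom0.
  exists x; apply: (@inj_eqh _ _ _ _ (inflate_hom (incl (hker f2)))).
    exact: (@incl_inj _ _ _ (hker f2)).
  by rewrite gE homhE xE uK.
have [h' h'E] := NR _ _ f2 (deflate_hom (comph v' h1)) f2s Nk2.
exists (comph (incl Y') (comph u (inflate_hom h'))) => x.
rewrite !homhE -[f (incl Y' _)]comphE -f1E -h1E; congr (incl Z' _).
have := h'E x; rewrite f2E => /(congr1 v); rewrite v'K => ->.
by rewrite -[deflate_hom _ x]/(comph v' h1 x) comphE v'K.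
Qed.

End IdempotentQuotient.

(** * Finiteness *)

Section FiniteClasses.
Variables (K : fieldType) (A : fdalgType K).
Implicit Types M N P Q X Y Z : rmod A.

Definition finite_class (P : rmod A -> Prop) :=
  exists (J : finType) (L : J -> rmod A), forall X, P X -> exists j, iso X (L j).

Lemma finite_class_ord (P : rmod A -> Prop) : finite_class P <->
  exists m (L : 'I_m -> rmod A), forall X, P X -> exists i, iso X (L i).
Proof.
split=> [[J [L PL]]|[m [L PL]]]; last by exists 'I_m, L.
exists #|J|, (fun i => L (enum_val i)) => X /PL[j jE].
by exists (enum_rank j); rewrite enum_rankK.
Qed.

Lemma finite_class_union (J : finType) (P : J -> rmod A -> Prop) :
  (forall j, finite_class (P j)) -> finite_class (fun X => exists j, P j X).
Proof.
move=> Pfin; pose s j := constructive_indefinite_description _ (Pfin j).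
pose t j := constructive_indefinite_description _ (svalP (s j)).
exists {j : J & sval (s j)}, (fun u => sval (t (tag u)) (tagged u)) => X [j Xj].
by have [i iE] := svalP (t j) X Xj; exists (Tagged (fun j => sval (s j)) i).
Qed.

Definition tau_rigid_finite := finite_class (fun X => indecomposable X /\ rigid X (eq X)).

Lemma rigid_self_retract X Y : retract X Y -> rigid Y (eq Y) -> rigid X (eq X).
Proof.
move=> XY Yr; apply: (rigid_retract XY); apply: rigid_sub Yr => _ <-.
by have [i [p pi]] := XY; apply: (gen_surj (f := p)) (gen_self erefl) => x; exists (i x).
Qed.

Lemma rigid_self_iso X Y : iso X Y -> rigid Y (eq Y) -> rigid X (eq X).
Proof. by move=> /iso_retract; apply: rigid_self_retract. Qed.

(** The definition supplies tau-rigidity over A/A(1-e)A; since 1 - e is idempotent, [rigid_inflate]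
    carries it to A. *)
Lemma tau_tilting_rigid M : tau_tilting M -> rigid M (eq M).
Proof.
move=> [e [[ee _] [N [MN /tau_rigidP Nr _]]] _]; apply: (rigid_self_iso MN).
apply: rigid_inflate Nr; rewrite /idempotent mulrBl mul1r mulrBr mulr1 ee.
by rewrite subrr subr0.
Qed.

Lemma num_summands_deflate (I : ideal A) M (N : rmod (quoalg I)) n :
  num_summands M n -> iso M (inflate N) -> num_summands N n.
Proof.
move=> [X [X1 X2 X3]] MN.
have Xk i : killed I (X i).
  have [_ /retractP XM] := X1 i; apply: (killed_retract XM).
  by apply: (killed_retract (iso_retract MN)); apply: killed_inflate.
have XE i := inflate_deflate_iso (Xk i).
exists (fun i => deflate (Xk i)); split.
- move=> i; have [Xi /retractP XM] := X1 i; split.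
    by apply/indec_inflate; apply: indec_iso Xi; apply: iso_sym.
  apply/retractP/retract_inflate; apply: (retract_trans (iso_retract (XE i))).
  exact: retract_trans XM (iso_retract MN).
- move=> i j /iso_inflate E; apply: X2; apply: (iso_trans (iso_sym (XE i))).
  exact: iso_trans E (XE j).
move=> Y /indec_inflate Yi /retractP/retract_inflate YN.
have [|i iE] := X3 _ Yi; first exact/retractP/(retract_trans YN)/iso_retract/iso_sym.
by exists i; apply/iso_inflate; apply: (iso_trans iE); apply/iso_sym.
Qed.

Lemma AeA1 : AeA (1 - 1 : A) = 0%VS :> {vspace A}.
Proof.
apply/eqP; rewrite -subv0; apply: AeA_least => a b.
by rewrite subrr mulr0 mul0r mem0v.
Qed.

Lemma regmod_inflate (I : ideal A) : I = 0%VS :> {vspace A} ->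
  iso (regmod A) (inflate (regmod (quoalg I))).
Proof.
move=> I0; pose f : regmod A -> inflate (regmod (quoalg I)) := quopi I.
have lin : linear f by exact: quopi_is_linear.
have act (x : regmod A) a : f (ract x a) = ract (f x) a.
  by rewrite inflateE /f !ract_reg quoalg_mulE.
apply: (iso_bij (f := mkhom lin act)) => [x|y].
  by rewrite mkhomE => /eqP; rewrite quopi_eq0 I0 memv0 => /eqP.
by exists (quorep y); rewrite mkhomE /f quorepK.
Qed.

(** At e = 1 the ideal A(1-e)A is zero, but A_M is still formally a quotient algebra, so the module,
    its rigidity and the counts are transported along the isomorphism with A. *)
Lemma tau_tilting_of_count M n : rigid M (eq M) ->
  (forall S, simple S -> composition_factor S M) ->
  num_summands M n -> num_summands (regmod A) n -> tau_tilting M.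
Proof.
move=> Mr Ms Mn An; have Mk : killed (AeA (1 - 1 : A)) M.
  by move=> x a; rewrite AeA1 memv0 => /eqP->; apply: ract0r.
have ME := iso_sym (inflate_deflate_iso Mk).
exists 1; last exact: AeA1.
split; first exact: support_idempotent1.
exists (deflate Mk); split=> //.
  apply/tau_rigidP/rigid_deflate; exact: rigid_self_iso (iso_sym ME) Mr.
exists n; first exact: Mn.
by apply: (num_summands_deflate An); apply: regmod_inflate; apply: AeA1.
Qed.

Definition ord_family n (T : 'I_n -> rmod A) (i : nat) : rmod A :=
  if insub i is Some j then T j else zeromod A.

Lemma ord_familyE n (T : 'I_n -> rmod A) (i : 'I_n) : ord_family T i = T i.
Proof. by rewrite /ord_family valK. Qed.

Lemma ord_family_lt n (T : 'I_n -> rmod A) i (lt : (i < n)%N) :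
  ord_family T i = T (Ordinal lt).
Proof. exact: (ord_familyE T (Ordinal lt)). Qed.

Lemma num_summands_bigdsum n (T : 'I_n -> rmod A) :
  (forall i, indecomposable (T i)) -> (forall i j, iso (T i) (T j) -> i = j) ->
  num_summands (bigdsum n (ord_family T)) n.
Proof.
move=> Ti Tinj; exists T; split=> // [i|Y Yi /retractP YT].
  split=> //; apply/retractP; rewrite -ord_familyE; exact: retract_bd.
have [i lt] := indec_retract_bd Yi YT; rewrite (ord_family_lt T lt) => YTi.
by exists (Ordinal lt); apply: indec_retract_iso => //; case: Yi.
Qed.

(** Each T_k of the completion is taken once, which makes the sum basic; X is among the T_k, being
    an indecomposable retract of itself. *)
Lemma summand_of_tau_tilting X : indecomposable X -> rigid X (eq X) ->
  exists M, [/\ tau_tilting M, basic_module M & retract X M].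
Proof.
move=> Xi Xr; have [t [T [T1 T2 At T3 T4]]] := tau_tilting_completion Xr.
pose F := ord_family T; exists (bigdsum t F).
have retrT k : retract (T k) (bigdsum t F) by rewrite -ord_familyE; apply: retract_bd.
have Trig k : rigid (T k) (eq (bigdsum t F)).
  apply: rigid_sub (T1 k).2 => _ <- U UP w; rewrite [w]bd_sum.
  apply: memv_suml => i _; apply: UP; exists i; rewrite ?inE //.
  exact: ord_familyE.
split.
- apply: (tau_tilting_of_count (n := t)) => //.
  + by apply: rigid_bigdsum => i lt; rewrite /F (ord_family_lt T lt).
  + apply: sincere_of_projectives => Y Yi YA; have [k [f [x fx]]] := T4 Y Yi YA.
    have [i [p pi]] := retrT k; exists (comph i f), x => ix; apply: fx.
    by rewrite -(pi (f x)) -(comphE i f) ix hom0.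
  + by apply: num_summands_bigdsum => // k; case: (T1 k).
- exists t, F; split; last exact: iso_refl.
    by move=> i lt; rewrite /F (ord_family_lt T lt); case: (T1 (Ordinal lt)).
  move=> i j il jl; rewrite /F (ord_family_lt T il) (ord_family_lt T jl).
  by move=> /T2 [].
have [k /iso_retract Xk] := T3 X Xi (retract_refl X).
exact: retract_trans Xk (retrT k).
Qed.

Lemma tau_rigid_finite_of_tilting : tau_tilting_finite A -> tau_rigid_finite.
Proof.
move=> [m [X XP]].
have [|J [L LP]] := @finite_class_union 'I_m (fun i Y => indecomposable Y /\ retract Y (X i)).
  move=> i; have [t [T [_ _ T3]]] := summand_list_exists (X i).
  by exists 'I_t, T => Y [Yi YX]; apply: T3.
exists J, L => Y [Yi Yr]; apply: LP.
have [M [Mt Mb YM]] := summand_of_tau_tilting Yi Yr.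
have [i iE] := XP M Mt Mb; exists i; split=> //.
exact: retract_trans YM (iso_retract iE).
Qed.

(** The summands of a basic tau-tilting module are pairwise non-isomorphic and each is isomorphic to
    one of n representatives. A length at most n and a choice of representatives therefore determine
    the module. *)
Lemma tilting_finite_of_rigid : tau_rigid_finite -> tau_tilting_finite A.
Proof.
move=> /finite_class_ord[n [L LP]].
suff /finite_class_ord[m [X XP]] : finite_class (fun M => tau_tilting M /\ basic_module M).
  by exists m, X => M Mt Mb; apply: XP.
exists ('I_n.+1 * {ffun 'I_n -> 'I_n})%type,
  (fun u : 'I_n.+1 * {ffun 'I_n -> 'I_n} => bigdsum u.1 (ord_family (fun i => L (u.2 i)))) => M [Mt [m [X [Xi Xinj MX]]]].
have Lex (i : 'I_m) : exists k, iso (X i) (L k).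
  apply: LP; split; first exact: Xi.
  apply: rigid_self_retract (tau_tilting_rigid Mt).
  exact: retract_trans (retract_bd X (ltn_ord i)) (iso_retract (iso_sym MX)).
pose s i := constructive_indefinite_description _ (Lex i); pose g i := sval (s i).
have gE (i : 'I_m) : iso (X i) (L (g i)) by apply: (svalP (s i)).
have ginj : injective g.
  move=> i j gij; apply: val_inj; apply: (Xinj _ _ (ltn_ord i) (ltn_ord j)).
  by apply: (iso_trans (gE i)); rewrite gij; apply: iso_sym.
have mn : (m <= n)%N by have := leq_card g ginj; rewrite !card_ord.
have mn1 : (m < n.+1)%N by [].
(* Only positions below m are read; past them i itself is an available default. *)
pose h (i : 'I_n) : 'I_n := if insub (val i) is Some j then g j else i.
exists (Ordinal mn1, [ffun i => h i]); apply: (iso_trans MX); apply: bigdsum_iso => i lt.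
rewrite (ord_family_lt _ (leq_trans lt mn)) ffunE /h /= insubT.
exact: gE (Ordinal lt).
Qed.

End FiniteClasses.

(** * Transfer of finiteness between the algebra and its quotients *)

Section Quotients.
Variables (K : fieldType) (A : fdalgType K).
Implicit Types M N P Q X Y Z : rmod A.

Lemma tau_rigid_finite_quotient (e : A) : idempotent e ->
  tau_rigid_finite A -> tau_rigid_finite (quoalg (AeA e)).
Proof.
move=> ee [J [L LP]].
(* A representative that is not killed by AeA is replaced by 0. The representative matching an
   inflated module is killed, so the default is never the one required. *)
pose D j : rmod (quoalg (AeA e)) :=
  if excluded_middle_informative (killed (AeA e) (L j)) is left k then deflate k
  else zeromod _.
exists J, D => X [Xi Xr].
have [|j Xj] := LP (inflate X); first by split; [apply/indec_inflate|apply: rigid_inflate].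
exists j; rewrite /D; case: excluded_middle_informative => [k|[]].
  by apply/iso_inflate; apply: (iso_trans Xj); apply/iso_sym/inflate_deflate_iso.
by apply: (killed_retract (iso_retract (iso_sym Xj))); apply: killed_inflate.
Qed.

Lemma tau_rigid_finite_nonsincere n (e : 'I_n -> A) :
  complete_primitive_orthogonal e -> ~ sincere A ->
  (forall i, tau_rigid_finite (quoalg (AeA (e i)))) -> tau_rigid_finite A.
Proof.
move=> ce ns fin.
have [|J [L LP]] := @finite_class_union K A 'I_n (fun i X =>
  exists N : rmod (quoalg (AeA (e i))), [/\ indecomposable N, rigid N (eq N) & iso X (inflate N)]).
  move=> i; have [J [L LP]] := fin i; exists J, (fun j => inflate (L j)) => X [N [Ni Nr XN]].
  have [j jE] := LP N (conj Ni Nr); exists j; apply: (iso_trans XN).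
  exact/iso_inflate.
exists J, L => X [Xi Xr]; apply: LP.
have [i /killed_AeA Xk] := nonsincere_annihilated ce ns Xi.
have XE := inflate_deflate_iso Xk.
exists i, (deflate Xk); split; last exact: iso_sym.
  by apply/indec_inflate; apply: indec_iso Xi; apply: iso_sym.
by apply: rigid_deflate; apply: rigid_self_iso Xr.
Qed.

End Quotients.

Theorem theorem1p2 (K : closedFieldType) (A : fdalgType K)
    (basicA : basic_algebra A) (n : nat) (e : 'I_n -> A)
    (completeE : complete_primitive_orthogonal e)
    (nonsincereA : ~ sincere A) :
  tau_tilting_finite A <->
  forall i : 'I_n, tau_tilting_finite (quoalg (AeA (e i))).
Proof.
split=> [Afin i|fin].
  apply: tilting_finite_of_rigid; apply: tau_rigid_finite_quotient.
    by have [prim _ _] := completeE; have [] := prim i.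
  exact: tau_rigid_finite_of_tilting.
apply: tilting_finite_of_rigid.
apply: (tau_rigid_finite_nonsincere completeE nonsincereA) => i.
exact: tau_rigid_finite_of_tilting.
Qed.
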